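(* A graph $G$ is the square of a connected odd-sun-free split graph if and only if $G$ is balanced and $\left|\bigcap\mathcal C(G)\right|\ge|\mathcal C(G)|$. In particular, there is a polynomial time algorithm to recognize graphs that admit an odd-sun-free split square root.
   Context: All graphs are finite and simple. The square $H^2$ of a graph $H$ is obtained from $H$ by adding an edge between any two distinct vertices at distance exactly two in $H$; $H$ is a square root of $H^2$. A split graph is a graph whose vertex set can be partitioned into a clique and an independent set. For $\ell\ge3$, the $\ell$-sun consists of an independent set $\{u_1,\dots,u_\ell\}$ and a clique $\{v_1,\dots,v_\ell\}$ with $u_i$ adjacent exactly to $v_i$ and $v_{i+1}$ (indices mod $\ell$); an odd sun is an $\ell$-sun with $\ell$ odd; odd-sun-free means no induced odd sun. $\mathcal C(G)$ is the set of inclusion-maximal cliques of $G$ and $\bigcap\mathcal C(G)$ their common intersection. A $0/1$ matrix is balanced if it has no square submatrix of odd order with exactly two 1's in each row and each column; a hypergraph is balanced if its vertex–hyperedge incidence matrix is balanced, equivalently if its bipartite vertex–hyperedge incidence graph has no induced cycle of length $2k$ for odd $k$. A graph $G$ is balanced if the hypergraph on $V(G)$ whose hyperedges are the maximal cliques of $G$ is balanced. *)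

(* Defs.v *)
From mathcomp Require Import all_boot all_order all_algebra.
Set Implicit Arguments.
Unset Strict Implicit.
Unset Printing Implicit Defensive.

Section Graphs.
Variable T : finType.
Implicit Types (e h : rel T) (K S : {set T}).

Definition simple_graph e : Prop := symmetric e /\ irreflexive e.

Definition has_walk e (x y : T) (k : nat) : bool :=
  [exists p : k.-tuple T, path e x p && (last x p == y)].

Definition at_distance e (x y : T) (k : nat) : bool :=
  has_walk e x y k && [forall j : 'I_k, ~~ has_walk e x y j].

Definition square h : rel T :=
  fun x y => h x y || (x != y) && at_distance h x y 2.

(* The graph without vertices does not count as connected. *)
Definition connected e : Prop := 0 < #|T| /\ forall x y, connect e x y.

Definition clique e K : bool :=
  [forall x in K, forall y in K, (x != y) ==> e x y].

Definition independent e S : bool :=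
  [forall x in S, forall y in S, ~~ e x y].

Definition split_graph e : Prop :=
  exists K, clique e K /\ independent e (~: K).

Definition max_cliques e : {set {set T}} := [set K | maxset (clique e) K].

End Graphs.

(* [inl i] is the vertex u_i and [inr j] is the vertex v_j; [ordS] is the
   cyclic successor. *)
Definition sun_adj (l : nat) : rel ('I_l + 'I_l) := fun a b =>
  match a, b with
  | inl _, inl _ => false
  | inr i, inr j => i != j
  | inl i, inr j | inr j, inl i => (j == i) || (j == ordS i)
  end.

Definition induced_subgraph (U T : finType) (f : rel U) (e : rel T) : Prop :=
  exists phi : U -> T, injective phi /\ forall a b, e (phi a) (phi b) = f a b.

Definition odd_sun_free (T : finType) (e : rel T) : Prop :=
  forall l, 3 <= l -> odd l -> ~ induced_subgraph (@sun_adj l) e.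

Definition two_ones_mx (k : nat) (B : 'M[bool]_k) : Prop :=
  (forall i, #|[set j | B i j]| = 2) /\ (forall j, #|[set i | B i j]| = 2).

Definition balanced_mx (m n : nat) (A : 'M[bool]_(m, n)) : Prop :=
  forall (k : nat) (f : 'I_k -> 'I_m) (g : 'I_k -> 'I_n),
    odd k -> injective f -> injective g -> ~ two_ones_mx (mxsub f g A).

Definition incidence_mx (T : finType) (E : {set {set T}}) :
    'M[bool]_(#|T|, #|E|) :=
  \matrix_(i, j) (@enum_val T T i \in @enum_val _ (mem E) j).

Definition balanced_hypergraph (T : finType) (E : {set {set T}}) : Prop :=
  balanced_mx (incidence_mx E).

Definition balanced_graph (T : finType) (e : rel T) : Prop :=
  balanced_hypergraph (max_cliques e).

Definition has_osf_split_root (T : finType) (e : rel T) : Prop :=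
  exists h : rel T,
    [/\ simple_graph h, split_graph h, odd_sun_free h & e =2 square h].

Definition has_connected_osf_split_root (T : finType) (e : rel T) : Prop :=
  exists h : rel T,
    [/\ simple_graph h, connected h, split_graph h, odd_sun_free h
      & e =2 square h].

(* Machine model: the WHILE language on binary trees (N. D. Jones,
   Computability and Complexity from a Programming Perspective), except that
   evaluating an expression is charged the sizes of the values of all its
   subexpressions instead of unit cost. A run of cost t therefore only handles
   data of size at most t, and the model is polynomially equivalent to Turing
   machines. *)
Inductive tree := Leaf | Node of tree & tree.

Fixpoint tree_size (d : tree) : nat :=
  if d is Node a b then (tree_size a + tree_size b).+1 else 1.

Definition hd_tree (d : tree) : tree := if d is Node a _ then a else Leaf.
Definition tl_tree (d : tree) : tree := if d is Node _ b then b else Leaf.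

Inductive expr :=
  | EVar of nat
  | ELeaf
  | ENode of expr & expr
  | EHd of expr
  | ETl of expr.

Inductive cmd :=
  | CAssign of nat & expr
  | CSeq of cmd & cmd
  | CIf of expr & cmd & cmd
  | CWhile of expr & cmd.

Definition store := nat -> tree.

Definition update (s : store) (x : nat) (d : tree) : store :=
  fun y => if y == x then d else s y.

Fixpoint eval (s : store) (a : expr) : tree :=
  match a with
  | EVar x => s x
  | ELeaf => Leaf
  | ENode a1 a2 => Node (eval s a1) (eval s a2)
  | EHd a1 => hd_tree (eval s a1)
  | ETl a1 => tl_tree (eval s a1)
  end.

Fixpoint eval_cost (s : store) (a : expr) : nat :=
  tree_size (eval s a) +
  match a with
  | EVar _ | ELeaf => 0
  | ENode a1 a2 => eval_cost s a1 + eval_cost s a2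
  | EHd a1 | ETl a1 => eval_cost s a1
  end.

(* [exec s c t s']: run from store s, command c halts in store s' at cost t.
   A test succeeds when its value is not [Leaf]. *)
Inductive exec : store -> cmd -> nat -> store -> Prop :=
  | ExecAssign s x a :
      exec s (CAssign x a) (eval_cost s a) (update s x (eval s a))
  | ExecSeq s s1 s2 c1 c2 t1 t2 :
      exec s c1 t1 s1 -> exec s1 c2 t2 s2 ->
      exec s (CSeq c1 c2) (t1 + t2) s2
  | ExecIfTrue s s1 a c1 c2 t :
      eval s a <> Leaf -> exec s c1 t s1 ->
      exec s (CIf a c1 c2) (eval_cost s a + t) s1
  | ExecIfFalse s s1 a c1 c2 t :
      eval s a = Leaf -> exec s c2 t s1 ->
      exec s (CIf a c1 c2) (eval_cost s a + t) s1
  | ExecWhileTrue s s1 s2 a c t1 t2 :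
      eval s a <> Leaf -> exec s c t1 s1 -> exec s1 (CWhile a c) t2 s2 ->
      exec s (CWhile a c) (eval_cost s a + t1 + t2) s2
  | ExecWhileFalse s a c :
      eval s a = Leaf -> exec s (CWhile a c) (eval_cost s a) s.

Definition enc_bool (b : bool) : tree := if b then Node Leaf Leaf else Leaf.

Definition enc_seq (ds : seq tree) : tree := foldr Node Leaf ds.

(* The adjacency matrix as a list of rows. *)
Definition enc_graph (n : nat) (e : rel 'I_n) : tree :=
  enc_seq [seq enc_seq [seq enc_bool (e i j) | j <- enum 'I_n]
          | i <- enum 'I_n].

Definition init_store (d : tree) : store := update (fun=> Leaf) 0 d.

(* Input and answer are in variable 0; any value but [Leaf] means "yes". *)
Definition poly_time_recognizable (P : forall n, rel 'I_n -> Prop) : Prop :=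
  exists (c : cmd) (a k : nat), forall (n : nat) (e : rel 'I_n),
    simple_graph e ->
    exists (t : nat) (s : store),
      [/\ exec (init_store (enc_graph e)) c t s,
          t <= a * n ^ k + a
        & s 0 <> Leaf <-> P n e].

(* Main.v *)
From Stdlib Require Import FunctionalExtensionality.
Require Import Defs.
From mathcomp Require Import all_boot all_order all_algebra zify.
Set Implicit Arguments.
Unset Strict Implicit.
Unset Printing Implicit Defensive.

(* The characterization.  Let h be an odd-sun-free split graph with clique K0, and let
   G = h^2.  As h has no 3-sun, a Helly argument shows that every maximal clique of G with
   at least two vertices is a closed neighbourhood N_h[v] with v in K0.  Hence K0 lies in
   all these cliques, their number is at most |K0|, and an odd sun formed by vertices and
   maximal cliques of G is an induced odd sun of h.  Conversely, assign to the maximal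
   cliques of G distinct vertices of their common intersection U, make U a clique, and join
   every vertex outside U to the vertices assigned to the cliques containing it.  A matrix
   is unbalanced if and only if it contains an odd sun, because a submatrix with two ones
   in each row and column decomposes into cycles.

   The algorithm.  If G has a root, no triangle xyz has vertices a, b, c whose closed
   neighbourhoods contain exactly {x,y}, {y,z}, {x,z} of it, and then the maximal cliques are
   the cliques of the form N[x] meet N[y] with xy an edge.  It remains to find a hole of
   length 2 mod 4 in their bipartite incidence graph.  A smallest such hole C either has
   length 6, or the graph contains a theta (three internally disjoint and nonadjacent
   paths between two nonadjacent vertices of different sides), or it contains a tent (two
   adjacent vertices that clone two vertices of C at odd distance at least 3, with the rest
   of C), or C is found as follows: all vertices with three far apart neighbours on C have a common
   neighbour on C, for each side, so guessing two vertices of C and their neighbours deletes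
   these major vertices, after which C is isometric and is recovered from five equidistant
   vertices by shortest paths.  Each of the four configurations is described by guessing
   a bounded number of vertices and numbers together with reachability conditions that
   already force an unbalanced hole.  Such descriptions are formulas with bounded
   quantifiers and walk predicates, which WHILE programs evaluate in polynomial time. *)

Ltac arith_bool b :=
  lazymatch b with
  | leq _ _ => idtac
  | odd _ => idtac
  | true => idtac
  | false => idtac
  | andb ?x ?y => arith_bool x; arith_bool y
  | orb ?x ?y => arith_bool x; arith_bool y
  | negb ?x => arith_bool x
  | @eq_op _ ?x _ => let t := type of x in unify t nat
  | _ => fail
  end.

Ltac arith_prop P :=
  lazymatch P with
  | nat => idtac
  | False => idtac
  | is_true ?b => arith_bool b
  | @eq _ (odd _) _ => idtac
  | @eq _ (leq _ _) _ => idtac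
  | @eq bool ?a ?b => arith_bool a; arith_bool b
  | @eq ?T _ _ => unify T nat
  | ~ ?P => arith_prop P
  | ?P -> ?Q => arith_prop P; arith_prop Q
  | ?P \/ ?Q => arith_prop P; arith_prop Q
  | ?P /\ ?Q => arith_prop P; arith_prop Q
  | _ => fail
  end.

(* lia after discarding the hypotheses that zify would otherwise preprocess in vain. *)
Ltac slia :=
  intros;
  repeat match goal with
  | H : ?P |- _ => tryif arith_prop P then fail else clear H
  end; lia.

(** * Induced paths and holes *)

Section Holes.
Variables (T : finType) (adj : rel T).
Hypothesis adjC : symmetric adj.

Definition induced_path (x : nat -> T) (l : nat) : Prop :=
  forall i j, i < j <= l -> x i != x j /\ adj (x i) (x j) = (j == i.+1).

(* An induced cycle of length n, as an n-periodic enumeration of its vertices. *)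
Definition hole (c : nat -> T) (n : nat) : Prop :=
  (forall i, c (i + n) = c i) /\
  forall i j, i < j < i + n ->
    c i != c j /\ adj (c i) (c j) = (j == i.+1) || (j.+1 == i + n).

Lemma induced_path_adjS x l i : induced_path x l -> i < l -> adj (x i) (x i.+1).
Proof. by move=> Hx il; have [|_ ->] := Hx i i.+1; rewrite ?eqxx //; slia. Qed.

Lemma induced_path_sub x l k m :
  induced_path x l -> k + m <= l -> induced_path (fun i => x (k + i)) m.
Proof.
move=> Hx km i j ij; have [|-> ->] := Hx (k + i) (k + j); first by slia.
by split=> //; slia.
Qed.

Lemma induced_path_rev x l :
  induced_path x l -> induced_path (fun i => x (l - i)) l.
Proof.
move=> Hx i j ij; have [|N A] := Hx (l - j) (l - i); first by slia.
by rewrite adjC A; split; [by rewrite eq_sym | slia].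
Qed.

Lemma induced_path_cat x l y m :
  induced_path x l -> induced_path y m -> x l = y 0 ->
  (forall i j, i < l -> 0 < j <= m -> x i != y j /\ ~~ adj (x i) (y j)) ->
  induced_path (fun i => if i <= l then x i else y (i - l)) (l + m).
Proof.
move=> Hx Hy E X i j ij.
have [jl|lj] := leqP j l.
  have -> : i <= l by slia.
  by apply: Hx; slia.
have [il|li] := leqP i l; last first.
  have [|-> ->] := Hy (i - l) (j - l); first by slia.
  by split=> //; slia.
have [{}il|{}li] := ltnP i l.
  have [//||-> /negbTE ->] := X i (j - l); first by slia.
  by split=> //; slia.
have -> : i = l by slia.
rewrite E; have [|-> ->] := Hy 0 (j - l); first by slia.
by split=> //; slia.
Qed.

Lemma induced_path2 a v b :
  a != b -> a != v -> v != b -> ~~ adj a b -> adj a v -> adj v b ->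
  induced_path (fun i => if i is j.+1 then (if j is _.+1 then b else v) else a) 2.
Proof.
move=> ab av vb /negbTE Nab Aav Avb [|[|[|i]]] [|[|[|j]]] //= ij;
  by first [slia | rewrite Aav | rewrite Nab | rewrite Avb].
Qed.

Lemma induced_path_cons y l a :
  induced_path y l -> adj a (y 0) -> (forall i, i <= l -> a != y i) ->
  (forall i, 0 < i <= l -> ~~ adj a (y i)) ->
  induced_path (fun i => if i is j.+1 then y j else a) l.+1.
Proof.
move=> Hy A N NA [|i] [|j] //= ij; last by apply: Hy; slia.
by rewrite N //; split=> //; case: j ij => [|j] ij; rewrite ?A ?(negbTE (NA _ _)).
Qed.

Lemma induced_path_rcons x m b :
  induced_path x m -> adj (x m) b -> (forall i, i <= m -> x i != b) ->
  (forall i, i < m -> ~~ adj (x i) b) ->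
  induced_path (fun t => if t <= m then x t else b) m.+1.
Proof.
move=> Hx Am N NA i j ij; have [jm|mj] := leqP j m.
  have -> : i <= m by slia.
  by apply: Hx; slia.
have im : i <= m by slia.
rewrite im N //; split=> //; have [->|ne] := eqVneq i m; first by rewrite Am; slia.
by rewrite (negbTE (NA _ _)); slia.
Qed.

Lemma induced_path_add_ends y l a b :
  induced_path y l -> a != b -> ~~ adj a b -> adj a (y 0) -> adj (y l) b ->
  (forall i, i <= l -> a != y i /\ b != y i) ->
  (forall i, 0 < i <= l -> ~~ adj a (y i)) -> (forall i, i < l -> ~~ adj b (y i)) ->
  exists x, [/\ induced_path x l.+2, x 0 = a, x l.+2 = b
              & forall i, i <= l -> x i.+1 = y i].
Proof.
move=> Hy ab Nab a_first b_last off Na Nb.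
have Hay : induced_path (fun i => if i is j.+1 then y j else a) l.+1.
  by apply: induced_path_cons => // i /off[].
exists (fun t => if t <= l.+1 then (if t is j.+1 then y j else a) else b).
split=> //; first 1 last.
- by rewrite ltnn.
- by move=> i il; rewrite ltnS il.
apply: induced_path_rcons => // [[|i] Hi|[|i] Hi] //.
  by rewrite eq_sym; have [] := off i Hi.
by rewrite adjC; apply: Nb.
Qed.

Lemma modn_addr_small n i d : 0 < d < n ->
  (i + d) %% n = (if i %% n + d < n then i %% n + d else i %% n + d - n).
Proof.
move=> dn; have n0 : 0 < n by slia.
rewrite -modnDml; have rn := ltn_pmod i n0.
case: ifP => H; first by rewrite modn_small.
have H' : n <= i %% n + d by slia.
by rewrite -[in LHS](subnK H') modnDr modn_small //; slia.
Qed.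

Lemma hole_of_range f n : 0 < n ->
  (forall i j, i < j < n ->
     f i != f j /\ adj (f i) (f j) = (j == i.+1) || ((i == 0) && (j.+1 == n))) ->
  hole (fun i => f (i %% n)) n.
Proof.
move=> n0 adjE; split=> [i|i j ij]; first by rewrite modnDr.
have [d dn ->] : exists2 d, 0 < d < n & j = i + d by exists (j - i); slia.
rewrite modn_addr_small // {ij j}.
have rn := ltn_pmod i n0; move: (i %% n) rn => r rn.
case: ltnP => nowrap.
  have [|-> ->] := adjE r (r + d); first by slia.
  by split=> //; slia.
have [|ne rdE] := adjE (r + d - n) r; first by slia.
by rewrite adjC rdE; split; [by rewrite eq_sym | slia].
Qed.

Lemma hole_of_two_paths x l y m :
  induced_path x l -> induced_path y m -> x 0 = y 0 -> x l = y m -> 1 < l -> 1 < m ->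
  (forall i j, 0 < i < l -> 0 < j < m -> x i != y j /\ ~~ adj (x i) (y j)) ->
  exists c, [/\ hole c (l + m), forall i, i <= l -> c i = x i
              & forall i, i <= m -> c (l + m - i) = y i].
Proof.
move=> Hx Hy x0y0 xlym l1 m1 X.
pose f k := if k <= l then x k else y (l + m - k).
exists (fun i => f (i %% (l + m))); split; last first.
- move=> [|i] Hi; first by rewrite subn0 modnn /f.
  rewrite modn_small /f; last by slia.
  case: leqP => near_end; last by congr y; slia.
  have -> : i.+1 = m by slia.
  by rewrite -xlym; congr x; slia.
- by move=> i Hi; rewrite modn_small /f ?Hi //; slia.
apply: hole_of_range; first by slia.
rewrite /f => i j ij; have [jl|lj] := leqP j l.
  have -> : i <= l by slia.
  by have [|-> ->] := Hx i j; [slia | split=> //; slia].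
have [il|li] := leqP i l; last first.
  have [|ne yE] := Hy (l + m - j) (l + m - i); first by slia.
  by rewrite adjC yE; split; [by rewrite eq_sym | slia].
have [->|i0] := posnP i.
  rewrite x0y0; have [|-> ->] := Hy 0 (l + m - j); first by slia.
  by split=> //; slia.
have [{}il|{}li] := ltnP i l.
  by have [||-> /negbTE ->] := X i (l + m - j); slia.
have -> : i = l by slia.
rewrite xlym; have [|ne yE] := Hy (l + m - j) m; first by slia.
by rewrite adjC yE; split; [by rewrite eq_sym | slia].
Qed.

Section HoleTheory.
Variables (c : nat -> T) (n : nat).
Hypothesis Hc : hole c n.

Lemma hole_period i : c (i + n) = c i.
Proof. by case: Hc. Qed.

Lemma hole_shift k : hole (fun i => c (k + i)) n.
Proof.
case: Hc => [P H]; split=> [i|i j ij]; first by rewrite addnA P.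
have [|-> ->] := H (k + i) (k + j); first by slia.
by split=> //; slia.
Qed.

Lemma hole_modn i : c (i %% n) = c i.
Proof.
rewrite [in RHS](divn_eq i n); elim: (i %/ n) => [|k IH]; first by rewrite add0n.
by rewrite mulSn -addnA addnC hole_period.
Qed.

Lemma hole_arc k l : l + 2 <= n -> induced_path (fun i => c (k + i)) l.
Proof.
case: Hc => [_ H] ln i j ij; have [|-> ->] := H (k + i) (k + j); first by slia.
by split=> //; slia.
Qed.

Lemma hole_index_window k i : 0 < n -> exists j, k <= j < k + n /\ c j = c i.
Proof.
move=> n0; have kn := ltn_pmod k n0.
exists (k + (i + (n - k %% n)) %% n); split.
  by have := ltn_pmod (i + (n - k %% n)) n0; slia.
rewrite -hole_modn modnDmr -(hole_modn i); congr c.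
rewrite addnCA -modnDmr -(modnDml k).
have -> : k %% n + (n - k %% n) = n by slia.
by rewrite modnn addn0.
Qed.

Lemma hole_neq i j : i < j < i + n -> c i != c j.
Proof. by case: Hc => _ H /H[]. Qed.

Lemma hole_adj i j : i < j < i + n -> adj (c i) (c j) = (j == i.+1) || (j.+1 == i + n).
Proof. by case: Hc => _ H /H[]. Qed.

Lemma hole_adjS i : 2 < n -> adj (c i) (c i.+1).
Proof. by move=> n2; rewrite hole_adj; slia. Qed.

Lemma hole_adj_pred i : 2 < n -> adj (c (i + n.-1)) (c i).
Proof.
by move=> n2; rewrite -[c i]hole_period -(ltn_predK n2) addnS; apply: hole_adjS.
Qed.

Lemma hole_far i j : i.+1 < j -> j.+1 < i + n -> c i != c j /\ ~~ adj (c i) (c j).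
Proof. by move=> ij ji; rewrite hole_neq ?hole_adj; slia. Qed.

Lemma hole_index_eq k m : c k = c m -> k < n -> m < n.*2 -> m = k \/ m = k + n.
Proof.
move=> E kn mn; have inj i j : i < n -> j < n -> c i = c j -> i = j.
  move=> i_n jn Eij; have [lt|lt|//] := ltngtP i j.
    by have := @hole_neq i j ltac:(slia); rewrite Eij eqxx.
  by have := @hole_neq j i ltac:(slia); rewrite Eij eqxx.
have [lt|ge] := ltnP m n; first by left; apply: esym; apply: inj.
right; rewrite (inj k (m - n)) ?subnK //; first by slia.
by rewrite E -[in LHS](subnK ge) hole_period.
Qed.

Lemma hole_avoid x : 0 < n -> (forall j, j < n -> x != c j) -> forall j, x != c j.
Proof. by move=> n0 H j; rewrite -hole_modn; apply: H; apply: ltn_pmod. Qed.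

End HoleTheory.

End Holes.

Section Links.
Variables (T : finType) (adj : rel T).
Hypothesis adjC : symmetric adj.

Definition restrict (P : {pred T}) : rel T := fun u v => [&& adj u v, u \in P & v \in P].

Definition linked (X : {set T}) (a b : T) : Prop :=
  exists u v, [/\ u \in X, v \in X, adj a u, adj v b & connect (restrict X) u v].

Definition walk (P : {pred T}) (x : nat -> T) (l : nat) : Prop :=
  (forall i, i < l -> adj (x i) (x i.+1)) /\ (forall i, 0 < i < l -> x i \in P).

Definition anticomplete (X Y : {set T}) : Prop :=
  forall x y, x \in X -> y \in Y -> x != y /\ ~~ adj x y.

Lemma anticompleteC X Y : anticomplete X Y -> anticomplete Y X.
Proof. by move=> H x y Hx Hy; rewrite eq_sym adjC; apply: H. Qed.

Lemma anticompleteS (X X' Y Y' : {set T}) :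
  X' \subset X -> Y' \subset Y -> anticomplete X Y -> anticomplete X' Y'.
Proof. by move=> /subsetP XX /subsetP YY H x y /XX + /YY; apply: H. Qed.

Lemma anticompleteU (X Y Z : {set T}) :
  anticomplete X Y -> anticomplete X Z -> anticomplete X (Y :|: Z).
Proof. by move=> XY XZ x y Hx /setUP[]; [apply: XY | apply: XZ]. Qed.

Lemma anticomplete1 (X : {set T}) v :
  (forall x, x \in X -> x != v /\ ~~ adj x v) -> anticomplete X [set v].
Proof. by move=> H x y xX /set1P ->; apply: H. Qed.

Lemma restrictC P : symmetric (restrict P).
Proof. by move=> u v; rewrite /restrict adjC [(u \in P) && _]andbC. Qed.

Lemma connect_restrictC P u v : connect (restrict P) u v = connect (restrict P) v u.
Proof. exact/sym_connect_sym/restrictC. Qed.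

Lemma connect_restrictS (X Y : {set T}) u v :
  X \subset Y -> connect (restrict X) u v -> connect (restrict Y) u v.
Proof.
move=> /subsetP XY; apply: connect_sub => x y /and3P[A Hx Hy].
by apply: connect1; rewrite /restrict A !XY.
Qed.

Lemma linkedC X a b : linked X a b -> linked X b a.
Proof.
by move=> [u [v [Hu Hv A B C]]]; exists v, u;
  split; rewrite // 1?adjC // connect_restrictC.
Qed.

Lemma linked_cons (X : {set T}) a b q : adj a q -> linked X q b -> linked (q |: X) a b.
Proof.
move=> aq [u [v [Hu Hv A B C]]]; exists q, v; split; rewrite ?setU11 ?setU1r //.
apply: (@connect_trans _ _ u); last by apply: connect_restrictS C; apply: subsetUr.
by apply: connect1; rewrite /restrict A setU11 setU1r.
Qed.

Lemma connect_segment (P : {pred T}) x i j : i <= j ->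
  (forall k, i <= k < j -> adj (x k) (x k.+1)) ->
  (forall k, i <= k <= j -> x k \in P) -> connect (restrict P) (x i) (x j).
Proof.
elim: j => [|j IH] ij steps inP; first by have -> : i = 0 by slia.
have [iE|ij'] := eqVneq i j.+1; first by rewrite iE.
apply: (@connect_trans _ _ (x j)).
  by apply: IH => [|k Hk|k Hk]; [slia|apply: steps; slia|apply: inP; slia].
by apply: connect1; rewrite /restrict steps ?inP //; slia.
Qed.

Definition arc (x : nat -> T) lo hi : {set T} := [set x (lo + i) | i : 'I_(hi - lo)].

Lemma arcP x lo hi y : reflect (exists2 i, lo <= i < hi & y = x i) (y \in arc x lo hi).
Proof.
apply: (iffP imsetP) => [[i _ ->]|[i Hi ->]].
  by exists (lo + i) => //; have := ltn_ord i; slia.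
have Hi' : i - lo < hi - lo by slia.
by exists (Ordinal Hi') => //=; congr x; slia.
Qed.

Lemma mem_arc x lo hi i : lo <= i < hi -> x i \in arc x lo hi.
Proof. by move=> Hi; apply/arcP; exists i. Qed.

Lemma card_arc x lo hi : #|arc x lo hi| <= hi - lo.
Proof. by apply: leq_trans (leq_imset_card _ _) _; rewrite card_ord. Qed.

Lemma card_arc_inj x lo hi :
  (forall i j, lo <= i -> i < j < hi -> x i != x j) -> #|arc x lo hi| = hi - lo.
Proof.
move=> H; rewrite card_imset ?card_ord // => i j E; apply/val_inj => /=.
have il := ltn_ord i; have jl := ltn_ord j; have [lt|lt|//] := ltngtP i j.
  by have := H (lo + i) (lo + j) ltac:(slia) ltac:(slia); rewrite E eqxx.
by have := H (lo + j) (lo + i) ltac:(slia) ltac:(slia); rewrite E eqxx.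
Qed.

Lemma anticomplete_arcs x lo1 hi1 y lo2 hi2 :
  (forall i j, lo1 <= i < hi1 -> lo2 <= j < hi2 -> x i != y j /\ ~~ adj (x i) (y j)) ->
  anticomplete (arc x lo1 hi1) (arc y lo2 hi2).
Proof. by move=> H u v /arcP[i Hi ->] /arcP[j Hj ->]; apply: H. Qed.

Lemma linked_arc x lo hi a b : lo < hi ->
  (forall k, lo <= k -> k.+1 < hi -> adj (x k) (x k.+1)) ->
  adj a (x lo) -> adj (x hi.-1) b -> linked (arc x lo hi) a b.
Proof.
move=> lh A Ha Hb; exists (x lo), (x hi.-1).
split; rewrite ?mem_arc //; try slia.
by apply: connect_segment => [|k Hk|k Hk]; [slia|apply: A; slia|apply: mem_arc; slia].
Qed.

Lemma linked_inner_arc x lo hi : lo.+1 < hi ->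
  (forall k, lo <= k < hi -> adj (x k) (x k.+1)) ->
  linked (arc x lo.+1 hi) (x lo) (x hi).
Proof.
move=> lh A; apply: linked_arc; rewrite ?A //; try slia.
  by move=> k Hk Hk'; apply: A; slia.
by have := A hi.-1 ltac:(slia); rewrite (ltn_predK lh).
Qed.

Lemma connect_walk (X : {set T}) u v : u \in X -> connect (restrict X) u v ->
  exists x l, [/\ x 0 = u, x l = v, forall i, i < l -> adj (x i) (x i.+1)
                & forall i, i <= l -> x i \in X].
Proof.
move=> uX /connectP[p Hp ->]; exists (nth u (u :: p)), (size p); split=> //=.
- by rewrite -[size p]/((size (u :: p)).-1) nth_last.
- by move=> i Hi; have /pathP := Hp => /(_ u i Hi) /and3P[].
- case=> [|i] Hi //=; have /pathP := Hp => /(_ u i Hi) /and3P[] //.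
Qed.

Lemma linked_walk (X : {set T}) a b :
  linked X a b -> exists x l, [/\ 1 < l, x 0 = a, x l = b & walk X x l].
Proof.
move=> [u [v [uX vX au vb /(connect_walk uX)[x [l [x0 xl steps inX]]]]]].
exists (fun i => if i is j.+1 then (if j <= l then x j else b) else a), l.+2; split=> //=.
  by rewrite ltnn.
split=> [[|i] Hi|[|i] Hi] //=; first by rewrite x0.
  have -> : i <= l by slia.
  case: ltnP => lt; first exact: steps.
  have -> : i = l by slia.
  by rewrite xl.
have -> : i <= l by slia.
by apply: inX; slia.
Qed.

(* A walk that is not induced has a repetition or a chord, which shortens it. *)
Lemma walk_shortcut (P : {pred T}) x l i j : walk P x l -> i < j <= l ->
  x i = x j \/ j != i.+1 /\ adj (x i) (x j) ->
  exists y m, [/\ m < l, y 0 = x 0, y m = x l & walk P y m].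
Proof.
move=> [steps inner] ij rep.
have [d [d0 dl endE jump]] : exists d, [/\ 0 < d, i + d <= l, i + d = l -> x i = x l
    & i + d < l -> adj (x i) (x (i + d).+1)].
  case: rep => [xij|[ji xij]].
    exists (j - i); rewrite subnKC; last by slia.
    by split; [slia | slia | move=> <- | move=> jl; rewrite xij; apply: steps].
  exists (j - i.+1); have -> : i + (j - i.+1) = j.-1 by slia.
  by split; [slia | slia | slia | rewrite (ltn_predK (_ : i < j)) //; slia].
exists (fun k => if k <= i then x k else x (k + d)), (l - d); split; first by slia.
- by [].
- case: leqP => C; last by congr x; slia.
  have -> : l - d = i by slia.
  by apply: endE; slia.
split=> k Hk; last by case: leqP => C; apply: inner; slia.
have [ki|ik] := ltnP k i; first by rewrite ltnW //; apply: steps; slia.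
case: leqP => C; last by rewrite addSn; apply: steps; slia.
by (have -> : k = i by slia); rewrite addSn; apply: jump; slia.
Qed.

Lemma walk_induced_path (P : {pred T}) x l : walk P x l ->
  exists y m, [/\ m <= l, y 0 = x 0, y m = x l, induced_path adj y m & walk P y m].
Proof.
have [N] := ubnP l; elim: N l x => // N IH l x lN Wx.
have [/existsP[i /existsP[j /andP[ij rep]]]|noshort] :=
    boolP [exists i : 'I_l.+1, exists j : 'I_l.+1, (i < j) &&
      ((x i == x j) || (j != i.+1 :> nat) && adj (x i) (x j))].
  have [||y [m [ml y0 ym Wy]]] := walk_shortcut (i := i) (j := j) Wx.
  - by have := ltn_ord j; slia.
  - by case/orP: rep => [/eqP|/andP[]]; [left | right].
  have [|z [k [km z0 zk Hz Wz]]] := IH m y _ Wy; first by slia.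
  by exists z, k; split; rewrite ?z0 ?zk //; slia.
exists x, l; split=> // i j ij; have jl : j < l.+1 by slia.
have il : i < l.+1 by slia.
move: noshort; rewrite negb_exists => /forallP/(_ (Ordinal il)).
rewrite negb_exists => /forallP/(_ (Ordinal jl)) /=.
have -> /= : i < j by slia.
rewrite negb_or => /andP[-> /=]; case: eqVneq => [-> _|_ /negbTE //].
by split=> //; case: Wx => A _; apply: A; slia.
Qed.

Lemma linked_induced_path (X : {set T}) a b : linked X a b -> a != b -> ~~ adj a b ->
  exists x l, [/\ 1 < l, x 0 = a, x l = b, induced_path adj x l & arc x 1 l \subset X].
Proof.
move=> /linked_walk[x [l [l1 x0 xl walk_x]]] ab Nab.
have [y [m [ml y0 ym Hy [steps inner]]]] := walk_induced_path walk_x.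
exists y, m; split=> //; rewrite ?y0 ?ym //; last first.
  by apply/subsetP => _ /arcP[j Hj ->]; apply: inner.
case: m {ml Hy inner} ym steps => [|[|m]] ym steps //.
  by move: ab; rewrite -x0 -xl -y0 ym eqxx.
by move: (steps 0 isT); rewrite y0 ym x0 xl (negbTE Nab).
Qed.

Lemma hole_of_anticomplete_paths x l y m :
  induced_path adj x l -> induced_path adj y m -> x 0 = y 0 -> x l = y m -> 1 < l -> 1 < m ->
  anticomplete (arc x 1 l) (arc y 1 m) ->
  exists h, [/\ hole adj h (l + m), h 0 = x 0, h l = x l,
      forall t, [\/ h t = x 0, h t = x l | h t \in arc x 1 l :|: arc y 1 m]
    & forall z, z \in arc x 1 l :|: arc y 1 m -> exists t, h t = z].
Proof.
move=> Hx Hy E0 El l1 m1 XY.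
have [i j Hi Hj|h [Hh hx hy]] := hole_of_two_paths adjC Hx Hy E0 El l1 m1.
  by apply: XY; apply: mem_arc.
exists h; split; [by [] | exact: hx | exact: hx | move=> t | move=> z].
  rewrite -(hole_modn Hh t); have := @ltn_pmod t (l + m) ltac:(slia).
  move: (t %% _) => {}t tlm; have [tl|lt] := leqP t l.
    rewrite hx //; have [->|t0] := posnP t; first by constructor 1.
    have [->|tl'] := eqVneq t l; first by constructor 2.
    by constructor 3; rewrite inE mem_arc //; slia.
  have -> : t = l + m - (l + m - t) by slia.
  by rewrite hy; [constructor 3; rewrite inE (mem_arc y) ?orbT //; slia | slia].
case/setUP => /arcP[t Ht ->]; first by exists t; rewrite hx //; slia.
by exists (l + m - t); rewrite hy //; slia.
Qed.

End Links.

Section Bipartite.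
Variables (T : finType) (adj : rel T) (side : T -> bool).
Hypothesis adjC : symmetric adj.
Hypothesis bip : forall x y, adj x y -> side x != side y.

Notation induced_path := (induced_path adj).
Notation hole := (hole adj).
Notation linked := (linked adj).
Notation anticomplete := (anticomplete adj).

Lemma side_adj x y : adj x y -> side x = ~~ side y.
Proof. by move/bip; case: (side x); case: (side y). Qed.

Lemma side_nadj x y : side x = side y -> ~~ adj x y.
Proof. by move=> E; apply/negP => /bip; rewrite E eqxx. Qed.

Lemma side_neq x y : side x != side y -> x != y.
Proof. by apply: contraNneq => ->. Qed.

Lemma walk_side x l : (forall i, i < l -> adj (x i) (x i.+1)) ->
  forall i, i <= l -> side (x i) = side (x 0) (+) odd i.
Proof.
move=> A; elim=> [|i IH] il; first by rewrite addbF.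
by rewrite /= addbN -IH 1?ltnW // (side_adj (A i il)) negbK.
Qed.

Lemma induced_path_side x l i :
  induced_path x l -> i <= l -> side (x i) = side (x 0) (+) odd i.
Proof. by move=> H; apply: walk_side => j; apply: induced_path_adjS H. Qed.

Lemma induced_path_odd x l : induced_path x l -> odd l = (side (x 0) != side (x l)).
Proof.
by move=> H; rewrite (induced_path_side H (leqnn l)); case: (side _); case: (odd l).
Qed.

Lemma induced_path3 a b c d : adj a b -> adj b c -> adj c d -> ~~ adj a d ->
  induced_path (nth a [:: a; b; c; d]) 3.
Proof.
move=> ab bc cd Nad.
have [sab sbc scd] : [/\ side a = ~~ side b, side b = ~~ side c & side c = ~~ side d].
  by split; apply: side_adj.
have ac : a != c by apply: contraNneq Nad => ->.
have bd : b != d by apply: contraNneq Nad => <-.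
have ad : a != d by apply: side_neq; rewrite sab sbc scd; case: (side d).
have Nac : ~~ adj a c by apply: side_nadj; rewrite sab sbc negbK.
have Nbd : ~~ adj b d by apply: side_nadj; rewrite sbc scd negbK.
have [nab nbc ncd] : [/\ a != b, b != c & c != d] by split; apply/side_neq/bip.
by move=> [|[|[|[|i]]]] [|[|[|[|j]]]] //= ij; first
  [ slia | rewrite ?ab ?bc ?cd ?(negbTE Nad) ?(negbTE Nac) ?(negbTE Nbd) ].
Qed.

Lemma hole_side c n i : hole c n -> 2 < n -> side (c i) = side (c 0) (+) odd i.
Proof. by move=> H n2; apply: (@walk_side _ i) => // j _; apply: hole_adjS H _ n2. Qed.

Lemma hole_even c n : hole c n -> 2 < n -> ~~ odd n.
Proof.
move=> H n2; have := hole_side n H n2; rewrite -[n in c n]add0n (hole_period H).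
by case: (side _) (odd n) => [] [].
Qed.

Lemma hole_nbr_side c n w i :
  hole c n -> 2 < n -> adj w (c i) -> side w = ~~ (side (c 0) (+) odd i).
Proof. by move=> H n2 /side_adj ->; rewrite (hole_side i H n2). Qed.

Lemma hole_nbr_parity c n w i j :
  hole c n -> 2 < n -> adj w (c i) -> adj w (c j) -> odd i = odd j.
Proof.
move=> H n2 wi wj; have := hole_nbr_side H n2 wj; rewrite (hole_nbr_side H n2 wi).
by case: (side _); case: (odd i); case: (odd j).
Qed.

Definition has_unbalanced_hole : Prop := exists n c, [/\ 5 < n, n %% 4 = 2 & hole c n].

(** * Thetas *)

Definition theta a b (X Y Z : {set T}) : Prop :=
  [/\ side a != side b, ~~ adj a b,
      [/\ linked X a b, linked Y a b & linked Z a b],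
      [/\ anticomplete X Y, anticomplete X Z & anticomplete Y Z]
    & a \notin X :|: Y :|: Z /\ b \notin X :|: Y :|: Z].

Definition theta_free : Prop := forall a b X Y Z, ~ theta a b X Y Z.

Definition small_theta (m : nat) : Prop :=
  exists a b X Y Z, theta a b X Y Z /\ #|X| + #|Y| + #|Z| < m.

Lemma in_setU3 (A B C : {set T}) x :
  (x \in A :|: B :|: C) = [|| x \in A, x \in B | x \in C].
Proof. by rewrite !inE orbA. Qed.

Lemma linked_odd_path X a b : linked X a b -> side a != side b -> ~~ adj a b ->
  exists x l, [/\ induced_path x l, x 0 = a, x l = b, odd l /\ 1 < l & arc x 1 l \subset X].
Proof.
move=> L sab Nab; have [x [l [l1 x0 xl Hx Xx]]] := linked_induced_path L (side_neq sab) Nab.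
by exists x, l; split; rewrite // (induced_path_odd Hx) x0 xl.
Qed.

(* Among the three odd lengths of the paths, two have a sum that is 2 modulo 4. *)
Lemma theta_unbalanced_hole a b X Y Z : theta a b X Y Z -> has_unbalanced_hole.
Proof.
move=> [sab Nab [LX LY LZ] [XY XZ YZ] _].
have [x [l [Hx x0 xl [ol l1] Xx]]] := linked_odd_path LX sab Nab.
have [y [m [Hy y0 ym [om m1] Yy]]] := linked_odd_path LY sab Nab.
have [z [p [Hz z0 zp [op p1] Zz]]] := linked_odd_path LZ sab Nab.
have [lm|lm] := eqVneq ((l + m) %% 4) 2.
  have [||c [Hc _ _ _ _]] := hole_of_anticomplete_paths adjC Hx Hy _ _ l1 m1
    (anticompleteS Xx Yy XY); rewrite ?x0 ?xl //; by exists (l + m), c; split=> //; slia.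
have [lp|lp] := eqVneq ((l + p) %% 4) 2.
  have [||c [Hc _ _ _ _]] := hole_of_anticomplete_paths adjC Hx Hz _ _ l1 p1
    (anticompleteS Xx Zz XZ); rewrite ?x0 ?xl //; by exists (l + p), c; split=> //; slia.
have [||c [Hc _ _ _ _]] := hole_of_anticomplete_paths adjC Hy Hz _ _ m1 p1
  (anticompleteS Yy Zz YZ); rewrite ?y0 ?ym //; by exists (m + p), c; split=> //; slia.
Qed.

(* A connected set Z that joins q to the vertex v of the hole h and sees nothing else of h. *)
Definition attachment (h : nat -> T) q (Z : {set T}) v : Prop :=
  [/\ q \notin Z, v \notin Z, linked Z q v,
      forall i, h i = v \/ adj (h i) v -> ~~ adj q (h i)
    & forall z i, z \in Z -> h i != v -> z != h i /\ ~~ adj z (h i)].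

Lemma attachment_shift h r q Z v :
  attachment h q Z v -> attachment (fun i => h (r + i)) q Z v.
Proof. by move=> [A B C D E]; split=> // [i|z i]; [apply: D | apply: E]. Qed.

Section Attachment.
Variables (h : nat -> T) (n : nat) (q : T) (Z : {set T}).
Hypotheses (Hh : hole h n) (n3 : 3 < n).
Hypotheses (q_off : forall i, q != h i) (att : attachment h q Z (h 0)).

Let hS i : adj (h i) (h i.+1). Proof. by apply: hole_adjS Hh _ _; slia. Qed.
Let hn : h n = h 0. Proof. by rewrite -[n]add0n (hole_period Hh). Qed.

Lemma attachment_nbr i : i < n -> adj q (h i) -> 1 < i < n.-1.
Proof.
case: att => _ _ _ far _ i_n qi.
have i0 : i != 0 by apply: contraTneq qi => ->; apply: far; left.
have i1 : i != 1 by apply: contraTneq qi => ->; apply: far; right; rewrite adjC.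
suff : i != n.-1 by slia.
apply: contraTneq qi => ->; apply: far; right.
by rewrite -[n.-1]add0n; apply: hole_adj_pred Hh _ _; slia.
Qed.

Lemma attachment_anticomplete lo hi : 0 < lo -> hi <= n -> anticomplete (arc h lo hi) Z.
Proof.
case: att => _ _ _ _ ZN l0 hin u z /arcP[i Hi ->] zZ; rewrite eq_sym adjC.
by apply: ZN => //; rewrite eq_sym; apply: (hole_neq Hh); slia.
Qed.

Lemma arc_avoid i lo hi : i < n -> hi <= n -> ~~ (lo <= i < hi) -> h i \notin arc h lo hi.
Proof.
move=> i_n hin out; apply/arcP => -[j Hj E].
by have [] := hole_index_eq Hh E i_n ltac:(slia); slia.
Qed.

Lemma theta_of_one_nbr k : k < n -> odd k -> adj q (h k) ->
  (forall i, i < n -> adj q (h i) -> i = k) ->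
  theta (h 0) (h k) (arc h 1 k) (arc h k.+1 n) (q |: Z).
Proof.
move=> kn ok qk uniq_k; have kE := attachment_nbr kn qk; have [qZ hZ L far ZN] := att.
have qA lo hi : 0 < lo -> hi <= n -> ~~ (lo <= k < hi) -> anticomplete (arc h lo hi) (q |: Z).
  move=> l0 hin out; apply: anticompleteU; last exact: attachment_anticomplete.
  apply: anticomplete1 => u /arcP[i Hi ->]; rewrite eq_sym q_off adjC; split=> //.
  by apply: contraNN out => /uniq_k <-; slia.
split.
- by rewrite (hole_side k Hh) ?ok; [case: (side _) | slia].
- by rewrite (hole_adj Hh); slia.
- split.
  + by apply: linked_inner_arc => //; slia.
  + by apply: linkedC => //; rewrite -hn; apply: linked_inner_arc => //; slia.
  + by apply: (linkedC adjC); apply: linked_cons L; rewrite adjC.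
- split; [|by apply: qA; slia..].
  by apply: anticomplete_arcs => i j Hi Hj; apply: (hole_far Hh); slia.
- rewrite !in_setU3 !in_setU1 !negb_or !arc_avoid; try slia.
  rewrite ![_ == q]eq_sym !q_off hZ; split=> //=.
  by apply/negP => /(ZN _ k) []; rewrite ?eqxx // eq_sym; apply: (hole_neq Hh); slia.
Qed.

Lemma theta_of_two_nbrs i j : i < j < n -> adj q (h i) -> adj q (h j) ->
  side q != side (h 0) -> theta (h 0) q (arc h 1 i.+1) (arc h j n) Z.
Proof.
move=> ij qi qj sq; have [qZ hZ L far ZN] := att.
have iE := attachment_nbr (ltac:(slia) : i < n) qi.
have jE := attachment_nbr (ltac:(slia) : j < n) qj.
have par := hole_nbr_parity Hh ltac:(slia) qi qj.
have qN lo hi : q \notin arc h lo hi by apply/arcP => -[t _ /eqP]; apply/negP.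
split.
- by rewrite eq_sym.
- by rewrite adjC; apply: far; left.
- split; last exact: linkedC.
  + by apply: linked_arc => //; [slia | rewrite adjC].
  + apply: (linkedC adjC); apply: linked_arc => //; first by slia.
    by rewrite -hn; have := hS n.-1; rewrite (ltn_predK n3).
- split; [|by apply: attachment_anticomplete; slia..].
  by apply: anticomplete_arcs => a b Ha Hb; apply: (hole_far Hh); slia.
- by rewrite !in_setU3 !negb_or !qN qZ hZ !arc_avoid //; slia.
Qed.

(* If q has several neighbours on the hole, the theta joins the attached vertex and q; if
   it has only one, the theta joins the attached vertex and this neighbour. *)
Lemma small_theta_of_attachment0 k : k < n -> adj q (h k) ->
  (exists j, [/\ j < n, j != k & adj q (h j)]) <-> side q != side (h 0) ->
  small_theta (n + #|Z|).
Proof.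
move=> kn qk several; have [qZ _ _ _ _] := att; have kE := attachment_nbr kn qk.
have [sq|sq] := boolP (side q != side (h 0)).
  have [j [jn jk qj]] := proj2 several sq.
  wlog lt : j k {several kE} qj qk kn jn jk / j < k.
    move=> wl; have [lt|lt|E] := ltngtP j k; last by rewrite E eqxx in jk.
      exact: (wl j k).
    by apply: (wl k j) => //; rewrite eq_sym.
  exists (h 0), q, (arc h 1 j.+1), (arc h k n), Z; split.
    by apply: theta_of_two_nbrs; rewrite // lt.
  by have := card_arc h 1 j.+1; have := card_arc h k n; slia.
have uniq_k i : i < n -> adj q (h i) -> i = k.
  by move=> i_n qi; apply/eqP; apply: contraNT sq => ik; apply/several; exists i.
have ok : odd k.
  have := hole_nbr_side Hh (ltnW n3) qk.
  by move: sq; case: (side q); case: (side (h 0)); case: (odd k).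
exists (h 0), (h k), (arc h 1 k), (arc h k.+1 n), (q |: Z); split.
  exact: theta_of_one_nbr.
by rewrite cardsU1 qZ; have := card_arc h 1 k; have := card_arc h k.+1 n; slia.
Qed.

End Attachment.

Lemma small_theta_of_attachment h n q Z r k : hole h n -> 3 < n ->
  (forall i, q != h i) -> adj q (h k) -> attachment h q Z (h r) ->
  (exists j, adj q (h j) /\ h j != h k) <-> side q != side (h r) ->
  small_theta (n + #|Z|).
Proof.
move=> Hh n3 q_off qk att several; have n0 : 0 < n by slia.
have [k' [Hk Ek]] := hole_index_window Hh r k n0.
have kn : k' - r < n by slia.
have rk : r + (k' - r) = k' by slia.
have attr : attachment (fun i => h (r + i)) q Z (h (r + 0)).
  by rewrite addn0; apply: attachment_shift.
apply: (small_theta_of_attachment0 (hole_shift Hh r) n3 _ attr kn) => //.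
  by rewrite rk Ek.
rewrite addn0; apply: iff_trans several; split=> [[j [jn jk qj]]|[i [qi ik]]].
  exists (r + j); split=> //; rewrite -Ek.
  have [lt|lt|E] := ltngtP j (k' - r); last by rewrite E eqxx in jk.
    by apply: (hole_neq Hh); slia.
  by rewrite eq_sym; apply: (hole_neq Hh); slia.
have [j [Hj Ej]] := hole_index_window Hh r i n0.
exists (j - r); have -> : r + (j - r) = j by slia.
rewrite Ej; split=> //; first by slia.
by apply: contraNneq ik => E; rewrite -Ej -Ek; apply/eqP; congr h; slia.
Qed.

Lemma small_theta_of_two_attachments h n q (Zs Zt : {set T}) m k s t : hole h n -> 3 < n ->
  (forall i, q != h i) -> adj q (h k) -> side (h s) != side (h t) ->
  attachment h q Zs (h s) -> attachment h q Zt (h t) -> #|Zs| <= m -> #|Zt| <= m ->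
  small_theta (n + m).
Proof.
move=> Hh n3 q_off qk st atts attt ms mt; have n0 : 0 < n by slia.
have size (Z : {set T}) : #|Z| <= m -> small_theta (n + #|Z|) -> small_theta (n + m).
  move=> Zm [a [b [X [Y [W [Th lt]]]]]]; exists a, b, X, Y, W; split=> //.
  by apply: leq_trans lt _; rewrite leq_add2l.
pose several := [exists i : 'I_n, adj q (h i) && (h i != h k)].
have severalP : reflect (exists j, adj q (h j) /\ h j != h k) several.
  apply: (iffP existsP) => [[i /andP[qi ik]]|[j [qj jk]]]; first by exists i.
  by exists (Ordinal (ltn_pmod j n0)); rewrite /= (hole_modn Hh) qj.
have [E|E] := boolP (several == (side q != side (h s))).
  apply: (size Zs ms); apply: (small_theta_of_attachment Hh n3 q_off qk atts).
  by rewrite -(eqP E); split=> /severalP.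
apply: (size Zt mt); apply: (small_theta_of_attachment Hh n3 q_off qk attt).
suff <- : several = (side q != side (h t)) by split=> /severalP.
by move: E st; case: (several); case: (side q); case: (side (h s)); case: (side (h t)).
Qed.

End Bipartite.
Section Walks.
Variables (T : finType) (R : rel T).

Fixpoint walkb (k : nat) (s t : T) : bool :=
  if k is k'.+1 then [exists v, R s v && walkb k' v t] else s == t.

Lemma walkbP k s t :
  reflect (exists x, [/\ x 0 = s, x k = t & forall i, i < k -> R (x i) (x i.+1)])
          (walkb k s t).
Proof.
elim: k s => [|k IH] s /=.
  by apply: (iffP eqP) => [->|[x [<- <- _]]] //; exists (fun=> t).
apply: (iffP existsP) => [[v /andP[Rv /IH[x [x0 xk H]]]]|[x [x0 xk H]]].
  exists (fun i => if i is j.+1 then x j else s); split=> // -[|i] Hi /=; first by rewrite x0.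
  exact: H.
exists (x 1); rewrite -x0 H //=; apply/IH.
by exists (fun i => x i.+1); split=> // i Hi; apply: H.
Qed.

Lemma walkb_segment x i j : i <= j -> (forall k, i <= k < j -> R (x k) (x k.+1)) ->
  walkb (j - i) (x i) (x j).
Proof.
move=> ij H; apply/walkbP; exists (fun t => x (i + t)); rewrite addn0 subnKC //.
by split=> // t Ht; rewrite addnS; apply: H; slia.
Qed.

Lemma walkb_cat j k s t u : walkb j s t -> walkb k t u -> walkb (j + k) s u.
Proof.
elim: j s => [|j IH] s /=; first by move/eqP=> ->.
move=> /existsP[v /andP[sv vt]] tu; apply/existsP; exists v; rewrite sv.
exact: IH vt tu.
Qed.

Lemma walkb_rcons k s v : walkb k.+1 s v = [exists u, walkb k s u && R u v].
Proof.
apply/idP/existsP => [|[u /andP[su uv]]].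
  elim: k s => [|k IH] s /existsP[w /andP[sw]]; first by move/eqP=> <-; exists s; rewrite /= eqxx.
  move/IH=> [u /andP[wu uv]]; exists u; rewrite uv andbT.
  by apply/existsP; exists w; rewrite sw.
by rewrite -addn1; apply: walkb_cat su _; apply/existsP; exists v; rewrite uv /=.
Qed.

Lemma walkbC k s t : symmetric R -> walkb k s t -> walkb k t s.
Proof.
move=> RC; elim: k s => [|k IH] s; first by rewrite /= eq_sym.
move=> /existsP[v /andP[sv /IH vt]]; rewrite walkb_rcons.
by apply/existsP; exists v; rewrite vt RC.
Qed.

Lemma walkb_connect j s t : walkb j s t -> connect R s t.
Proof.
elim: j s => [|j IH] s /=; first by move=> /eqP ->.
by move=> /existsP[v /andP[Rv /IH Hv]]; apply: connect_trans (connect1 Rv) Hv.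
Qed.

Lemma connect_walkb s t : connect R s t -> exists2 j, j < #|T| & walkb j s t.
Proof.
move=> /connectP[p0 Hp0 ->]; case/shortenP: Hp0 => p Hp Up _.
exists (size p).
  by have /card_uniqP := Up; have := max_card (mem (s :: p)) => + E; rewrite E.
elim: p s Hp {Up} => [|v p IH] s //= /andP[Rv Hp].
by apply/existsP; exists v; rewrite Rv IH.
Qed.

End Walks.

Lemma eq_walkb (T : finType) (R R' : rel T) k s t :
  R =2 R' -> walkb R k s t = walkb R' k s t.
Proof. by move=> E; elim: k s => //= k IH s; apply: eq_existsb => v; rewrite E IH. Qed.

Section Touching.
Variables (T : finType) (adj : rel T).

Definition touches (B : {set T}) (v : T) : bool := [exists z in B, (v == z) || adj v z].

Lemma touchesPn (B : {set T}) v :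
  reflect (forall z, z \in B -> v != z /\ ~~ adj v z) (~~ touches B v).
Proof.
rewrite negb_exists; apply: (iffP forallP) => H z.
  by move=> zB; have := H z; rewrite zB negb_or => /andP.
by rewrite negb_and -implybE; apply/implyP => /H/andP; rewrite negb_or.
Qed.

(* The first vertex of a walk that touches B is not in B, for its predecessor does not. *)
Lemma touching_step (B : {set T}) u v : adj u v -> ~~ touches B u -> touches B v ->
  v \notin B /\ exists2 z, z \in B & adj v z.
Proof.
move=> uv /touchesPn uB /existsP[z /andP[zB vz]].
have vB : v \notin B by apply/negP => /uB[_]; rewrite uv.
split=> //; exists z => //; case/orP: vz => // /eqP vz.
by rewrite vz zB in vB.
Qed.

End Touching.

(** * Detecting thetas *)

Section SplitThetas.
Variables (T : finType) (adj : rel T) (side : T -> bool).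
Hypothesis adjC : symmetric adj.
Hypothesis bip : forall x y, adj x y -> side x != side y.

Notation hole := (hole adj).
Notation theta := (theta adj side).
Notation small_theta := (small_theta adj side).
Notation linked := (linked adj).
Notation anticomplete := (anticomplete adj).
Notation touches := (touches adj).

Implicit Types (r : bool -> T) (k : 'I_3 -> nat) (w : 'I_3 -> bool -> nat -> T).

(* A theta cut at the middle edges of its three paths: [r] are the two ends, [w i b] is the
   half of the i-th path starting next to [r b]. *)
Record split_theta r k w : Prop := SplitTheta {
  split_ends_side : side (r false) != side (r true);
  split_ends_nadj : ~~ adj (r false) (r true);
  split_first_adj : forall i b, adj (r b) (w i b 0);
  split_step : forall i b j, j < k i -> adj (w i b j) (w i b j.+1);
  split_middle : forall i, adj (w i false (k i)) (w i true (k i));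
  split_anticomplete : forall i i' b b' j j', i != i' -> j <= k i -> j' <= k i' ->
    w i b j != w i' b' j' /\ ~~ adj (w i b j) (w i' b' j');
  split_end_nbr : forall i b c j, j <= k i ->
    w i b j != r c /\ (adj (w i b j) (r c) -> j = 0 /\ b = c)
}.

Definition theta_route k w i : {set T} :=
  arc (w i false) 0 (k i).+1 :|: arc (w i true) 0 (k i).+1.

Lemma theta_routeP k w i x :
  reflect (exists b j, j <= k i /\ x = w i b j) (x \in theta_route k w i).
Proof.
rewrite inE; apply: (iffP orP) => [[] /arcP[j Hj ->]|[b [j [Hj ->]]]].
- by exists false, j.
- by exists true, j.
- by case: b; [right|left]; apply: mem_arc.
Qed.

Lemma card_theta_route k w i : #|theta_route k w i| <= (k i).+1.*2.
Proof.
rewrite cardsU; have := card_arc (w i false) 0 (k i).+1.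
by have := card_arc (w i true) 0 (k i).+1; move: #|_| #|_| #|_| => a b c; slia.
Qed.

Lemma ord3_ordSP (i j : 'I_3) : [\/ j = i, j = ordS i | j = ordS (ordS i)].
Proof.
have [->|ji] := eqVneq j i; first by constructor 1.
have [->|ji1] := eqVneq j (ordS i); first by constructor 2.
constructor 3; apply/val_inj; move: ji ji1.
by case: i j => [[|[|[|i]]] Hi] // [[|[|[|j]]] Hj].
Qed.

Lemma ord3_ordS_neq (i : 'I_3) :
  [/\ i != ordS i, i != ordS (ordS i) & ordS i != ordS (ordS i)].
Proof. by case: i => [[|[|[|i]]] Hi]. Qed.

Definition split_theta_size k : nat := \sum_i (k i).+1.*2.

Lemma split_theta_sizeE k i :
  split_theta_size k = (k i).+1.*2 + (k (ordS i)).+1.*2 + (k (ordS (ordS i))).+1.*2.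
Proof.
have [n1 n2 n3] := ord3_ordS_neq i.
rewrite /split_theta_size (bigD1 i) //= (bigD1 (ordS i)) /=; last by rewrite eq_sym.
rewrite (bigD1 (ordS (ordS i))) /=; last by rewrite eq_sym n2 eq_sym n3.
rewrite big1 ?addn0 ?addnA // => j.
by have [->|->|->] := ord3_ordSP i j; rewrite ?eqxx ?andbF.
Qed.

Section SplitTheta.
Variables (r : bool -> T) (k : 'I_3 -> nat) (w : 'I_3 -> bool -> nat -> T).
Hypothesis F : split_theta r k w.

Let route := theta_route k w.

Lemma theta_route_linked i b : linked (route i) (r b) (r (~~ b)).
Proof.
have wR c j : j <= k i -> w i c j \in route i by move=> H; apply/theta_routeP; exists c, j.
have half c : connect (restrict adj (route i)) (w i c 0) (w i c (k i)).
  by apply: connect_segment => // j Hj; [apply: (split_step F) | apply: wR; slia].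
exists (w i b 0), (w i (~~ b) 0).
split; rewrite ?wR ?(split_first_adj F) //; first by rewrite adjC (split_first_adj F).
apply: connect_trans (half b) _; rewrite connect_restrictC //.
apply: connect_trans (half (~~ b)) _; apply: connect1; rewrite /restrict !wR // !andbT.
by case: b => /=; rewrite ?(split_middle F) // adjC (split_middle F).
Qed.

Lemma theta_route_avoid i c : r c \notin route i.
Proof.
apply/negP => /theta_routeP[b [j [Hj E]]].
by have [] := split_end_nbr F b c Hj; rewrite E eqxx.
Qed.

Lemma theta_route_anticomplete i i' : i != i' -> anticomplete (route i) (route i').
Proof.
move=> ne x y /theta_routeP[b [j [Hj ->]]] /theta_routeP[b' [j' [Hj' ->]]].
exact: (split_anticomplete F).
Qed.

Lemma theta_of_split_theta i :
  theta (r false) (r true) (route i) (route (ordS i)) (route (ordS (ordS i))).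
Proof.
have [n1 n2 n3] := ord3_ordS_neq i; have [sr Nr _ _ _ _ _] := F.
split; rewrite ?in_setU3 ?(negbTE (theta_route_avoid _ _)) //.
- by split; apply: theta_route_linked.
- by split; apply: theta_route_anticomplete.
Qed.

Lemma split_ends_far c : r c != r (~~ c) /\ ~~ adj (r c) (r (~~ c)).
Proof.
have [sr Nr _ _ _ _ _] := F.
by split; case: c; rewrite // 1?[adj _ _]adjC //; [rewrite eq_sym|]; apply: side_neq sr.
Qed.

Hypothesis minF : ~ small_theta (split_theta_size k).

(* The route contains an induced path between the ends, which by minimality uses all its
   vertices. *)
Lemma minimal_theta_induced_path i b : exists x,
  [/\ induced_path adj x (k i).+1.*2.+1, x 0 = r b, x (k i).+1.*2.+1 = r (~~ b)
    & arc x 1 (k i).+1.*2.+1 = route i].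
Proof.
have [sr Nr [_ link1 link2] [anti1 anti2 anti12] [Nfalse Ntrue]] := theta_of_split_theta i.
have [rb Nb] := split_ends_far b.
have [x [l [l1 x0 xl Hx sub]]] := linked_induced_path (theta_route_linked i b) rb Nb.
have link : linked (arc x 1 l) (r false) (r true).
  have : linked (arc x 1 l) (r b) (r (~~ b)).
    rewrite -x0 -xl; apply: linked_inner_arc => // j /andP[_].
    exact: induced_path_adjS Hx.
  by case: (b) => // /(linkedC adjC).
have Th : theta (r false) (r true) (arc x 1 l) (route (ordS i)) (route (ordS (ordS i))).
  split=> //; first by split=> //; apply: anticompleteS sub (subxx _) _.
  by split; [move: Nfalse | move: Ntrue]; apply: contra; rewrite !in_setU3;
    move=> /or3P[/(subsetP sub) ->|->|->]; rewrite ?orbT.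
have cx : #|arc x 1 l| = l.-1.
  by rewrite card_arc_inj ?subn1 // => p q Hp Hpq; have [|-> _] := Hx p q; slia.
have cR i' : #|route i'| <= (k i').+1.*2 := card_theta_route k w i'.
have l_le : l.-1 <= (k i).+1.*2 by rewrite -cx (leq_trans (subset_leq_card sub)).
have l_ge : (k i).+1.*2 <= l.-1.
  rewrite leqNgt; apply/negP => lt; apply: minF; rewrite (split_theta_sizeE k i).
  do 5 eexists; split; first exact: Th.
  by have := cR (ordS i); have := cR (ordS (ordS i)); rewrite cx; slia.
have lE : l = (k i).+1.*2.+1 by slia.
exists x; rewrite -lE; split=> //; apply/eqP; rewrite eqEcard sub cx.
by apply: leq_trans (cR i) _.
Qed.

Definition other_routes i : {set T} := route (ordS i) :|: route (ordS (ordS i)).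

Lemma other_routesP i z :
  reflect (exists i' c j, [/\ i' != i, j <= k i' & z = w i' c j]) (z \in other_routes i).
Proof.
have [n1 n2 _] := ord3_ordS_neq i.
apply: (iffP setUP) => [[] /theta_routeP[c [j [Hj ->]]]|[i' [c [j [Hi Hj ->]]]]].
- by exists (ordS i), c, j; rewrite eq_sym.
- by exists (ordS (ordS i)), c, j; rewrite eq_sym.
have [E|E|E] := ord3_ordSP i i'; first by rewrite E eqxx in Hi.
  by left; apply/theta_routeP; exists c, j; rewrite -E.
by right; apply/theta_routeP; exists c, j; rewrite -E.
Qed.

Lemma minimal_theta_hole i : exists h,
  [/\ hole h ((k (ordS i)).+1.*2.+1 + (k (ordS (ordS i))).+1.*2.+1),
      forall c, exists t, h t = r c,
      forall t, (exists c, h t = r c) \/ h t \in other_routes i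
    & forall z, z \in other_routes i -> exists t, h t = z].
Proof.
have [_ _ n3] := ord3_ordS_neq i.
have [x [Hx x0 xl xR]] := minimal_theta_induced_path (ordS i) false.
have [y [Hy y0 ym yR]] := minimal_theta_induced_path (ordS (ordS i)) false.
have XY := theta_route_anticomplete n3; rewrite -xR -yR in XY.
have [||||h [Hh h0 hl hR Rh]] :=
  hole_of_anticomplete_paths adjC Hx Hy _ _ _ _ XY; rewrite ?x0 ?y0 ?xl ?ym //.
rewrite /other_routes -xR -yR; exists h; split=> // [[]|t].
- by exists (k (ordS i)).+1.*2.+1; rewrite hl xl.
- by exists 0; rewrite h0 x0.
- have [->|->|tR] := hR t; [left; exists false|left; exists true|by right].
    by rewrite x0.
  by rewrite xl.
Qed.

End SplitTheta.

Definition replace_half w i b (u : nat -> T) : 'I_3 -> bool -> nat -> T :=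
  fun i' b' => if (i' == i) && (b' == b) then u else w i' b'.

Section ReplaceHalf.
Variables (r : bool -> T) (k : 'I_3 -> nat) (w : 'I_3 -> bool -> nat -> T).
Hypotheses (F : split_theta r k w) (minF : ~ small_theta (split_theta_size k)).
Variables (i : 'I_3) (b : bool) (u : nat -> T).
Hypotheses (u0 : u 0 = w i b 0) (uk : u (k i) = w i b (k i)).
Hypothesis uS : forall j, j < k i -> adj (u j) (u j.+1).
Hypothesis u_ends : forall j c, 0 < j <= k i -> ~~ adj (u j) (r c).
Hypothesis u_firsts : forall j c i', 0 < j <= k i -> i' != i -> ~~ adj (u j) (w i' c 0).

Let B := other_routes k w i.

Lemma half_untouched c j : j <= k i -> ~~ touches B (w i c j).
Proof.
move=> Hj; apply/touchesPn => z /(other_routesP k w)[i' [c' [j' [ne Hj' ->]]]].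
by apply: (split_anticomplete F); rewrite // eq_sym.
Qed.

Lemma new_half_neq_end j c : j <= k i -> u j != r c.
Proof.
case: j => [|j] Hj; first by rewrite u0; have [] := split_end_nbr F b c (leq0n (k i)).
have [ne _ _] := ord3_ordS_neq i.
apply: contraTneq (split_first_adj F (ordS i) c) => <-.
by apply: u_firsts => //; rewrite eq_sym.
Qed.

Section LastTouching.
Variable j : nat.
Hypotheses (jk : 0 < j < k i) (uj : touches B (u j)).
Hypothesis after : forall j', j < j' <= k i -> ~~ touches B (u j').

Let Z c : {set T} := arc u j.+1 (k i).+1 :|: arc (w i c) 0 (k i).+1.

Lemma detour_far v c : v \in Z c ->
  [/\ ~~ touches B v, forall c', v != r c' & forall c', adj v (r c') -> c' = c].
Proof.
case/setUP => /arcP[j' Hj' ->].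
  split=> [|c'|c']; first by apply: after; slia.
    by apply: new_half_neq_end; slia.
  by rewrite (negbTE (u_ends _ _)) //; slia.
split=> [|c'|c' A]; first by apply: half_untouched; slia.
  by have [] := split_end_nbr F c c' (ltac:(slia) : j' <= k i).
by have [_ /(_ A)[]] := split_end_nbr F c c' (ltac:(slia) : j' <= k i).
Qed.

Lemma card_detour c : #|Z c| <= (k i).*2.
Proof.
rewrite cardsU; have := card_arc u j.+1 (k i).+1; have := card_arc (w i c) 0 (k i).+1.
by move: #|_| #|_| #|_| => x y z; slia.
Qed.

Lemma detour_linked c : linked (Z c) (u j) (r c).
Proof.
have uZ j' : j < j' <= k i -> u j' \in Z c by move=> le_j; rewrite inE mem_arc.
have wZ j' : j' <= k i -> w i c j' \in Z c by move=> le_j; rewrite inE orbC mem_arc.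
exists (u j.+1), (w i c 0); split; rewrite ?uZ ?wZ ?uS ?(split_first_adj F) //; try slia.
  by rewrite adjC (split_first_adj F).
apply: (@connect_trans _ _ (u (k i))).
  by apply: connect_segment => [|j' le_j|j' le_j]; [slia | apply: uS; slia | apply: uZ; slia].
apply: (@connect_trans _ _ (w i c (k i))); last first.
  rewrite connect_restrictC //.
  by apply: connect_segment => [|j' ?|j' ?]; [slia | apply: (split_step F); slia | apply: wZ; slia].
have [->|cb] := eqVneq c b; first by rewrite uk.
apply: connect1; rewrite /restrict uZ ?wZ //; last by slia.
rewrite uk !andbT; case: (c) (b) cb => [] [] // _; rewrite ?(split_middle F) //.
by rewrite adjC (split_middle F).
Qed.

Lemma detour_attachment h c : 
  (forall t, (exists c', h t = r c') \/ h t \in B) -> attachment adj h (u j) (Z c) (r c).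
Proof.
move=> hB; split=> [|||t ht|v t vZ ht].
- by apply/negP => /detour_far[]; rewrite uj.
- by apply/negP => /detour_far[_ /(_ c)]; rewrite eqxx.
- exact: detour_linked.
- have [[c' ->]|] := hB t; first exact: u_ends (ltac:(slia) : 0 < j <= k i).
  move/(other_routesP k w)=> [i' [c' [j' [ne Hj' E]]]]; rewrite E in ht *.
  have [neq nbr] := split_end_nbr F c' c Hj'; have [E0|A] := ht.
    by rewrite E0 eqxx in neq.
  by have [-> _] := nbr A; apply: u_firsts => //; slia.
have [v1 v2 v3] := detour_far vZ; have [[c' E]|tB] := hB t; last exact: (touchesPn _ _ _ v1).
by rewrite E in ht *; split=> //; apply: contraNN ht => /v3 ->.
Qed.

Lemma last_touching_absurd : False.
Proof.
have jlt : j < k i by slia.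
have [ujB [z zB ujz]] : u j \notin B /\ exists2 z, z \in B & adj (u j) z.
  by apply: (touching_step (u := u j.+1)) => //; [rewrite adjC uS | apply: after; slia].
have [h [Hh hr hB Bh]] := minimal_theta_hole F minF i.
have [t ht] := Bh z zB; have [s hs] := hr false; have [s' hs'] := hr true.
have q_off t' : u j != h t'.
  have [[c ->]|tB] := hB t'; first by apply: new_half_neq_end; slia.
  by apply: contraNneq ujB => ->.
have atts := detour_attachment false hB; have attt := detour_attachment true hB.
rewrite -ht in ujz; rewrite -hs in atts; rewrite -hs' in attt.
have st : side (h s) != side (h s') by rewrite hs hs' (split_ends_side F).
have n3 : 3 < (k (ordS i)).+1.*2.+1 + (k (ordS (ordS i))).+1.*2.+1 by slia.
have [a [c [X [Y [W [Th lt]]]]]] := small_theta_of_two_attachments adjC bip Hh n3 q_off ujz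
  st atts attt (card_detour false) (card_detour true).
apply: minF; rewrite (split_theta_sizeE k i); exists a, c, X, Y, W; split=> //.
by apply: leq_trans lt _; slia.
Qed.

End LastTouching.

Lemma new_half_untouched j : j <= k i -> ~~ touches B (u j).
Proof.
move=> Hj; apply/negP => uj.
pose P j := (j <= k i) && touches B (u j).
have exP : exists j, P j by exists j; rewrite /P Hj.
have ubP j' : P j' -> j' <= k i by case/andP.
case: (ex_maxnP exP ubP) => {uj Hj}j /andP[Hj uj] max_j.
apply: (@last_touching_absurd j) => //.
  have j0 : j != 0 by apply: contraTneq uj => ->; rewrite u0 half_untouched.
  have jk : j != k i by apply: contraTneq uj => ->; rewrite uk half_untouched.
  by slia.
move=> j' /andP[jj' Hj']; apply/negP => H.
by have := max_j j'; rewrite /P Hj' H => /(_ isT); slia.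
Qed.

Lemma split_theta_replace_half : split_theta r k (replace_half w i b u).
Proof.
have same i' c j : j = 0 \/ j = k i' -> replace_half w i b u i' c j = w i' c j.
  by rewrite /replace_half; case: andP => [[/eqP -> /eqP ->] [] ->|].
have new i' c j j' : i' != i -> j <= k i -> j' <= k i' ->
    u j != w i' c j' /\ ~~ adj (u j) (w i' c j').
  move=> ne /new_half_untouched/touchesPn untouched Hj'; apply: untouched.
  by apply/other_routesP; exists i', c, j'.
split; rewrite ?(split_ends_side F) ?(split_ends_nadj F) //.
- by move=> i' c; rewrite same ?(split_first_adj F) //; left.
- move=> i' c j; rewrite /replace_half; case: andP => [[/eqP -> _]|_]; first exact: uS.
  exact: (split_step F).
- by move=> i'; rewrite !same ?(split_middle F) //; right.
- move=> i1 i2 b1 b2 j1 j2 ne Hj1 Hj2; rewrite /replace_half.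
  case: andP => [[/eqP i1E _]|_]; case: andP => [[/eqP i2E _]|_].
  + by rewrite i1E i2E eqxx in ne.
  + by subst i1; apply: new; rewrite // eq_sym.
  + by subst i2; rewrite eq_sym adjC; apply: new.
  + exact: (split_anticomplete F).
- move=> i' b' c j; rewrite /replace_half; case: andP => [[/eqP -> /eqP ->]|_]; last first.
    exact: (split_end_nbr F).
  move=> Hj; split; first exact: new_half_neq_end.
  case: j Hj => [|j] Hj; last by rewrite (negbTE (u_ends _ _)).
  by rewrite u0; have [] := split_end_nbr F b c (leq0n (k i)).
Qed.

End ReplaceHalf.

Lemma minimal_split_theta_bound r k w i :
  split_theta r k w -> ~ small_theta (split_theta_size k) -> k i < #|T|.
Proof.
move=> F minF; have [x [Hx _ _ _]] := minimal_theta_induced_path F minF i false.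
have := max_card (mem (arc x 0 (k i).+1)); rewrite card_arc_inj ?subn0 //.
by move=> p q _ pq; have [] := Hx p q ltac:(slia).
Qed.

Definition halves (x : nat -> T) n (c : bool) j : T := if c then x (n - j.+1) else x j.+1.

Lemma split_theta_of_paths a b (x : 'I_3 -> nat -> T) k :
  side a != side b -> ~~ adj a b ->
  (forall i, [/\ induced_path adj (x i) (k i).*2.+3, x i 0 = a & x i (k i).*2.+3 = b]) ->
  (forall i i', i != i' ->
     anticomplete (arc (x i) 1 (k i).*2.+3) (arc (x i') 1 (k i').*2.+3)) ->
  split_theta (fun c => if c then b else a) k (fun i => halves (x i) (k i).*2.+3).
Proof.
move=> sab Nab paths anti.
have x0 i : x i 0 = a by have [] := paths i.
have xl i : x i (k i).*2.+3 = b by have [] := paths i.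
have xadj i p q : p < q <= (k i).*2.+3 -> adj (x i p) (x i q) = (q == p.+1).
  by move=> pq; have [Hi _ _] := paths i; have [] := Hi p q.
have xneq i p q : p < q <= (k i).*2.+3 -> x i p != x i q.
  by move=> pq; have [Hi _ _] := paths i; have [] := Hi p q.
split=> //.
- by move=> i [] /=; [rewrite adjC -(xl i) xadj | rewrite -(x0 i) xadj]; slia.
- by move=> i [] j Hj; rewrite /halves; [rewrite adjC|]; rewrite xadj; slia.
- by move=> i; rewrite /halves xadj; slia.
- move=> i i' c c' j j' ne Hj Hj'; apply: (anti i i' ne).
    by rewrite /halves; case: c; apply: mem_arc; slia.
  by rewrite /halves; case: c'; apply: mem_arc; slia.
move=> i c c' j Hj; rewrite /halves; case: c; case: c'; rewrite -?(x0 i) -?(xl i).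
- by rewrite xadj ?xneq; try slia; split=> // /eqP; slia.
- by rewrite adjC eq_sym xadj ?xneq; try slia; split=> // /eqP; slia.
- by rewrite xadj ?xneq; try slia; split=> // /eqP; slia.
- by rewrite adjC eq_sym xadj ?xneq; try slia; split=> // /eqP [->]; slia.
Qed.

Lemma linked_long_path X a b : linked X a b -> side a != side b -> ~~ adj a b ->
  exists x n, [/\ induced_path adj x n.*2.+3, x 0 = a, x n.*2.+3 = b
                & arc x 1 n.*2.+3 \subset X].
Proof.
move=> L sab Nab; have [x [l [Hx x0 xl [ol l1] sub]]] := linked_odd_path bip L sab Nab.
exists x, (l - 3)./2; have -> : (l - 3)./2.*2.+3 = l by slia.
by split.
Qed.

Lemma split_theta_of_theta a b X Y Z : theta a b X Y Z ->
  exists r k w, split_theta r k w /\ split_theta_size k <= #|X| + #|Y| + #|Z|.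
Proof.
move=> [sab Nab [LX LY LZ] [XY XZ YZ] _].
pose S (i : 'I_3) := nth X [:: X; Y; Z] i.
have S_linked i : linked (S i) a b by case: i => [[|[|[|i]]] Hi].
have S_anti i i' : i != i' -> anticomplete (S i) (S i').
  case: i i' => [[|[|[|i]]] Hi] // [[|[|[|i']]] Hi'] // _; rewrite /S //=;
    exact: (anticompleteC adjC).
have /fin_all_exists[x Hx] i : exists x, exists n, [/\ induced_path adj x n.*2.+3, x 0 = a,
    x n.*2.+3 = b & arc x 1 n.*2.+3 \subset S i] by apply: linked_long_path (S_linked i) sab Nab.
have /fin_all_exists[k Hk] i := Hx i.
do 3 eexists; split.
  apply: (split_theta_of_paths sab Nab (x := x) (k := k)) => [i|i i' ne].
    by have [Hi xa xb _] := Hk i; split.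
  have [_ _ _ sub] := Hk i; have [_ _ _ sub'] := Hk i'.
  exact: anticompleteS sub sub' (S_anti _ _ ne).
have card_S i : (k i).+1.*2 <= #|S i|.
  have [Hi _ _ sub] := Hk i; apply: leq_trans (subset_leq_card sub).
  by rewrite card_arc_inj ?subn1 // => p q Hp Hpq; have [|-> _] := Hi p q; slia.
rewrite (split_theta_sizeE k ord0).
exact: leq_add (leq_add (card_S ord0) (card_S (ordS ord0))) (card_S (ordS (ordS ord0))).
Qed.

(* A description of a theta by boundedly many vertices and numbers. [free_step] keeps the
   walks from [s i b] to [m i b] away from the ends and from the first vertices of the
   other paths. *)
Definition free_of_ends r (s : 'I_3 -> bool -> T) (i : 'I_3) (v : T) : bool :=
  [forall c, ~~ adj v (r c)] && [forall i', (i' != i) ==> [forall c, ~~ adj v (s i' c)]].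

Definition free_step r s i : rel T := fun u v => adj u v && free_of_ends r s i v.

Definition between r (s m : 'I_3 -> bool -> T) k i b v : Prop :=
  exists j1 j2, [/\ j1 + j2 = k i, walkb (free_step r s i) j1 (s i b) v
                  & walkb (free_step r s i) j2 v (m i b)].

Record theta_frame r (s m : 'I_3 -> bool -> T) k : Prop := ThetaFrame {
  theta_frame_ends : ~~ adj (r false) (r true);
  theta_frame_first : forall i b, adj (r b) (s i b);
  theta_frame_middle : forall i, adj (m i false) (m i true);
  theta_frame_walk : forall i b, walkb (free_step r s i) (k i) (s i b) (m i b);
  theta_frame_anticomplete : forall i i' b b' v v', i != i' ->
    between r s m k i b v -> between r s m k i' b' v' -> v != v' /\ ~~ adj v v'
}.

Section ThetaFrameSound.
Variables (r : bool -> T) (s m : 'I_3 -> bool -> T) (k : 'I_3 -> nat).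
Hypothesis F : theta_frame r s m k.

Let route i : {set T} := [set v | [exists b, exists j : 'I_(k i).+1,
  walkb (free_step r s i) j (s i b) v && walkb (free_step r s i) (k i - j) v (m i b)]].

Lemma between_routeP i v : reflect (exists b, between r s m k i b v) (v \in route i).
Proof.
rewrite inE; apply: (iffP existsP) => [[b /existsP[j /andP[H1 H2]]]|[b [j1 [j2 [E H1 H2]]]]].
  by exists b, j, (k i - j); split=> //; have := ltn_ord j; slia.
have Hj : j1 < (k i).+1 by slia.
by exists b; apply/existsP; exists (Ordinal Hj); rewrite /= H1 -E addKn.
Qed.

Lemma theta_frame_path i b : exists x, [/\ x 0 = s i b, x (k i) = m i b,
  forall j, j < k i -> adj (x j) (x j.+1) & forall j, j <= k i -> x j \in route i].
Proof.
have /walkbP[x [x0 xk xS]] := theta_frame_walk F i b.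
exists x; split=> // [j /xS/andP[] // |j jk].
apply/between_routeP; exists b, j, (k i - j); rewrite -x0 -xk; split; first by slia.
  by rewrite -[j in walkb _ j]subn0; apply: walkb_segment => // t Ht; apply: xS; slia.
by apply: walkb_segment => // t Ht; apply: xS; slia.
Qed.

Lemma between_route_first i b : s i b \in route i.
Proof. by have [x [<- _ _ xR]] := theta_frame_path i b; apply: xR. Qed.

Lemma between_route_middle i b : m i b \in route i.
Proof. by have [x [_ <- _ xR]] := theta_frame_path i b; apply: xR. Qed.

Lemma between_route_linked i : linked (route i) (r false) (r true).
Proof.
have half b : connect (restrict adj (route i)) (s i b) (m i b).
  have [x [<- <- xS xR]] := theta_frame_path i b.
  exact: connect_segment.
exists (s i false), (s i true).
split; rewrite ?between_route_first ?(theta_frame_first F) //.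
  by rewrite adjC (theta_frame_first F).
apply: connect_trans (half false) _; rewrite connect_restrictC //.
apply: connect_trans (half true) _; apply: connect1.
by rewrite /restrict !between_route_middle adjC (theta_frame_middle F).
Qed.

Lemma between_route_anticomplete i i' : i != i' -> anticomplete (route i) (route i').
Proof.
move=> ne v v' /between_routeP[b Hb] /between_routeP[b' Hb'].
exact: (theta_frame_anticomplete F ne Hb Hb').
Qed.

Lemma between_route_avoid i c : r c \notin route i.
Proof.
have [ne _ _] := ord3_ordS_neq i; apply/negP => H.
have [_] := between_route_anticomplete ne H (between_route_first (ordS i) c).
by rewrite (theta_frame_first F).
Qed.

Lemma theta_frame_ends_side : side (r false) != side (r true).
Proof.
have sm b : side (m ord0 b) = side (r b) (+) ~~ odd (k ord0).
  have [x [x0 <- xS _]] := theta_frame_path ord0 b.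
  rewrite (walk_side bip xS (leqnn _)) x0 (side_adj bip (theta_frame_first F ord0 b)).
  by case: (side (s _ b)); case: (odd _).
have := bip (theta_frame_middle F ord0); rewrite !sm.
by case: (side (r false)); case: (side (r true)); case: (odd _).
Qed.

Lemma theta_frame_sound : exists a b X Y Z, theta a b X Y Z.
Proof.
have [n1 n2 n3] := ord3_ordS_neq ord0.
exists (r false), (r true), (route ord0), (route (ordS ord0)), (route (ordS (ordS ord0))).
split; rewrite ?in_setU3 ?(negbTE (between_route_avoid _ _)) ?theta_frame_ends_side //.
- exact: theta_frame_ends F.
- by split; apply: between_route_linked.
- by split; apply: between_route_anticomplete.
Qed.

End ThetaFrameSound.

Let first w i c : T := w i c 0.
Let middle k w i c : T := w i c (k i).

Lemma between_path r k w i b v : between r (first w) (middle k w) k i b v ->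
  exists u j, [/\ j <= k i, v = u j, u 0 = w i b 0, u (k i) = w i b (k i)
    & forall j', j' < k i -> free_step r (first w) i (u j') (u j'.+1)].
Proof.
move=> [j1 [j2 [lenE walk1 walk2]]].
have := walkb_cat walk1 walk2; rewrite lenE => /walkbP[y [y0 yk yS]].
move: walk1 walk2 => /walkbP[x [x0 xj xS]] /walkbP[z [z0 zj zS]].
exists (fun t => if t <= j1 then x t else z (t - j1)), j1; rewrite leqnn xj.
split=> //; first by slia.
  rewrite -[RHS]zj; case: leqP => C; last by congr z; slia.
  have kE : k i = j1 by slia.
  by rewrite kE xj -z0; congr z; slia.
move=> j' Hj'; case: (ltnP j' j1) => C; first by rewrite (ltnW C); apply: xS.
rewrite (subSn C); case: leqP => C'; last by apply: zS; slia.
have -> : j' = j1 by slia.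
by rewrite xj subnn -z0; apply: zS; slia.
Qed.

Lemma split_theta_replace_free r k w i b u :
  split_theta r k w -> ~ small_theta (split_theta_size k) ->
  u 0 = w i b 0 -> u (k i) = w i b (k i) ->
  (forall j, j < k i -> free_step r (first w) i (u j) (u j.+1)) ->
  split_theta r k (replace_half w i b u).
Proof.
move=> F minF u0 uk uS; apply: split_theta_replace_half => //.
- by move=> j /uS /andP[].
- by case=> // j c Hj; have /andP[_ /andP[/forallP]] := uS j ltac:(slia).
- case=> // j c i' Hj ne; have /andP[_ /andP[_ /forallP/(_ i')/implyP/(_ ne)]] := uS j ltac:(slia).
  by move/forallP/(_ c).
Qed.

(* Walks through two different halves can replace these halves one after the other, so that
   the paths of the resulting theta show that the walks do not meet. *)
Lemma minimal_split_theta_frame r k w :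
  split_theta r k w -> ~ small_theta (split_theta_size k) ->
  theta_frame r (first w) (middle k w) k.
Proof.
move=> F minF; split.
- exact: (split_ends_nadj F).
- exact: (split_first_adj F).
- exact: (split_middle F).
- move=> i b; apply/walkbP; exists (w i b); split=> // j Hj.
  rewrite /free_step (split_step F) //=; apply/andP; split; apply/forallP => c.
    by apply/negP => step; have [_ /(_ step)[]] := split_end_nbr F b c Hj.
  apply/implyP => ne; apply/forallP => c'.
  by have [] := @split_anticomplete _ _ _ F i c b c' j.+1 0; rewrite // eq_sym.
move=> i i' b b' v v' ne /between_path[u [j [Hj -> u0 uk uS]]].
move=> /between_path[u' [j' [Hj' -> u0' uk' uS']]].
have same i1 c j1 : j1 = 0 \/ j1 = k i1 -> replace_half w i b u i1 c j1 = w i1 c j1.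
  by rewrite /replace_half; case: andP => [[/eqP -> /eqP ->] [] ->|].
have F_u := split_theta_replace_free F minF u0 uk uS.
have F_uu : split_theta r k (replace_half (replace_half w i b u) i' b' u').
  apply: split_theta_replace_free => //; rewrite ?same //; try by [left|right].
  move=> t /uS' /andP[step /andP[ends /forallP other]].
  rewrite /free_step step /free_of_ends ends /=.
  apply/forallP => i1; have := other i1; case: (i1 != i') => //= /forallP other1.
  by apply/forallP => c; rewrite /first same; [exact: other1 | left].
have := split_anticomplete F_uu b b' ne Hj Hj'.
by rewrite /replace_half !eqxx /= (negbTE ne).
Qed.

Lemma theta_free_of_frame_free :
  (forall r s m k, (forall i, k i < #|T|) -> ~ theta_frame r s m k) -> theta_free adj side.
Proof.
move=> no_frame a b X Y Z Th; have [N] := ubnP (#|X| + #|Y| + #|Z|).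
elim: N a b X Y Z Th => // N IH a b X Y Z Th sz.
have [r [k [w [F size_k]]]] := split_theta_of_theta Th.
have minF : ~ small_theta (split_theta_size k).
  by move=> [a' [b' [X' [Y' [Z' [Th' lt]]]]]]; apply: IH Th' _; slia.
apply: no_frame _ (minimal_split_theta_frame F minF) => i.
exact: minimal_split_theta_bound F minF.
Qed.

End SplitThetas.
(** * Detecting tents *)

Section Tents.
Variables (T : finType) (adj : rel T) (side : T -> bool).
Hypothesis adjC : symmetric adj.
Hypothesis bip : forall x y, adj x y -> side x != side y.

Notation induced_path := (induced_path adj).
Notation hole := (hole adj).
Notation linked := (linked adj).
Notation restrict := (restrict adj).
Notation touches := (touches adj).
Notation has_unbalanced_hole := (has_unbalanced_hole adj).
Notation theta_free := (theta_free adj side).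

Definition component (F : pred T) r v : bool := F r && connect (restrict F) r v.

Definition joined a b r (K : pred T) : bool :=
  adj a b || (adj a r && [exists v, K v && adj v b]).

Lemma component_refl (F : pred T) r : F r -> component F r r.
Proof. by rewrite /component => ->; apply: connect0. Qed.

Lemma component_sub (F : pred T) r v : component F r v -> F v.
Proof.
rewrite /component => /andP[Fr /connectP[p Hp ->]].
by elim: p r Fr Hp => //= u p IH r Fr /andP[/and3P[_ _ Fu] /IH ->].
Qed.

Lemma component_step (F : pred T) r u v : component F r u -> adj u v -> F v -> component F r v.
Proof.
move=> Hu A Fv; have Fu := component_sub Hu; have /andP[Fr C] := Hu; rewrite /component Fr.
by apply: connect_trans C (connect1 _); apply/and3P.
Qed.

Lemma componentC (F : pred T) r v : component F r v = component F v r.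
Proof.
apply/idP/idP => C; rewrite /component (component_sub C) connect_restrictC //;
  by case/andP: C.
Qed.

Lemma component_segment (F : pred T) x i j : i <= j ->
  (forall k, i <= k < j -> adj (x k) (x k.+1)) -> (forall k, i <= k <= j -> F (x k)) ->
  component F (x i) (x j).
Proof.
move=> ij A Fx; rewrite /component Fx ?leqnn //.
exact: (connect_segment ij A Fx).
Qed.

Lemma component_connect F r v :
  component F r v -> connect (restrict [set u | component F r u]) r v.
Proof.
move=> /andP[Fr /connectP[p Hp ->]].
suff suffix s : component F r s -> path (restrict F) s p ->
    connect (restrict [set u | component F r u]) s (last s p).
  by apply: suffix Hp; apply: component_refl.
elim: p s {Hp} => //= u p IH s Hs /andP[/and3P[su Fs Fu] Hp].
have Hu := component_step Hs su Fu; apply: connect_trans (IH _ Hu Hp).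
by apply: connect1; apply/and3P; rewrite !inE.
Qed.

Lemma joined_induced_path a b r F : joined a b r (component F r) ->
  exists y l, [/\ induced_path y l, y 0 = a, y l = b
                & forall i, 0 < i < l -> component F r (y i)].
Proof.
move=> ab; have [x [l [x0 xl walk_x]]] :
    exists x l, [/\ x 0 = a, x l = b & walk adj [set u | component F r u] x l].
  case/orP: ab => [adj_ab|/andP[adj_ab /existsP[v /andP[Kv vb]]]].
    by exists (fun i => if i is 0 then a else b), 1; split=> //; split=> -[].
  have link : linked [set u | component F r u] a b.
    exists r, v; split; rewrite ?inE //; last exact: component_connect.
    by apply: component_refl; case/andP: Kv.
  by have [x [l [_ x0 xl walk_x]]] := linked_walk link; exists x, l.
have [y [m [_ y0 ym Hy [_ yF]]]] := walk_induced_path walk_x.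
exists y, m; split; rewrite ?y0 ?ym // => i /yF.
by rewrite inE.
Qed.

Lemma odd_path_ends x l a b : induced_path x l -> odd l -> adj a (x 0) -> adj b (x l) ->
  [/\ side a != side b, ~~ adj a (x l) & ~~ adj b (x 0)].
Proof.
move=> Hx ol a0 bl; have := induced_path_odd bip Hx; rewrite ol.
have := side_adj bip a0; have := side_adj bip bl => -> -> /esym; rewrite eq_sym => s0l.
split; first by move: s0l; case: (side (x 0)); case: (side (x l)).
  by apply: (side_nadj bip); rewrite (side_adj bip a0); move: s0l; case: (side _); case: (side _).
by apply: (side_nadj bip); rewrite (side_adj bip bl); move: s0l; case: (side _); case: (side _).
Qed.

Lemma unbalanced_hole_of_path_edge x l p1 p2 : induced_path x l -> l %% 4 = 3 ->
  adj p1 p2 -> adj p1 (x 0) -> adj p2 (x l) ->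
  (forall i, 0 < i < l -> ~~ adj (x i) p1 /\ ~~ adj (x i) p2) ->
  (forall i, i <= l -> p1 != x i /\ p2 != x i) -> has_unbalanced_hole.
Proof.
move=> Hx l3 p12 p1x p2x inner off; have ol : odd l by slia.
have [x0l Nx] := Hx 0 l ltac:(slia).
have x0p1 : adj (x 0) p1 by rewrite adjC.
have Hp := induced_path3 bip x0p1 p12 p2x ltac:(rewrite Nx; slia).
have [||||i [|[|[|j]]] // Hi _|h [Hh _ _]] := hole_of_two_paths adjC Hx Hp => //; try slia.
- by have [N _] := inner i Hi; have [p _] := off i ltac:(slia); rewrite eq_sym.
- by have [_ N] := inner i Hi; have [_ p] := off i ltac:(slia); rewrite eq_sym.
by exists (l + 3), h; split=> //; slia.
Qed.

Lemma unbalanced_hole_of_path_clones x l y m c1 c2 : induced_path x l -> induced_path y m ->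
  l %% 4 = 1 -> m %% 4 = 1 -> ~~ adj c1 c2 ->
  [&& adj c1 (x 0), adj c1 (y 0), adj c2 (x l) & adj c2 (y m)] ->
  (forall i, 0 < i < l -> ~~ adj (x i) c1 /\ ~~ adj (x i) c2) ->
  (forall i, 0 < i < m -> ~~ adj (y i) c1 /\ ~~ adj (y i) c2) ->
  (forall i, i <= l -> c1 != x i /\ c2 != x i) ->
  (forall i, i <= m -> c1 != y i /\ c2 != y i) ->
  (forall i j, i <= l -> j <= m -> x i != y j /\ ~~ adj (x i) (y j)) ->
  has_unbalanced_hole.
Proof.
move=> Hx Hy l1 m1 Nc /and4P[c1x c1y c2x c2y] Ix Iy Ox Oy xy.
have [s12 _ _] := odd_path_ends Hx ltac:(slia) c1x c2x.
have add_ends z k : induced_path z k -> odd k -> adj c1 (z 0) -> adj c2 (z k) ->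
    (forall i, 0 < i < k -> ~~ adj (z i) c1 /\ ~~ adj (z i) c2) ->
    (forall i, i <= k -> c1 != z i /\ c2 != z i) ->
    exists x, [/\ induced_path x k.+2, x 0 = c1, x k.+2 = c2
                & forall i, i <= k -> x i.+1 = z i].
  move=> Hz ok c1z c2z Iz Oz; have [_ c1_off c2_off] := odd_path_ends Hz ok c1z c2z.
  apply: (induced_path_add_ends adjC Hz (side_neq s12)) => // [|i Hi|i Hi].
  - by rewrite adjC.
  - have [->//|ik] := eqVneq i k.
    by rewrite adjC; have [] := Iz i ltac:(slia).
  - have [->//|i0] := posnP i.
    by rewrite adjC; have [] := Iz i ltac:(slia).
have [x' [Hx' x0' xl' xE]] := add_ends x l Hx ltac:(slia) c1x c2x Ix Ox.
have [y' [Hy' y0' ym' yE]] := add_ends y m Hy ltac:(slia) c1y c2y Iy Oy.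
have [||||[|i] [|j] // Hi Hj|h [Hh _ _]] := hole_of_two_paths adjC Hx' Hy';
  rewrite ?x0' ?y0' ?xl' ?ym' //.
  by rewrite xE ?yE; try slia; apply: xy; slia.
by exists (l.+2 + m.+2), h; split=> //; slia.
Qed.

Section Frame.
Variables (p1 p2 c1 c2 a1 b1 r1 a2 b2 r2 : T).

Definition tent_zone1 : pred T := fun v =>
  ~~ [|| adj v p1, adj v p2, adj v c1, adj v c2, adj v a2 | adj v b2].

Definition tent_part1 : pred T := fun v => [|| v == a1, v == b1 | component tent_zone1 r1 v].

Definition tent_zone2 : pred T := fun v =>
  ~~ [|| adj v p1, adj v p2, adj v c1 | adj v c2] &&
  [forall u, tent_part1 u ==> (u != v) && ~~ adj u v].

(* The adjacent vertices p1 and p2 have the same neighbours a1, a2 and b1, b2 on a hole as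
   its vertices c1 and c2, which split the hole into a path from a1 to b1 and a path from
   a2 to b2. The inner vertices of these paths are only required to be in the component of
   r1 or r2 in a zone of vertices without unwanted neighbours. *)
Definition tent_frame : bool :=
  [&& adj p1 p2, [&& adj p1 a1, adj p1 a2, adj c1 a1 & adj c1 a2],
      [&& adj p2 b1, adj p2 b2, adj c2 b1 & adj c2 b2],
      [&& ~~ adj c1 c2, ~~ adj c1 p2 & ~~ adj p1 c2],
      joined a1 b1 r1 (component tent_zone1 r1), joined a2 b2 r2 (component tent_zone2 r2)
    & [forall u, tent_part1 u ==> [&& u != a2, u != b2, ~~ adj u a2 & ~~ adj u b2]]].

Lemma tent_part1_far v : tent_frame -> tent_part1 v ->
  [/\ v != a2, v != b2, ~~ adj v a2 & ~~ adj v b2].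
Proof. by case/and5P=> _ _ _ _ /and3P[_ _ /forallP/(_ v)/implyP H] /H/and4P. Qed.

Lemma tent_frame_paths : tent_frame -> exists x l y m,
  [/\ [/\ induced_path x l, x 0 = a1 & x l = b1], [/\ induced_path y m, y 0 = a2 & y m = b2],
      forall i, 0 < i < l -> tent_zone1 (x i), forall i, 0 < i < m -> tent_zone2 (y i)
    & forall i j, i <= l -> j <= m -> x i != y j /\ ~~ adj (x i) (y j)].
Proof.
move=> F; case/and5P: (F) => _ _ _ _ /and3P[].
move=> /joined_induced_path[x [l [Hx x0 xl xF]]] /joined_induced_path[y [m [Hy y0 ym yF]]] _.
exists x, l, y, m; split=> // [i /xF/component_sub//|i /yF/component_sub//|i j il jm].
have xP : tent_part1 (x i).
  have [->|i0] := posnP i; first by rewrite x0 /tent_part1 eqxx.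
  have [->|il'] := eqVneq i l; first by rewrite xl /tent_part1 eqxx orbT.
  by rewrite /tent_part1 xF ?orbT //; slia.
have [Na Nb Aa Ab] := tent_part1_far F xP.
have [->|j0] := posnP j; first by rewrite y0.
have [->|jm'] := eqVneq j m; first by rewrite ym.
have /component_sub/andP[_ /forallP/(_ (x i))] := yF j ltac:(slia).
by rewrite xP => /andP.
Qed.

Lemma tent_frame_sound : tent_frame -> has_unbalanced_hole.
Proof.
move=> F; have [x [l [y [m [[Hx x0 xl] [Hy y0 ym] xF yF xy]]]]] := tent_frame_paths F.
case/and5P: F => p12 /and4P[p1a1 p1a2 c1a1 c1a2] /and4P[p2b1 p2b2 c2b1 c2b2] /and3P[Nc _ _] _.
have sp a b : adj p1 a -> adj p2 b -> side a != side b.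
  move=> /(side_adj bip) sa /(side_adj bip) sb; have := bip p12; rewrite sa sb.
  by case: (side a); case: (side b).
have ol : odd l by rewrite (induced_path_odd bip Hx) x0 xl; apply: sp.
have om : odd m by rewrite (induced_path_odd bip Hy) y0 ym; apply: sp.
have x_inner i : 0 < i < l ->
    [/\ ~~ adj (x i) p1, ~~ adj (x i) p2, ~~ adj (x i) c1 & ~~ adj (x i) c2].
  by move=> /xF; rewrite /tent_zone1 !negb_or => /and5P[-> -> -> -> _].
have y_inner i : 0 < i < m ->
    [/\ ~~ adj (y i) p1, ~~ adj (y i) p2, ~~ adj (y i) c1 & ~~ adj (y i) c2].
  by move=> /yF/andP[]; rewrite !negb_or => /and4P[-> -> -> ->].
have x_off a b i : adj a a2 -> adj b b2 -> i <= l -> a != x i /\ b != x i.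
  move=> aa bb il; have [_ N0] := xy i 0 il isT; have [_ Nend] := xy i m il (leqnn m).
  rewrite y0 in N0; rewrite ym in Nend.
  by split; [apply: contraTneq aa | apply: contraTneq bb] => ->.
have y_off a b i : adj a a1 -> adj b b1 -> i <= m -> a != y i /\ b != y i.
  move=> aa bb im; have [_ N0] := xy 0 i isT im; have [_ Nend] := xy l i (leqnn l) im.
  rewrite x0 adjC in N0; rewrite xl adjC in Nend.
  by split; [apply: contraTneq aa | apply: contraTneq bb] => ->.
have [l3|l3] := eqVneq (l %% 4) 3.
  apply: (unbalanced_hole_of_path_edge Hx l3 p12); rewrite ?x0 ?xl // => i; last exact: x_off.
  by case/x_inner.
have [m3|m3] := eqVneq (m %% 4) 3.
  apply: (unbalanced_hole_of_path_edge Hy m3 p12); rewrite ?y0 ?ym // => i; last exact: y_off.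
  by case/y_inner.
apply: (unbalanced_hole_of_path_clones Hx Hy _ _ Nc); rewrite ?x0 ?y0 ?xl ?ym; try slia.
- by apply/and4P.
- by move=> i /x_inner[].
- by move=> i /y_inner[].
- by move=> i; apply: x_off.
- by move=> i; apply: y_off.
- exact: xy.
Qed.

End Frame.
Section TentFrameComplete.
Variables (c : nat -> T) (n : nat) (x y : T) (f : nat).
Hypotheses (Hc : hole c n) (n5 : 5 < n) (TF : theta_free) (f_odd : odd f) (fn : 3 <= f <= n - 3).
Hypothesis x_nbrs : forall j, j < n -> adj x (c j) = (j == 1) || (j == n.-1).
Hypothesis y_nbrs : forall j, j < n -> adj y (c j) = (j == f.-1) || (j == f.+1).
Hypotheses (x_off : forall j, x != c j) (y_off : forall j, y != c j) (xy : adj x y).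

Let r1 := if f == 3 then x else c 2.
Let r2 := if n - f == 3 then x else c n.-2.
Let zone1 := tent_zone1 x y (c 0) (c f) (c n.-1) (c f.+1).
Let part1 := tent_part1 x y (c 0) (c f) (c 1) (c f.-1) r1 (c n.-1) (c f.+1).
Let zone2 := tent_zone2 x y (c 0) (c f) (c 1) (c f.-1) r1 (c n.-1) (c f.+1).
Let far : {set T} := arc c f.+1 n.

Let ev : ~~ odd n. Proof. by apply: (hole_even bip Hc); slia. Qed.
Let cS j : adj (c j) (c j.+1). Proof. by apply: hole_adjS Hc _ _; slia. Qed.
Let c_adj i j : i < n -> j < n -> i != j ->
  adj (c i) (c j) = [|| j == i.+1, i == j.+1, j.+1 == i + n | i.+1 == j + n].
Proof.
move=> i_n jn; have [ij|ij|//] := ltngtP i j => _; first by rewrite (hole_adj Hc); slia.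
by rewrite adjC (hole_adj Hc); slia.
Qed.

Lemma zone1_far v : zone1 v ->
  [/\ [/\ ~~ adj v x, ~~ adj v y & ~~ adj v (c n.-1)], ~~ adj v (c f.+1), v != x & v != y].
Proof.
rewrite /zone1 /tent_zone1 !negb_or => /and5P[-> -> _ _ /andP[Nn Nf]].
split; rewrite ?Nn ?Nf //.
  by apply: contraNneq Nn => ->; rewrite x_nbrs ?eqxx ?orbT //; slia.
by apply: contraNneq Nf => ->; rewrite y_nbrs ?eqxx ?orbT //; slia.
Qed.

Lemma zone1_hole j : 2 <= j <= f - 2 -> zone1 (c j).
Proof.
by move=> Hj; rewrite /zone1 /tent_zone1 (adjC _ x) (adjC _ y) x_nbrs ?y_nbrs ?c_adj; slia.
Qed.

Lemma near_untouched j : 0 < j < f -> ~~ touches far (c j).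
Proof.
by move=> Hj; apply/touchesPn => z /arcP[i Hi ->]; apply: (hole_far Hc); slia.
Qed.

Lemma tent_hole : exists h, [/\ hole h (n - f).+1, h 0 = x, h 1 = y,
    forall i, [\/ h i = x, h i = y | h i \in far] & forall w, w \in far -> exists i, h i = w].
Proof.
pose g i := if i is j.+1 then (if j is k.+1 then c (f + j) else y) else x.
have Hg : hole (fun i => g (i %% (n - f).+1)) (n - f).+1.
  apply: hole_of_range => //.
  case=> [|[|i]] [|[|j]] //= ij; first by split; [apply: (side_neq (bip xy)) | rewrite xy].
  - by rewrite x_off x_nbrs; [split=> //; slia | slia].
  - by rewrite y_off y_nbrs; [split=> //; slia | slia].
  - by rewrite (hole_neq Hc) ?(hole_adj Hc); [split=> // | |]; slia.
exists (fun i => g (i %% (n - f).+1)); split=> // [|i|w /arcP[i Hi ->]].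
- by rewrite modn_small //; slia.
- have := ltn_pmod i (ltn0Sn (n - f)); case: (i %% _) => [|[|j]] lt; first by constructor 1.
    by constructor 2.
  by constructor 3; apply: mem_arc; slia.
by exists (i - f).+1; rewrite modn_small; [case E: (i - f) => [|k] /=; [|congr c]; slia | slia].
Qed.

Section Bypass.
Variables (z : nat -> T) (t : nat).
Hypotheses (f3 : f != 3) (z0 : z 0 = c 2) (zF : forall j, j <= t -> zone1 (z j)).
Hypothesis zS : forall j, j < t -> adj (z j) (z j.+1).
Hypotheses (zt : touches far (z t)) (before : forall j, j < t -> ~~ touches far (z j)).

Let t0 : 0 < t.
Proof. by rewrite lt0n; apply: contraTneq zt => ->; rewrite z0 near_untouched //; slia. Qed.

Let bypass lo hi : {set T} := arc z 0 t :|: arc c lo hi.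

Lemma bypass_linked v lo hi e : lo <= 2 < hi -> lo <= e < hi -> adj (c e) v ->
  linked (bypass lo hi) (z t) v.
Proof.
move=> lohi Hel ev'; have zB j : j < t -> z j \in bypass lo hi.
  by move=> H; rewrite inE mem_arc.
have cB j : lo <= j < hi -> c j \in bypass lo hi.
  by move=> H; rewrite inE (mem_arc c) ?orbT.
exists (z t.-1), (c e); rewrite zB ?cB //; last by slia.
split=> //; first by rewrite adjC; have := zS (ltac:(slia) : t.-1 < t); rewrite prednK.
apply: (@connect_trans _ _ (c 2)).
  rewrite connect_restrictC // -z0.
  by apply: connect_segment => // j Hj; [apply: zS | apply: zB]; slia.
have cC i j : lo <= i <= j -> j < hi -> connect (restrict (bypass lo hi)) (c i) (c j).
  by move=> Hi Hj; apply: connect_segment => [|k Hk|k Hk]; [slia | exact: cS | apply: cB; slia].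
have [le|gt] := leqP 2 e; first by apply: cC; slia.
by rewrite connect_restrictC //; apply: cC; slia.
Qed.

Lemma bypass_attachment h v v' lo hi e :
  (forall i, [\/ h i = x, h i = y | h i \in far]) -> (v, v') \in [:: (x, y); (y, x)] ->
  0 < lo -> lo <= 2 < hi -> hi <= f -> lo <= e < hi -> adj (c e) v ->
  (forall j, lo <= j < hi -> ~~ adj (c j) v') -> attachment adj h (z t) (bypass lo hi) v.
Proof.
move=> hB vv' lo0 lohi hif Hel ev' cv'.
have vE : v = x /\ v' = y \/ v = y /\ v' = x.
  by move: vv'; rewrite !inE => /orP[]/eqP[-> ->]; [left | right].
have bypassP u : u \in bypass lo hi -> [/\ ~~ touches far u, u != x, u != y & ~~ adj u v'].
  case/setUP => /arcP[j Hj ->].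
    have [[Nx Ny _] _ jx jy] := zone1_far (zF (ltac:(slia) : j <= t)).
    by split=> //; [apply: before | case: vE => -[_ ->]].
  split; [by apply: near_untouched; slia | by rewrite eq_sym x_off | by rewrite eq_sym y_off |].
  exact: cv'.
have [[Nx Ny Nn] Nf _ _] := zone1_far (zF (leqnn t)).
split=> [|||i Hi|u i uB Hi].
- by apply/negP => /bypassP[]; rewrite zt.
- by apply/negP => /bypassP[_]; case: vE => -[-> _]; rewrite eqxx.
- exact: bypass_linked ev'.
- have [->|->|/arcP[j Hj E]] := hB i => //; rewrite {}E in Hi *.
  case: Hi => [E|]; first by case: vE => -[vE _]; move: (x_off j) (y_off j); rewrite E vE eqxx.
  by rewrite adjC; case: vE => -[-> _]; rewrite ?x_nbrs ?y_nbrs;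
    try slia; case/orP => /eqP E; rewrite ?E //; slia.
have [u1 u2 u3 u4] := bypassP u uB.
have [E|E|/touchesPn] := hB i; rewrite ?E in Hi *; [| |exact].
  by case: vE => -[vE v'E]; [rewrite vE eqxx in Hi | rewrite u2 -v'E].
by case: vE => -[vE v'E]; [rewrite u3 -v'E | rewrite vE eqxx in Hi].
Qed.

Lemma bypass_absurd : False.
Proof.
have ztS : adj (z t.-1) (z t) by have := zS (ltac:(slia) : t.-1 < t); rewrite prednK.
have [ztN [w wfar ztw]] := touching_step ztS (before (ltac:(slia) : t.-1 < t)) zt.
have [h [Hh h0 h1 hB Bh]] := tent_hole; have [k hk] := Bh w wfar.
have [_ _ tx ty] := zone1_far (zF (leqnn t)).
have h_off i : z t != h i.
  by have [->|->|farE] := hB i => //; apply: contraNneq ztN => ->.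
have att_x : attachment adj h (z t) (bypass 1 3) (h 0).
  rewrite h0; apply: (bypass_attachment (v' := y) (e := 1)) => //; rewrite ?inE ?eqxx //.
  - by slia.
  - by rewrite adjC x_nbrs //; slia.
  - by move=> j Hj; rewrite adjC y_nbrs; slia.
have att_y : attachment adj h (z t) (bypass 2 f) (h 1).
  rewrite h1; apply: (bypass_attachment (v' := x) (e := f.-1)) => //; rewrite ?inE ?eqxx ?orbT //;
    try slia.
  - by rewrite adjC y_nbrs ?eqxx //; slia.
  - by move=> j Hj; rewrite adjC x_nbrs; slia.
have s01 : side (h 0) != side (h 1) by rewrite h0 h1 bip.
rewrite -hk in ztw; have n3 : 3 < (n - f).+1 by slia.
have [a [b [X [Y [Z [Th _]]]]]] := small_theta_of_two_attachments adjC bip Hh n3 h_off ztw s01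
  att_x att_y (leq_addr #|bypass 2 f| _) (leq_addl #|bypass 1 3| _).
exact: TF Th.
Qed.

End Bypass.

Lemma component1_untouched v : component zone1 r1 v -> ~~ touches far v.
Proof.
move=> Cv; have f3 : f != 3.
  apply: contraTneq Cv => f3; rewrite /r1 f3 eqxx /component; apply/negP => /andP[/zone1_far[_ _]].
  by rewrite eqxx.
rewrite /r1 (negbTE f3) in Cv; have zone_c2 : zone1 (c 2) by case/andP: Cv.
apply/negP => tv; case/andP: Cv => _ /connect_walkb[l _ /walkbP[z [z0 zl zS]]].
pose P j := (j <= l) && touches far (z j).
have exP : exists j, P j by exists l; rewrite /P leqnn zl.
case: (ex_minnP exP) => t /andP[tl zt] min_t.
apply: (@bypass_absurd z t) => // [j jt|j jt|j jt].
- by case: j jt => [|j] jt; [rewrite z0 | have /and3P[] := zS j ltac:(slia)].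
- by have /and3P[] := zS j ltac:(slia).
by apply/negP => tzj; have := min_t j; rewrite /P tzj; slia.
Qed.

Lemma part1_untouched u : part1 u -> ~~ touches far u.
Proof.
by case/or3P => [/eqP ->|/eqP ->|/component1_untouched //]; apply: near_untouched; slia.
Qed.

Lemma zone2_hole j : f.+2 <= j <= n - 2 -> zone2 (c j).
Proof.
move=> Hj; apply/andP; split.
  by rewrite (adjC _ x) (adjC _ y) x_nbrs ?y_nbrs ?c_adj; slia.
apply/forallP => u; apply/implyP => /part1_untouched/touchesPn H; apply/andP.
by apply: H; apply: mem_arc; slia.
Qed.

Lemma joined1 : joined (c 1) (c f.-1) r1 (component zone1 r1).
Proof.
rewrite /joined /r1; case: eqP => [->|/eqP f3]; first by rewrite cS.
apply/orP; right; rewrite cS; apply/existsP; exists (c (f - 2)).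
rewrite -(_ : (f - 2).+1 = f.-1); last by slia.
rewrite cS andbT; apply: component_segment => [|k _|k Hk]; [slia | exact: cS |].
by apply: zone1_hole; slia.
Qed.

Lemma joined2 : joined (c n.-1) (c f.+1) r2 (component zone2 r2).
Proof.
rewrite /joined /r2; case: eqP => [n3|/eqP n3].
  by rewrite c_adj; slia.
apply/orP; right; rewrite c_adj; try slia.
apply/andP; split; first by slia.
apply/existsP; exists (c f.+2); rewrite [adj _ _]adjC cS andbT componentC.
apply: component_segment => [|k _|k Hk]; [slia | exact: cS |].
by apply: zone2_hole; slia.
Qed.

Lemma tent_frame_complete :
  exists r1 r2, tent_frame x y (c 0) (c f) (c 1) (c f.-1) r1 (c n.-1) (c f.+1) r2.
Proof.
exists r1, r2; apply/and5P; split=> //.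
- by rewrite !x_nbrs ?c_adj; slia.
- by rewrite !y_nbrs ?c_adj; slia.
- by rewrite [adj _ y]adjC x_nbrs ?y_nbrs ?c_adj; slia.
apply/and3P; split; [exact: joined1 | exact: joined2 |].
apply/forallP => u; apply/implyP => /part1_untouched/touchesPn H.
have [->  ->] := H (c n.-1) (mem_arc _ (ltac:(slia) : f.+1 <= n.-1 < n)).
by have [-> ->] := H (c f.+1) (mem_arc _ (ltac:(slia) : f.+1 <= f.+1 < n)).
Qed.

End TentFrameComplete.

End Tents.
(** * Major vertices of a smallest unbalanced hole *)

Lemma helly_of_triples (I J : finType) (r : I -> J -> bool) (S : {set I}) :
  (forall x y, x \in S -> y \in S -> exists j, r x j && r y j) ->
  (forall x1 x2 x3 j1 j2 j3, x1 \in S -> x2 \in S -> x3 \in S ->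
     [&& r x1 j2, r x1 j3, r x2 j1, r x2 j3, r x3 j1 & r x3 j2] ->
     [|| r x1 j1, r x2 j2 | r x3 j3]) ->
  S != set0 -> exists j, forall x, x \in S -> r x j.
Proof.
have [N] := ubnP #|S|; elim: N S => // N IH S S_lt pairs triples /set0Pn[x xS].
have [/eqP Sx|/set0Pn[y]] := boolP (S :\ x == set0).
  have [j /andP[rj _]] := pairs x x xS xS; exists j => u uS.
  by have [->//|ux] := eqVneq u x; have := in_set0 u; rewrite -Sx !inE ux uS.
rewrite !inE => /andP[yx yS].
have [/eqP Sy|/set0Pn[z]] := boolP (S :\ x :\ y == set0).
  have [j /andP[rj rj']] := pairs x y xS yS; exists j => u uS.
  have [->//|ux] := eqVneq u x; have [->//|uy] := eqVneq u y.
  by have := in_set0 u; rewrite -Sy !inE ux uy uS.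
rewrite !inE => /and3P[zy zx zS].
have but_one t t' : t \in S -> t' \in S -> t' != t ->
    exists j, forall u, u \in S -> u != t -> r u j.
  move=> tS tS' tt'; have [||||j Hj] := IH (S :\ t).
  - by rewrite (cardsD1 t S) tS in S_lt.
  - by move=> u v /setD1P[_ uS] /setD1P[_ vS]; apply: pairs.
  - by move=> x1 x2 x3 j1 j2 j3 /setD1P[_ S1] /setD1P[_ S2] /setD1P[_ S3]; apply: triples.
  - by apply/set0Pn; exists t'; rewrite !inE tt'.
  by exists j => u uS ut; apply: Hj; rewrite !inE ut.
have xy : x != y by rewrite eq_sym.
have xz : x != z by rewrite eq_sym.
have yz : y != z by rewrite eq_sym.
have [j1 but_x] := but_one x y xS yS yx.
have [j2 but_y] := but_one y x yS xS xy.
have [j3 but_z] := but_one z x zS xS xz.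
have := triples x y z j1 j2 j3 xS yS zS.
rewrite (but_y x) ?(but_z x) ?(but_x y) ?(but_z y) ?(but_x z) ?(but_y z) // => /(_ isT).
case/or3P => [h|h|h]; [exists j1|exists j2|exists j3] => u uS.
- by have [->//|ux] := eqVneq u x; apply: but_x.
- by have [->//|uy] := eqVneq u y; apply: but_y.
- by have [->//|uz] := eqVneq u z; apply: but_z.
Qed.

Section Majors.
Variables (T : finType) (adj : rel T) (side : T -> bool).
Hypothesis adjC : symmetric adj.
Hypothesis bip : forall x y, adj x y -> side x != side y.

Notation induced_path := (induced_path adj).
Notation hole := (hole adj).
Notation theta_free := (theta_free adj side).

Definition smallest_unbalanced (c : nat -> T) n : Prop :=
  [/\ 5 < n, n %% 4 = 2, hole c n &
      forall m c', 5 < m -> m %% 4 = 2 -> m < n -> ~ hole c' m].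

Lemma smallest_unbalanced_shift c n k :
  smallest_unbalanced c n -> smallest_unbalanced (fun i => c (k + i)) n.
Proof. by case=> n5 n4 Hc min_n; split=> //; apply: hole_shift. Qed.

Definition major (c : nat -> T) n w : Prop := exists i j k,
  [/\ i < j, j < k, k < i + n & [/\ adj w (c i), adj w (c j) & adj w (c k)]].

Section SmallestHole.
Variables (c : nat -> T) (n : nat).
Hypothesis Cmin : smallest_unbalanced c n.

Let n5 : 5 < n. Proof. by case: Cmin. Qed.
Let n2 : 2 < n. Proof. by slia. Qed.
Let n4 : n %% 4 = 2. Proof. by case: Cmin. Qed.
Let Hc : hole c n. Proof. by case: Cmin. Qed.
Let c_min m c' : 5 < m -> m %% 4 = 2 -> m < n -> ~ hole c' m.
Proof. by case: Cmin => _ _ _ H; apply: H. Qed.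
Let cS i : adj (c i) (c i.+1). Proof. exact: hole_adjS Hc _ n2. Qed.

Lemma nbr_gap w i j : (forall k, w != c k) -> adj w (c i) -> adj w (c j) -> i < j < i + n ->
  (forall k, i < k < j -> ~~ adj w (c k)) -> (j - i) %% 4 = 2 \/ n <= j - i + 2.
Proof.
move=> w_off wi wj ij gap; have par := hole_nbr_parity bip Hc n2 wi wj.
have [long|short] := leqP n (j - i + 2); first by right.
have [m4|m4] := eqVneq ((j - i) %% 4) 2; [by left|exfalso].
have Hij := hole_arc Hc i (ltnW (ltac:(slia) : j - i + 2 < n)).
have [cij Ncij] := hole_far Hc (ltac:(slia) : i.+1 < j) (ltac:(slia) : j.+1 < i + n).
have iw : adj (c i) w by rewrite adjC.
have Hiwj := induced_path2 cij (side_neq (bip iw)) (w_off j) Ncij iw wj.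
have [||||t [|[|s]] // Ht _|h [Hh _ _]] := hole_of_two_paths adjC Hij Hiwj;
  rewrite ?addn0 //; try slia.
- by congr c; slia.
- by rewrite eq_sym adjC w_off; split=> //; apply: gap; slia.
by apply: (@c_min (j - i + 2) h) => //; slia.
Qed.

Lemma major_window w i0 : major c n w -> exists i j k,
  [/\ i0 <= i, i < j, j < k, k < i0 + n & [/\ adj w (c i), adj w (c j) & adj w (c k)]].
Proof.
move=> [i [j [k [ij jk ki [wi wj wk]]]]]; have n0 : 0 < n by slia.
have [i' [Hi Ei]] := hole_index_window Hc i0 i n0.
have [j' [Hj Ej]] := hole_index_window Hc i0 j n0.
have [k' [Hk Ek]] := hole_index_window Hc i0 k n0.
have ne a b a' b' : a < b < a + n -> c a' = c a -> c b' = c b -> a' != b'.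
  by move=> /(hole_neq Hc) + Ea Eb; rewrite -Ea -Eb; apply: contra_neq => ->.
have ij' := ne i j i' j' ltac:(slia) Ei Ej; have ik' := ne i k i' k' ltac:(slia) Ei Ek.
have jk' := ne j k j' k' ltac:(slia) Ej Ek.
rewrite -Ei in wi; rewrite -Ej in wj; rewrite -Ek in wk.
have [a|a|a] := ltngtP i' j'; have [b|b|b] := ltngtP j' k'; have [d|d|d] := ltngtP i' k';
  try (exfalso; slia).
- by exists i', j', k'; split=> //; slia.
- by exists i', k', j'; split=> //; slia.
- by exists k', i', j'; split=> //; slia.
- by exists j', i', k'; split=> //; slia.
- by exists j', k', i'; split=> //; slia.
- by exists k', j', i'; split=> //; slia.
Qed.

Lemma major_gap w i j : (forall k, w != c k) -> major c n w ->
  adj w (c i) -> adj w (c j) -> i < j -> (forall k, i < k < j -> ~~ adj w (c k)) ->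
  [/\ (j - i) %% 4 = 2, j - i + 4 <= n & exists k, j < k < i + n /\ adj w (c k)].
Proof.
move=> w_off Mw wi wj ij gap; have [a [b [d [ia ab bd dn [wa wb wd]]]]] := major_window i Mw.
have jb : j <= b by rewrite leqNgt; apply/negP => bj; have := gap b ltac:(slia); rewrite wb.
have par_jd := hole_nbr_parity bip Hc n2 wj wd.
have par_id := hole_nbr_parity bip Hc n2 wi wd.
have ev := hole_even bip Hc n2.
have [m4|long] := nbr_gap w_off wi wj ltac:(slia) gap; last by exfalso; slia.
by split=> //; [slia | exists d; split=> //; slia].
Qed.

Definition nbr_count w i j : nat := \sum_(i <= k < j) adj w (c k).

Lemma nbr_count_cat w i j k :
  i <= j <= k -> nbr_count w i k = nbr_count w i j + nbr_count w j k.
Proof. by move=> /andP[ij jk]; rewrite /nbr_count (big_cat_nat (n := j)). Qed.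

Lemma nbr_count0 w i j : (forall k, i <= k < j -> ~~ adj w (c k)) -> nbr_count w i j = 0.
Proof. by move=> H; rewrite /nbr_count big_nat big1 // => k /H /negbTE ->. Qed.

Lemma nbr_count1 w i : adj w (c i) -> nbr_count w i i.+1 = 1.
Proof. by move=> H; rewrite /nbr_count big_nat1 H. Qed.

Lemma next_nbr w i j : i < j -> adj w (c j) ->
  exists k, [/\ i < k <= j, adj w (c k) & forall t, i < t < k -> ~~ adj w (c t)].
Proof.
move=> ij wj; have exP : exists k, (i < k) && adj w (c k) by exists j; rewrite ij.
case: (ex_minnP exP) => k /andP[ik wk] min_k; exists k; split=> //.
  by have := min_k j; rewrite ij wj; slia.
by move=> t Ht; apply/negP => wt; have := min_k t; rewrite wt; slia.
Qed.

Lemma nbr_count_gap w i j : (forall k, w != c k) -> major c n w ->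
  adj w (c i) -> adj w (c j) -> i <= j -> (j - i + 2 * nbr_count w i j) %% 4 = 0.
Proof.
move=> w_off Mw; have [N] := ubnP (j - i); elim: N i => // N IH i jN wi wj ij.
have [->|lt] := eqVneq i j; first by rewrite subnn /nbr_count big_geq.
have [|k [Hk wk gap]] := @next_nbr w i j _ wj; first by slia.
have [m4 _ _] := major_gap w_off Mw wi wk ltac:(slia) gap.
have := IH k ltac:(slia) wk wj ltac:(slia).
rewrite (@nbr_count_cat w i i.+1 j); last by slia.
rewrite (@nbr_count_cat w i.+1 k j); last by slia.
rewrite nbr_count1 // (@nbr_count0 w i.+1 k) //.
by move: (nbr_count _ _ _) => C; slia.
Qed.

Lemma nbr_count_period w i : nbr_count w i (i + n) = nbr_count w 0 n.
Proof.
elim: i => // i <-; rewrite (@nbr_count_cat w i i.+1 (i + n)); last by slia.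
rewrite addSn (@nbr_count_cat w i.+1 (i + n) (i + n).+1); last by slia.
by rewrite addnC /nbr_count !big_nat1 (hole_period Hc).
Qed.

Lemma nbr_count_odd w : (forall k, w != c k) -> major c n w -> odd (nbr_count w 0 n).
Proof.
move=> w_off Mw; have [i [_ [_ [_ _ _ [wi _ _]]]]] := Mw.
have wi' : adj w (c (i + n)) by rewrite (hole_period Hc).
have := nbr_count_gap w_off Mw wi wi' ltac:(slia); rewrite nbr_count_period addKn.
by move: n4; move: (nbr_count _ _ _) => C; slia.
Qed.

Section Pair.
Variables v w : T.
Hypotheses (v_off : forall k, v != c k) (w_off : forall k, w != c k).
Hypotheses (Mv : major c n v) (Mw : major c n w).
Hypotheses (TF : theta_free) (svw : side v = side w).
Hypothesis disj : forall k, adj v (c k) -> ~~ adj w (c k).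

Let vw : v != w.
Proof.
have [i [_ [_ [_ _ _ [vi _ _]]]]] := Mv.
by apply: contraTneq (disj vi) => <-; rewrite negbK.
Qed.

Section Sector.
Variables i j : nat.
Hypotheses (vi : adj v (c i)) (vj : adj v (c j)) (ij : i < j).
Hypothesis gap : forall k, i < k < j -> ~~ adj v (c k).

Let ij4 : (j - i) %% 4 = 2. Proof. by have [] := major_gap v_off Mv vi vj ij gap. Qed.
Let ijn : j - i + 4 <= n. Proof. by have [] := major_gap v_off Mv vi vj ij gap. Qed.

Lemma sector_extreme_nbrs : odd (nbr_count w i j) -> exists h1 h2,
  [/\ i < h1 <= h2, h2 < j, adj w (c h1) /\ adj w (c h2),
      forall k, i <= k <= j -> adj w (c k) -> h1 <= k <= h2 & (h2 - h1) %% 4 = 0].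
Proof.
move=> o; pose P k := (i < k < j) && adj w (c k).
have inner k : i <= k <= j -> adj w (c k) -> P k.
  move=> Hk wk; rewrite /P wk andbT.
  have ki : k != i by apply: contraTneq wk => ->; apply: disj.
  by have kj : k != j; [apply: contraTneq wk => ->; apply: disj | slia].
have exP : exists k, P k.
  case: (boolP [exists k : 'I_j, P k]) => [/existsP[k Pk]|H]; first by exists k.
  move: o; rewrite nbr_count0 // => k /andP[ik kj]; apply/negP => /(inner k ltac:(slia)) Pk.
  by case/existsP: H; exists (Ordinal kj).
have ubP k : P k -> k <= j by move=> /andP[]; slia.
case: (ex_minnP exP) => h1 /andP[H1 w1] min_h; case: (ex_maxnP exP ubP) => h2 /andP[H2 w2] max_h.
have h12 : h1 <= h2 by apply: min_h; rewrite /P H2.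
have out k : i <= k <= j -> adj w (c k) -> h1 <= k <= h2.
  by move=> Hk wk; rewrite min_h ?max_h ?inner.
exists h1, h2; split=> //; try slia.
have := nbr_count_gap w_off Mw w1 w2 h12; move: o.
rewrite (@nbr_count_cat w i h1 j); last by slia.
rewrite (@nbr_count_cat w h1 h2 j); last by slia.
rewrite (@nbr_count_cat w h2 h2.+1 j); last by slia.
rewrite nbr_count1 // (@nbr_count0 w i h1) ?(@nbr_count0 w h2.+1 j) ?addn0 ?addn1.
- by move: (nbr_count _ _ _) => C; slia.
- by move=> k Hk; apply/negP => /out; slia.
- by move=> k Hk; apply/negP => /out; slia.
Qed.

Section ExtremeNbrs.
Variables h1 h2 : nat.
Hypotheses (H1 : i < h1 <= h2) (H2 : h2 < j) (w1 : adj w (c h1)) (w2 : adj w (c h2)).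
Hypothesis out : forall k, i <= k <= j -> adj w (c k) -> h1 <= k <= h2.

Let Nvw : ~~ adj v w. Proof. exact: (side_nadj bip). Qed.

Lemma sector_two_nbrs_absurd : (h2 - h1) %% 4 = 0 -> h1 != h2 -> False.
Proof.
move=> h4 h12.
have [|||||x [Hx x0 xl xE]] := induced_path_add_ends adjC
    (hole_arc Hc i (ltac:(slia) : h1 - i + 2 <= n)) vw Nvw; rewrite ?addn0 ?subnKC //; try slia.
- by rewrite adjC.
- by move=> t Ht; apply: gap; slia.
- by move=> t Ht; apply/negP => /out; slia.
have [|||||z [Hz z0 zl zE]] := induced_path_add_ends adjC
    (induced_path_rev adjC (hole_arc Hc h2 (ltac:(slia) : j - h2 + 2 <= n))) vw Nvw;
  rewrite ?subn0 ?subnn ?addn0 ?subnKC //; try slia.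
- by rewrite adjC.
- by move=> t Ht; apply: gap; slia.
- by move=> t Ht; apply/negP => /out; slia.
have [||||[|a] [|b] // Ha Hb|h [Hh _ _]] := hole_of_two_paths adjC Hx Hz; rewrite ?x0 ?xl //.
  by rewrite xE ?zE; try slia; apply: (hole_far Hc); slia.
by apply: (@c_min ((h1 - i).+2 + (j - h2).+2) h) => //; slia.
Qed.

Lemma sector_outer_nbrs : h1 = h2 -> exists g h,
  [/\ adj v (c g), adj w (c h), j.+2 <= g, j.+2 <= h & g + 2 <= i + n /\ h + 2 <= i + n].
Proof.
move=> h12; have [_ _ [g [Hg vg]]] := major_gap v_off Mv vi vj ij gap.
have [a [b [d [ia ab bd dn [wa wb wd]]]]] := major_window i Mw.
have [h [Hh wh]] : exists h, j < h < i + n /\ adj w (c h).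
  exists d; split=> //; rewrite dn andbT ltnNge; apply/negP => dj.
  by have := out (ltac:(slia) : i <= b <= j) wb; have := out (ltac:(slia) : i <= d <= j) wd; slia.
have ev := hole_even bip Hc n2.
have par_ij := hole_nbr_parity bip Hc n2 vi vj; have par_jg := hole_nbr_parity bip Hc n2 vj vg.
have par_h : odd h = odd j.
  have := hole_nbr_side bip Hc n2 vj; rewrite svw (hole_nbr_side bip Hc n2 wh).
  by case: (side _); case: (odd h); case: (odd j).
clear -Hg Hh ev par_ij par_jg par_h vg wh.
by exists g, h; split=> //; slia.
Qed.

Lemma sector_one_nbr_absurd : h1 = h2 -> False.
Proof.
move=> h12; have [g [h [vg wh gj hj [g_in h_in]]]] := sector_outer_nbrs h12.
pose outer := arc c (minn g h) (maxn g h).+1.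
have outer_range k : minn g h <= k < (maxn g h).+1 -> j.+2 <= k /\ k + 2 <= i + n by slia.
have inner_nadj a : i <= a <= j -> a != h1 -> c a != w /\ ~~ adj (c a) w.
  by move=> Ha ne; rewrite eq_sym adjC w_off; split=> //; apply/negP => /out; slia.
have vA lo hi : v \notin arc c lo hi by apply/arcP => -[t _ /eqP]; apply/negP.
have gO : c g \in outer by apply: mem_arc; slia.
have hO : c h \in outer by apply: mem_arc; slia.
have L : linked adj outer w v.
  have seg a b : minn g h <= a <= b -> b <= maxn g h ->
      connect (restrict adj outer) (c a) (c b).
    move=> Ha Hb; apply: connect_segment => [|k _|k Hk]; [slia|exact: cS|].
    by apply: mem_arc; slia.
  exists (c h), (c g); split=> //; first by rewrite adjC.
  have [hg|gh] := leqP h g; first by apply: seg; slia.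
  by rewrite connect_restrictC //; apply: seg; slia.
apply: (@TF v (c h1) (arc c i h1) (arc c h1.+1 j.+1) (w |: outer)); split.
- by rewrite svw; apply: bip.
- by apply: contraTN w1 => /disj.
- split.
  + apply: linked_arc => //; first by slia.
    by have := cS h1.-1; rewrite prednK //; slia.
  + by apply: linkedC => //; apply: linked_arc; rewrite //= 1?adjC //; slia.
  + by apply: linkedC => //; apply: linked_cons L; rewrite adjC.
- have far lo hi : i <= lo -> hi <= j.+1 -> ~~ (lo <= h1 < hi) ->
      anticomplete adj (arc c lo hi) (w |: outer).
    move=> Hlo Hhi out_h1; apply: anticompleteU.
      by apply: anticomplete1 => u /arcP[a Ha ->]; apply: inner_nadj; slia.
    apply: anticomplete_arcs => a b Ha /outer_range[Hb Hb'].
    by apply: (hole_far Hc); slia.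
  split; [|by apply: far; slia..].
  by apply: anticomplete_arcs => a b Ha Hb; apply: (hole_far Hc); slia.
- rewrite !in_setU3 !in_setU1 !negb_or !vA vw [c h1 == w]eq_sym w_off; split=> //=.
  apply/and3P; split; apply/arcP => -[t Ht /eqP]; apply/negP.
  + by rewrite eq_sym; apply: (hole_neq Hc); slia.
  + by apply: (hole_neq Hc); slia.
  + by have [] := outer_range t Ht; move=> *; apply: (hole_neq Hc); slia.
Qed.

End ExtremeNbrs.

Lemma sector_even : ~~ odd (nbr_count w i j).
Proof.
apply/negP => /sector_extreme_nbrs[h1 [h2 [H1 H2 [w1 w2] out h4]]].
have [h12|h12] := eqVneq h1 h2; first exact: sector_one_nbr_absurd h12.
exact: sector_two_nbrs_absurd h4 h12.
Qed.

End Sector.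

Lemma disjoint_majors_absurd : False.
Proof.
have [i [_ [_ [_ _ _ [vi _ _]]]]] := Mv.
suff even_count j : i <= j -> adj v (c j) -> ~~ odd (nbr_count w i j).
  have := even_count (i + n) ltac:(slia); rewrite (hole_period Hc) => /(_ vi).
  by rewrite nbr_count_period nbr_count_odd.
have [N] := ubnP j; elim: N j => // N IH j jN ij vj.
have [ijE|ne] := eqVneq i j; first by rewrite ijE /nbr_count big_geq.
have exP : exists k, (i <= k < j) && adj v (c k) by exists i; rewrite vi andbT; slia.
have ubP k : (i <= k < j) && adj v (c k) -> k <= j by move=> /andP[]; slia.
case: (ex_maxnP exP ubP) => k /andP[Hk vk] max_k.
rewrite (@nbr_count_cat w i k j) ?oddD; last by slia.
rewrite (negbTE (IH k _ _ vk)); try slia.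
apply: sector_even => //; first by slia.
by move=> t Ht; apply/negP => vt; have := max_k t; rewrite vt; slia.
Qed.

End Pair.

Lemma minor_nbrs w i j : (forall k, w != c k) -> ~ major c n w ->
  adj w (c i) -> adj w (c j) -> i < j < i + n -> j = i + 2 \/ j + 2 = i + n.
Proof.
move=> w_off minor wi wj ij; have ev := hole_even bip Hc n2.
have par := hole_nbr_parity bip Hc n2 wi wj.
have gap_ij k : i < k < j -> ~~ adj w (c k).
  by move=> Hk; apply/negP => wk; apply: minor; exists i, k, j; split=> //; slia.
have gap_ji k : j < k < i + n -> ~~ adj w (c k).
  by move=> Hk; apply/negP => wk; apply: minor; exists i, j, k; split=> //; slia.
have wi' : adj w (c (i + n)) by rewrite (hole_period Hc).
have := nbr_gap w_off wi wj ij gap_ij; have := nbr_gap w_off wj wi' ltac:(slia) gap_ji.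
by move: n4 n5; slia.
Qed.

Lemma majorP w : reflect (major c n w) [exists i : 'I_n, exists j : 'I_n, exists k : 'I_n,
  [&& i < j, j < k, adj w (c i), adj w (c j) & adj w (c k)]].
Proof.
apply: (iffP existsP) => [[i /existsP[j /existsP[k /and5P[ij jk wi wj wk]]]]|].
  by exists i, j, k; split=> //; have := ltn_ord k; slia.
move=> /(major_window 0)[i [j [k [_ ij jk kn [wi wj wk]]]]].
have jn : j < n by slia.
have i_n : i < n by slia.
exists (Ordinal i_n); apply/existsP; exists (Ordinal jn); apply/existsP; exists (Ordinal kn).
by rewrite /= ij jk wi wj wk.
Qed.

Lemma hexagon_hole x1 x2 x3 j1 j2 j3 :
  [&& adj x1 j2, adj x1 j3, adj x2 j1, adj x2 j3, adj x3 j1 & adj x3 j2] ->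
  ~~ [|| adj x1 j1, adj x2 j2 | adj x3 j3] -> exists c, hole c 6.
Proof.
case/and5P=> a12 a13 a21 a23 /andP[a31 a32]; rewrite !negb_or => /and3P[n11 n22 n33].
have [a23' a32'] : adj j2 x3 /\ adj j3 x2 by rewrite ![adj _ x3]adjC ![adj _ x2]adjC.
have Hx := induced_path3 bip a12 a23' a31 n11; have Hy := induced_path3 bip a13 a32' a21 n11.
have sx : side x2 = side x3 by rewrite (side_adj bip a21) (side_adj bip a31).
have sj : side j2 = side j3.
  by apply: negb_inj; rewrite -(side_adj bip a12) -(side_adj bip a13).
have [||||[|[|[|i]]] // [|[|[|j]]] // Hi Hj|h [Hh _ _]] := hole_of_two_paths adjC Hx Hy => //=;
  last by exists h.
- by split; [apply: contraNneq n22 => -> | apply: (side_nadj bip)].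
- by split; [apply: (side_neq (side := side)); rewrite sx bip | rewrite adjC].
- by split; [apply: (side_neq (side := side)); rewrite -sj eq_sym bip | ].
- by split; [apply: contraNneq n22 => <- | apply: (side_nadj bip)].
Qed.

(* Two majors of the same side have a common neighbour on the hole, and three of them
   without a common one would form a hexagon. *)
Lemma majors_common_nbr s : 6 < n -> theta_free ->
  exists k, forall w, (forall i, w != c i) -> major c n w -> side w = s -> adj w (c k).
Proof.
move=> n6 TF; have n0 : 0 < n by slia.
pose S := [set w | [&& [forall i : 'I_n, w != c i], [exists i : 'I_n, exists j : 'I_n,
  exists k : 'I_n, [&& i < j, j < k, adj w (c i), adj w (c j) & adj w (c k)]] & side w == s]].
have inS w : reflect [/\ forall i, w != c i, major c n w & side w = s] (w \in S).
  rewrite inE; apply: (iffP and3P) => -[off Mw sw];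
    split; [|exact/majorP|exact/eqP| |exact/majorP|exact/eqP].
    by apply: (hole_avoid Hc n0) => i i_n; apply: (forallP off (Ordinal i_n)).
  exact/forallP.
have [S_empty|[w0 w0S]] := set_0Vmem S.
  by exists 0 => w off Mw sw; have := in_set0 w; rewrite -S_empty; case/inS.
pose r x j := adj x j && [exists i : 'I_n, j == c i].
have [|||j Hj] := @helly_of_triples _ _ r S.
- move=> x y /inS[xN xM sx] /inS[yN yM sy].
  case: (boolP [exists k : 'I_n, adj x (c k) && adj y (c k)]) => [/existsP[k /andP[xk yk]]|none].
    by exists (c k); rewrite /r xk yk /= andbb; apply/existsP; exists k.
  exfalso; apply: (disjoint_majors_absurd xN yN xM yM TF); first by rewrite sx.
  move=> k xk; apply: contra none => yk; apply/existsP; exists (Ordinal (ltn_pmod k n0)).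
  by rewrite /= (hole_modn Hc) xk.
- move=> x1 x2 x3 j1 j2 j3 _ _ _; rewrite /r.
  case/and5P => /andP[a12 e2] /andP[a13 e3] /andP[a21 e1] /andP[a23 _].
  move=> /andP[/andP[a31 _] /andP[a32 _]]; rewrite e1 e2 e3 !andbT; apply/negPn/negP => none.
  by have [|c' /c_min] := hexagon_hole _ none; [apply/and5P; split=> //; apply/andP | apply].
- by apply/set0Pn; exists w0.
have /andP[_ /existsP[k /eqP jk]] := Hj _ w0S.
by exists k => w off Mw sw; rewrite -jk; have /andP[] := Hj w ltac:(exact/inS).
Qed.

End SmallestHole.

End Majors.
(** * Smallest unbalanced holes are isometric *)

Section ClonePaths.
Variables (T : finType) (adj : rel T) (side : T -> bool).
Hypothesis adjC : symmetric adj.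
Hypothesis bip : forall x y, adj x y -> side x != side y.

Notation induced_path := (induced_path adj).
Notation hole := (hole adj).
Notation theta_free := (theta_free adj side).
Notation smallest_unbalanced := (smallest_unbalanced adj).

Definition tent_free : Prop := forall p1 p2 c1 c2 a1 b1 r1 a2 b2 r2,
  ~~ tent_frame adj p1 p2 c1 c2 a1 b1 r1 a2 b2 r2.

Definition clone_at (c : nat -> T) n x e : Prop :=
  (x = c e \/ forall j, x != c j) /\
  forall j, j < n -> adj x (c (e + j)) = (j == 1) || (j == n.-1).

Lemma clone_at_self c n e : hole c n -> 3 < n -> clone_at c n (c e) e.
Proof.
move=> Hc n3; split=> [|[|j] jn]; first by left.
  by rewrite addn0 (negbTE (side_nadj bip (erefl _))); slia.
by rewrite (hole_adj Hc) //; slia.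
Qed.

Lemma clone_at_shift c n x e k : clone_at c n x (k + e) -> clone_at (fun i => c (k + i)) n x e.
Proof.
by case=> off nbrs; split=> [|j /nbrs]; [case: off => ?; [left | right] | rewrite addnA].
Qed.

Lemma clone_at_period c n x e : hole c n -> clone_at c n x e -> clone_at c n x (e + n).
Proof.
move=> Hc [off nbrs]; split=> [|j /nbrs <-]; last by rewrite addnAC (hole_period Hc).
by case: off; [left; rewrite (hole_period Hc) | right].
Qed.

Lemma clone_at_nbrs c n x e : hole c n -> clone_at c n x e -> 0 < e < n.-1 ->
  forall j, j < n -> adj x (c j) = (j == e.-1) || (j == e.+1).
Proof.
move=> Hc [_ nbrs] en j jn; have [ej|je] := leqP e j.
  by have := nbrs (j - e) ltac:(slia); rewrite subnKC // => ->; slia.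
have := nbrs (j + n - e) ltac:(slia); have -> : e + (j + n - e) = j + n by slia.
by rewrite (hole_period Hc) => ->; slia.
Qed.

Lemma clone_at_neq c n x e j : hole c n -> clone_at c n x e -> e < n -> j < n -> j != e ->
  x != c j.
Proof.
move=> Hc [[->|//] _] en jn je; have [lt|lt|E] := ltngtP j e; last by rewrite E eqxx in je.
  by rewrite eq_sym; apply: (hole_neq Hc); slia.
by apply: (hole_neq Hc); slia.
Qed.

Lemma clone_at_of_nbrs c n x e : hole c n -> 0 < e < n.-1 -> (forall j, x != c j) ->
  (forall j, j < n -> adj x (c j) = (j == e.-1) || (j == e.+1)) -> clone_at c n x e.
Proof.
move=> Hc en off nbrs; split=> [|j jn]; first by right.
have [ej|je] := ltnP (e + j) n; first by rewrite nbrs //; slia.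
have -> : e + j = (e + j - n) + n by slia.
by rewrite (hole_period Hc) nbrs; slia.
Qed.

Lemma minor_clone_at c n w e : smallest_unbalanced c n -> (forall k, w != c k) ->
  ~ major adj c n w -> adj w (c e) -> adj w (c (e + 2)) -> clone_at c n w (e + 1).
Proof.
move=> Cm w_off minor we we2; have [n5 n4 Hc cmin] := Cm; split=> [|j jn]; first by right.
have [->|j1] := eqVneq j 1; first by rewrite -addnA we2.
have [->|jn1] := eqVneq j n.-1.
  have -> : e + 1 + n.-1 = e + n by slia.
  by rewrite (hole_period Hc) we.
apply/negbTE/negP => wj.
have [E|E] := minor_nbrs adjC bip Cm w_off minor we wj ltac:(slia); first by slia.
by apply: minor; exists e, (e + 2), (e + 1 + j); split=> //; slia.
Qed.

(* A path between clones of the vertices in positions e and e + f of the hole. *)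
Definition clone_path (c : nat -> T) n e f w l : Prop :=
  [/\ clone_at c n (w 0) e, clone_at c n (w l) (e + f), induced_path w l, 0 < l
    & forall i j, 0 < i < l -> 0 < j < n -> j != f ->
        w i != c (e + j) /\ ~~ adj (w i) (c (e + j))].

Section ClonePath.
Variables (c : nat -> T) (n f : nat) (w : nat -> T) (l : nat).
Hypotheses (Cm : smallest_unbalanced c n) (TF : theta_free) (TNF : tent_free).
Hypotheses (fn : 2 <= f <= n - 2) (W : clone_path c n 0 f w l).

Let n5 : 5 < n. Proof. by case: Cm. Qed.
Let Hc : hole c n. Proof. by case: Cm. Qed.
Let Hw : induced_path w l. Proof. by case: W. Qed.
Let ev : ~~ odd n. Proof. by apply: (hole_even bip Hc); slia. Qed.
Let cS i : adj (c i) (c i.+1). Proof. by apply: hole_adjS Hc _ _; slia. Qed.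

Let x_nbrs j : j < n -> adj (w 0) (c j) = (j == 1) || (j == n.-1).
Proof. by case: W => -[_ nbrs] _ _ _ _ /nbrs. Qed.

Let y_nbrs j : j < n -> adj (w l) (c j) = (j == f.-1) || (j == f.+1).
Proof. by case: W => _ Cy _ _ _; apply: clone_at_nbrs Hc Cy _ _; slia. Qed.

Let x_off j : 0 < j < n -> w 0 != c j.
Proof. by case: W => Cx _ _ _ _ Hj; apply: clone_at_neq Hc Cx _ _ _; slia. Qed.

Let y_off j : j < n -> j != f -> w l != c j.
Proof. by case: W => _ Cy _ _ _ jn jf; apply: clone_at_neq Hc Cy _ jn jf; slia. Qed.

Let inner i j : 0 < i < l -> 0 < j < n -> j != f -> w i != c j /\ ~~ adj (w i) (c j).
Proof. by case: W => _ _ _ _; apply. Qed.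

Let side_ends : side (w l) = side (w 0) (+) odd f.
Proof.
have x1 : adj (w 0) (c 1) by rewrite x_nbrs //; slia.
have y1 : adj (w l) (c f.+1) by rewrite y_nbrs ?eqxx ?orbT //; slia.
rewrite (hole_nbr_side bip Hc ltac:(slia) x1) (hole_nbr_side bip Hc ltac:(slia) y1) /=.
by case: (side _); case: (odd f).
Qed.

Let l_parity : odd l = odd f.
Proof.
by rewrite (induced_path_odd bip Hw) side_ends; case: (side _); case: (odd f).
Qed.

Lemma clone_path_even : ~~ odd f.
Proof.
apply/negP => of_; have fn3 : 3 <= f <= n - 3 by slia.
have [[Cx _] [Cy _] _ l0 _] := W.
have [xy|Nxy] := boolP (adj (w 0) (w l)).
  have x_out j : w 0 != c j.
    by case: Cx => // E; move: xy; rewrite E adjC y_nbrs; slia.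
  have y_out j : w l != c j.
    by case: Cy => // E; move: xy; rewrite E x_nbrs; slia.
  have [r1 [r2]] := tent_frame_complete adjC bip Hc n5 TF of_ fn3 x_nbrs y_nbrs x_out y_out xy.
  exact/negP/TNF.
have l1 : l != 1 by apply: contraNneq Nxy => l1; rewrite l1; apply: (induced_path_adjS Hw); slia.
apply: (TF (a := w 0) (b := w l) (X := arc c 1 f) (Y := arc c f.+1 n) (Z := arc w 1 l)).
have path_far lo hi : 0 < lo -> hi <= n -> ~~ (lo <= f < hi) ->
    anticomplete adj (arc c lo hi) (arc w 1 l).
  move=> lo0 hin out; apply: anticompleteC => //.
  by apply: anticomplete_arcs => a b Ha Hb; apply: inner; slia.
split=> //.
- by rewrite side_ends of_; case: (side _).
- split.
  + apply: linked_arc => //; rewrite ?x_nbrs //; try slia.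
    by rewrite adjC y_nbrs ?eqxx //; slia.
  + apply: linkedC => //; apply: linked_arc => //; rewrite ?y_nbrs ?eqxx ?orbT //; try slia.
    by rewrite adjC x_nbrs; slia.
  + by apply: linked_inner_arc => [|k /andP[_]]; [slia | apply: induced_path_adjS Hw].
- split; [|by apply: path_far; slia..].
  by apply: anticomplete_arcs => a b Ha Hb; apply: (hole_far Hc); slia.
- rewrite !in_setU3; split; apply/or3P => -[] /arcP[a Ha /eqP]; apply/negP.
  + by apply: x_off; slia.
  + by apply: x_off; slia.
  + by have [] := Hw (ltac:(slia) : 0 < a <= l).
  + by apply: y_off; slia.
  + by apply: y_off; slia.
  + by rewrite eq_sym; have [] := Hw (ltac:(slia) : a < l <= l).
Qed.

(* Otherwise the path and one of the two arcs of the hole form a shorter unbalanced hole. *)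
Lemma clone_path_long : f <= l \/ n - f <= l.
Proof.
have [_ n4 _ cmin] := Cm; have ef := clone_path_even; have [_ _ _ l0 _] := W.
apply/orP; rewrite -implyNb; apply/implyP; rewrite -ltnNge => lf.
rewrite leqNgt; apply/negP => lnf.
have l2 : 1 < l by slia.
have xy : w 0 != w l by have [] := Hw (ltac:(slia) : 0 < l <= l).
have Nxy : ~~ adj (w 0) (w l).
  by apply: (side_nadj bip); rewrite side_ends (negbTE ef) addbF.
have [|||i Hi|i Hi|x [Hx x0 xf xE]] := induced_path_add_ends adjC
    (hole_arc Hc 1 (ltac:(slia) : f - 2 + 2 <= n)) xy Nxy; rewrite ?x_nbrs ?y_nbrs //; try slia.
- by rewrite adjC y_nbrs; slia.
- by move=> i Hi; split; [apply: x_off | apply: y_off]; slia.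
have yx : w l != w 0 by rewrite eq_sym.
have Nyx : ~~ adj (w l) (w 0) by rewrite adjC.
have [|||i Hi|i Hi|y [Hy y0 yf yE]] := induced_path_add_ends adjC
    (hole_arc Hc f.+1 (ltac:(slia) : n - f - 2 + 2 <= n)) yx Nyx;
  rewrite ?x_nbrs ?y_nbrs //; try slia.
- by rewrite adjC x_nbrs; slia.
- by move=> i Hi; split; [apply: y_off | apply: x_off]; slia.
have [m4|m4] := eqVneq ((f + l) %% 4) 2.
  have [||||[|i] j // Hi Hj|h [Hh _ _]] := hole_of_two_paths adjC Hx Hw; rewrite ?x0 ?xf //.
    by rewrite xE; [rewrite eq_sym adjC; apply: inner; slia | slia].
  by apply: (@cmin ((f - 2).+2 + l) h) => //; slia.
have [||||[|i] j // Hi Hj|h [Hh _ _]] := hole_of_two_paths adjC Hy (induced_path_rev adjC Hw);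
  rewrite ?subn0 ?subnn ?y0 ?yf //.
  by rewrite yE; [rewrite eq_sym adjC; apply: inner; slia | slia].
by apply: (@cmin ((n - f - 2).+2 + l) h) => //; slia.
Qed.

End ClonePath.

Lemma clone_path_length c n e f w l : smallest_unbalanced c n -> theta_free -> tent_free ->
  2 <= f <= n - 2 -> clone_path c n e f w l -> ~~ odd f /\ (f <= l \/ n - f <= l).
Proof.
move=> Cm TF TNF fn [Cx Cy Hw l0 inner].
have We : clone_path (fun i => c (e + i)) n 0 f w l.
  by split=> //; apply: clone_at_shift; rewrite ?addn0.
have Cme := smallest_unbalanced_shift e Cm.
by split; [apply: clone_path_even Cme TF TNF fn We | apply: clone_path_long Cme TF TNF fn We].
Qed.

End ClonePaths.

(* Antipodal vertices are an exception: the two holes formed with a path of length d - 2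
   between them have length n - 2, which is 0 modulo 4. *)
Definition long_walk n d l : bool :=
  if d.*2 == n then d <= l + 2 else (d <= l) || (n - d <= l).

Section IsometryStep.
Variables (T : finType) (adj : rel T) (side : T -> bool).
Hypothesis adjC : symmetric adj.
Hypothesis bip : forall x y, adj x y -> side x != side y.

Notation induced_path := (induced_path adj).
Notation hole := (hole adj).
Notation smallest_unbalanced := (smallest_unbalanced adj).
Notation clone_at := (clone_at adj).
Notation clone_path := (clone_path adj).

Variables (c : nat -> T) (n : nat) (A : {pred T}) (d l : nat) (p : nat -> T).
Hypotheses (Cm : smallest_unbalanced c n) (TF : theta_free adj side) (TNF : tent_free adj).
Hypothesis cA : forall i, c i \in A.
Hypothesis minor : forall v, v \in A -> (forall k, v != c k) -> ~ major adj c n v.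
Hypothesis shorter_long : forall l' i d', l' < l -> 0 < d' < n ->
  walkb (restrict adj A) l' (c i) (c (i + d')) -> long_walk n d' l'.
Hypotheses (d0 : 0 < d) (dn : d.*2 <= n).
Hypotheses (Hp : induced_path p l) (p0 : p 0 = c 0) (pl : p l = c d).
Hypothesis pA : forall i, i <= l -> p i \in A.
Hypothesis short : ~~ long_walk n d l.

Let Hc : hole c n. Proof. by case: Cm. Qed.
Let n5 : 5 < n. Proof. by case: Cm. Qed.
Let ev : ~~ odd n. Proof. by apply: (hole_even bip Hc); slia. Qed.
Let cS k : adj (c k) (c k.+1). Proof. by apply: hole_adjS Hc _ _; slia. Qed.
Let pS i : i < l -> adj (p i) (p i.+1). Proof. exact: induced_path_adjS Hp. Qed.

Let l_parity : odd l = odd d.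
Proof.
rewrite (induced_path_odd bip Hp) p0 pl (hole_side bip d Hc); last by slia.
by case: (side (c 0)); case: (odd d).
Qed.

Let dl : l + 2 <= d /\ (d.*2 = n -> l + 2 < d).
Proof.
by move: short; rewrite /long_walk; case: eqP => [E|E] H; split;
  move: d0 dn l_parity ev; slia.
Qed.

Let p_walk i j : i <= j <= l -> walkb (restrict adj A) (j - i) (p i) (p j).
Proof.
move=> ij; apply: walkb_segment => [|t Ht]; first by slia.
by apply/and3P; split; [apply: pS | apply: pA | apply: pA]; slia.
Qed.

Let walk_sym k u v : walkb (restrict adj A) k u v -> walkb (restrict adj A) k v u.
Proof. exact/walkbC/restrictC. Qed.

Let walk_step k u v w : walkb (restrict adj A) k u v -> adj v w -> v \in A -> w \in A ->
  walkb (restrict adj A) k.+1 u w.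
Proof.
by move=> W vw vA wA; rewrite walkb_rcons; apply/existsP; exists v; rewrite W /=; exact/and3P.
Qed.

Lemma shorter_long_dist k i j : walkb (restrict adj A) k (c i) (c j) ->
  k < l -> i < n -> j < n -> i != j -> long_walk n (if i < j then j - i else i - j) k.
Proof.
move=> W kl i_n jn ij; case: ltnP => C.
  by apply: (@shorter_long k i (j - i)); rewrite ?subnKC //; slia.
by apply: (@shorter_long k j (i - j)); rewrite ?subnKC //; [slia | apply: walk_sym].
Qed.

Lemma path_off i : 0 < i < l -> forall j, p i != c j.
Proof.
move=> il; apply: (hole_avoid Hc ltac:(slia)) => j jn; apply/eqP => pic.
have j0 : j != 0.
  by apply/eqP => j0; have [] := Hp (i := 0) (j := i) ltac:(slia); rewrite pic j0 p0 eqxx.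
have jd : j != d.
  by apply/eqP => jd; have [] := Hp (i := i) (j := l) ltac:(slia); rewrite pic jd pl eqxx.
have long1 : long_walk n j i.
  apply: (@shorter_long i 0 j); try slia.
  by have := p_walk (ltac:(slia) : 0 <= i <= l); rewrite subn0 p0 pic.
have long2 : long_walk n (if j < d then d - j else j - d) (l - i).
  have := p_walk (ltac:(slia) : i <= l <= l); rewrite pic pl.
  by move/shorter_long_dist; apply; slia.
move: long1 long2 dl dn d0; rewrite /long_walk.
by case: (ltnP j d) => C; case: eqP => E1; case: eqP => E2; slia.
Qed.

Lemma middle_nbr i j : 1 < i < l.-1 -> j < n -> adj (p i) (c j) ->
  [/\ d = l + 2, d.*2 < n & j = i.+1].
Proof.
move=> il jn pc; have iA := pA (ltac:(slia) : i <= l).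
have j0 : j != 0.
  by apply/eqP => j0; have [|_] := Hp (i := 0) (j := i); [slia | rewrite adjC p0 -j0 pc; slia].
have jd : j != d.
  by apply/eqP => jd; have [|_] := Hp (i := i) (j := l); [slia | rewrite pl -jd pc; slia].
have long1 : long_walk n j i.+1.
  apply: (@shorter_long i.+1 0 j); try slia.
  by have := p_walk (ltac:(slia) : 0 <= i <= l); rewrite subn0 p0 => /walk_step; apply.
set dj := if j < d then d - j else j - d.
have long2 : long_walk n dj (l - i).+1.
  have := walk_step (walk_sym (p_walk (ltac:(slia) : i <= l <= l))) pc iA (cA j).
  by rewrite pl => /walk_sym/shorter_long_dist; apply; slia.
have [dl1 dl2] := dl.
have short1 : j <= i.+1 \/ n - j <= i.+1.
  by move: long1; rewrite /long_walk; clear -il dl1 dn; case: eqP => jE; slia.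
have djE : j < d /\ dj = d - j \/ d < j /\ dj = j - d.
  by rewrite /dj; clear -jd; case: (ltnP j d) => C; slia.
have short2 : dj <= (l - i).+1 \/ n - dj <= (l - i).+1.
  by move: long2; rewrite /long_walk; clear -il dl1 dn; case: eqP => jE; slia.
clear -short1 short2 dl1 dl2 djE il dn jn d0.
by case: short1 => short1; case: short2 => short2; case: djE => -[? ?]; split; slia.
Qed.

Lemma path_length_ge3 : 3 <= l.
Proof.
have [dl1 dl2] := dl; rewrite leqNgt; apply/negP => l3.
have [lE|[lE|lE]] : l = 0 \/ l = 1 \/ l = 2 by slia.
- by move: pl; rewrite lE p0; apply/eqP/(hole_neq Hc); slia.
- have := pS (ltac:(slia) : 0 < l); rewrite p0 -lE pl (hole_adj Hc); slia.
have off := path_off (ltac:(slia) : 0 < 1 < l).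
have p1c0 : adj (p 1) (c 0) by rewrite adjC -p0; apply: pS; slia.
have p1cd : adj (p 1) (c d) by rewrite -pl lE; apply: pS; slia.
have := minor_nbrs adjC bip Cm off (minor (pA (ltac:(slia) : 1 <= l)) off) p1c0 p1cd.
by move: dn; slia.
Qed.

Let l3 := path_length_ge3.
Let p1_off : forall j, p 1 != c j. Proof. by apply: path_off; slia. Qed.
Let pl1_off : forall j, p l.-1 != c j. Proof. by apply: path_off; slia. Qed.
Let p1_minor : ~ major adj c n (p 1). Proof. by apply: minor p1_off; apply: pA; slia. Qed.
Let pl1_minor : ~ major adj c n (p l.-1). Proof. by apply: minor pl1_off; apply: pA; slia. Qed.
Let p1c0 : adj (p 1) (c 0). Proof. by rewrite adjC -p0; apply: pS; slia. Qed.
Let pl1cd : adj (p l.-1) (c d).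
Proof. by rewrite -pl; have := pS (ltac:(slia) : l.-1 < l); rewrite prednK //; slia. Qed.

Lemma first_nbr j : j < n -> adj (p 1) (c j) -> [\/ j = 0, j = 2 | j = n - 2].
Proof.
move=> jn pc; have [->|j0] := eqVneq j 0; first by constructor 1.
have [E|E] := minor_nbrs adjC bip Cm p1_off p1_minor p1c0 pc ltac:(slia).
  by constructor 2; slia.
by constructor 3; slia.
Qed.

Lemma last_nbr j : j < n -> adj (p l.-1) (c j) -> [\/ j = d, j = d.+2 | j = d - 2].
Proof.
have [dl1 dl2] := dl; move=> jn pc; have [->|jd] := eqVneq j d; first by constructor 1.
have [lt|ge] := ltnP j d.
  have [jE|jE] := minor_nbrs adjC bip Cm pl1_off pl1_minor pc pl1cd ltac:(move: dn; slia).
    by constructor 3; slia.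
  by move: dn d0; slia.
have [jE|jE] := minor_nbrs adjC bip Cm pl1_off pl1_minor pl1cd pc ltac:(slia).
  by constructor 2; slia.
by move: dn d0; slia.
Qed.

(* The path is cut at its second vertex if this is a clone of a vertex of the hole. *)
Lemma first_clone : exists s e, [/\ clone_at c n (p s) e,
    [\/ s = 0 /\ e = 0, s = 1 /\ e = 1 | s = 1 /\ e = n.-1]
  & s = 0 -> forall j, j < n -> adj (p 1) (c j) -> j = 0].
Proof.
have [p2|Np2] := boolP (adj (p 1) (c 2)).
  exists 1, 1; split=> //; [|by constructor 2].
  exact: (minor_clone_at adjC bip Cm p1_off p1_minor p1c0 p2).
have [pn|Npn] := boolP (adj (p 1) (c (n - 2))).
  exists 1, n.-1; split=> //; [|by constructor 3].
  have -> : n.-1 = n - 2 + 1 by slia.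
  apply: (minor_clone_at adjC bip Cm p1_off p1_minor pn).
  by rewrite (_ : n - 2 + 2 = 0 + n) ?(hole_period Hc) //; slia.
exists 0, 0; split; [by rewrite p0; apply: (clone_at_self bip _ Hc); slia | by constructor 1 |].
by move=> _ j jn pj; have [//|E|E] := first_nbr jn pj; move: pj;
  rewrite E ?(negbTE Np2) ?(negbTE Npn).
Qed.

Lemma last_clone : exists t f, [/\ clone_at c n (p (l - t)) f,
    [\/ t = 0 /\ f = d, t = 1 /\ f = d.+1 | t = 1 /\ f = d.-1]
  & t = 0 -> forall j, j < n -> adj (p l.-1) (c j) -> j = d].
Proof.
have [dl1 _] := dl; have [p2|Np2] := boolP (adj (p l.-1) (c d.+2)).
  exists 1, d.+1; rewrite subn1; split=> //; [|by constructor 2].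
  rewrite -[d.+1]addn1; apply: (minor_clone_at adjC bip Cm pl1_off pl1_minor pl1cd).
  by rewrite addn2.
have [pn|Npn] := boolP (adj (p l.-1) (c (d - 2))).
  exists 1, d.-1; rewrite subn1; split=> //; [|by constructor 3].
  have -> : d.-1 = d - 2 + 1 by slia.
  apply: (minor_clone_at adjC bip Cm pl1_off pl1_minor pn).
  by rewrite subnK //; slia.
exists 0, d; rewrite subn0 pl.
split; [by apply: (clone_at_self bip _ Hc); slia | by constructor 1 |].
by move=> _ j jn pj; have [//|jE|jE] := last_nbr jn pj; move: pj;
  rewrite jE ?(negbTE Np2) ?(negbTE Npn).
Qed.

Lemma clone_at_wrap x e f : clone_at c n x f -> e <= f + n ->
  clone_at c n x (e + (if e <= f then f - e else f + n - e)).
Proof. by move=> Cx ef; case: leqP => C; rewrite subnKC // ; apply: clone_at_period. Qed.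

Lemma no_middle_nbr_absurd :
  (forall i j, 1 < i < l.-1 -> j < n -> ~~ adj (p i) (c j)) -> False.
Proof.
move=> no_middle; have [dl1 dl2] := dl.
have [s [e [clone_s start only_c0]]] := first_clone.
have [t [f [clone_t finish only_cd]]] := last_clone.
pose g := if e <= f then f - e else f + n - e.
have Hst : s <= 1 /\ t <= 1.
  by clear -start finish; case: start => -[? ?]; case: finish => -[? ?]; slia.
have en : e < n by clear -start n5; case: start => -[? ?]; slia.
have eg : e + g = f \/ e + g = f + n by rewrite /g; clear -en; case: leqP => C; slia.
have [gn short_l] : 2 <= g <= n - 2 /\ l - s - t < g /\ l - s - t < n - g.
  rewrite /g; clear -start finish dl1 dl2 d0 n5 dn l3 ev.
  by case: (leqP e f); case: start => -[-> ->]; case: finish => -[-> ->]; slia.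
have Ct' := clone_at_wrap clone_t (ltac:(slia) : e <= f + n).
have [] := clone_path_length adjC bip (e := e) (w := fun i => p (s + i)) (l := l - s - t)
  Cm TF TNF gn.
  split; rewrite ?addn0 //; last move=> i j Hi Hj jg.
  - by have -> : s + (l - s - t) = l - t by slia.
  - by apply: induced_path_sub Hp _; slia.
  - by slia.
  split; first by apply: path_off; slia.
  have [k [Hk ck]] := hole_index_window Hc 0 (e + j) ltac:(slia).
  have kE := hole_index_eq Hc ck ltac:(slia) ltac:(slia).
  rewrite -ck; have kn : k < n by slia.
  have [mid|edge] := boolP (1 < s + i < l.-1); first exact: no_middle.
  apply/negP => pk; have [si1|si1] := eqVneq (s + i) 1.
    rewrite si1 in pk; have := only_c0 ltac:(slia) k kn pk.
    by clear -start si1 kE Hi Hj jg n5 en; case: start => -[? ?]; slia.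
  have sil : s + i = l.-1 by slia.
  rewrite sil in pk; have := only_cd ltac:(slia) k kn pk.
  by clear -finish sil kE Hi Hj jg eg kn gn; case: finish => -[? ?]; slia.
by move=> _; slia.
Qed.

(* The vertices of the path are now adjacent to consecutive vertices of the hole, one step
   ahead. As far as these rungs go, the path can replace the hole. *)
Section MiddleNbr.
Hypotheses (dE : d = l + 2) (d2n : d.*2 < n).
Variable i0 : nat.
Hypotheses (Hi0 : 1 < i0 < l.-1) (pi0 : adj (p i0) (c i0.+1)).

Let p_adj i j : i < j <= l -> adj (p i) (p j) = (j == i.+1).
Proof. by move/Hp=> []. Qed.
Let p_neq i j : i < j <= l -> p i != p j.
Proof. by move/Hp=> []. Qed.

Lemma inner_nbr i j : 0 < i < l -> j < n -> adj (p i) (c j) ->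
  [\/ i = 1 /\ j = 0, i = l.-1 /\ j = d | j = i.+1].
Proof.
move=> il jn pj; have i0A := pA (ltac:(slia) : i0 <= l).
have [iE|i1] := eqVneq i 1.
  rewrite iE in pj *; have [->|->|jE] := first_nbr jn pj; [by constructor 1|by constructor 3|].
  have p1A := pA (ltac:(slia) : 1 <= l).
  have back := walk_step (walk_sym (walk_step (p_walk (ltac:(slia) : 1 <= i0 <= l)) pi0 i0A (cA _)))
    pj p1A (cA _).
  have := shorter_long_dist back ltac:(slia) ltac:(slia) jn ltac:(slia); rewrite jE /long_walk.
  have -> : i0.+1 < n - 2 by slia.
  by move: d2n Hi0 dE; clear; case: eqP; slia.
have [iE|il1] := eqVneq i l.-1; last first.
  by have [_ _ ->] := middle_nbr (ltac:(slia) : 1 < i < l.-1) jn pj; constructor 3.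
rewrite iE in pj *; have [->|jE|jE] := last_nbr jn pj;
  [by constructor 2 | exfalso | by constructor 3; slia].
have pl1A := pA (ltac:(slia) : l.-1 <= l).
have out := p_walk (ltac:(slia) : i0 <= l.-1 <= l).
have back := walk_step (walk_sym (walk_step out pj pl1A (cA _)))
  pi0 i0A (cA _).
have := shorter_long_dist back ltac:(slia) jn ltac:(slia) ltac:(slia); rewrite jE /long_walk.
have -> : (d.+2 < i0.+1) = false by slia.
by move: d2n Hi0 dE; clear; case: eqP; slia.
Qed.

Lemma inner_nadj i j : 0 < i < l -> j < n ->
  ~~ [|| (i == 1) && (j == 0), (i == l.-1) && (j == d) | j == i.+1] -> ~~ adj (p i) (c j).
Proof.
move=> il jn out; apply: contra out => /(inner_nbr il jn).
by case=> [[-> ->]|[-> ->]|->]; rewrite !eqxx ?orbT.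
Qed.

Let reroute q j : T := if j %% n <= q then p (j %% n) else c (j %% n).

Lemma rerouteE q j : j < n -> reroute q j = if j <= q then p j else c j.
Proof. by move=> jn; rewrite /reroute modn_small. Qed.

Section Reroute.
Variable q : nat.
Hypotheses (ql : q.+2 <= l) (rungs : forall i, 0 < i <= q -> adj (p i) (c i.+1)).

Lemma reroute_smallest : smallest_unbalanced (reroute q) n.
Proof.
case: Cm => m1 m2 _ m4; split=> //.
apply: (@hole_of_range _ _ adjC (fun j => if j <= q then p j else c j)) => //; first by slia.
move=> i j ij; case: leqP => iq; case: leqP => jq.
- by rewrite p_neq ?p_adj; try slia; split=> //; slia.
- have [->|i1] := posnP i.
    by rewrite p0 (hole_neq Hc) ?(hole_adj Hc); try slia; split=> //; slia.
  rewrite path_off; last by slia.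
  split=> //; have [->|ji] := eqVneq j i.+1; first by rewrite rungs //; slia.
  by rewrite (negbTE (inner_nadj _ _ _)); slia.
- by slia.
- by rewrite (hole_neq Hc) ?(hole_adj Hc); try slia; split=> //; slia.
Qed.

Let Hq : hole (reroute q) n. Proof. by case: reroute_smallest. Qed.

Lemma reroute_off t : q < t < l -> forall j, p t != reroute q j.
Proof.
move=> Ht; apply: (hole_avoid Hq) => [|j jn]; first by slia.
rewrite rerouteE //; case: leqP => C; first by rewrite eq_sym; apply: p_neq; slia.
by apply: path_off; slia.
Qed.

Lemma reroute_clone_self j : j < n -> clone_at (reroute q) n (if j <= q then p j else c j) j.
Proof. by move=> jn; rewrite -rerouteE //; apply: (clone_at_self bip _ Hq); slia. Qed.

Lemma reroute_clone t j : q < t < l -> 0 < j < n.-1 ->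
  (forall k, k <= q -> (t == k.+1) = (k == j.-1) || (k == j.+1)) ->
  (forall k, q < k < n -> adj (p t) (c k) = (k == j.-1) || (k == j.+1)) ->
  clone_at (reroute q) n (p t) j.
Proof.
move=> Ht jn near far; apply: clone_at_of_nbrs (reroute_off Ht) _ => // k kn.
rewrite rerouteE //; case: leqP => C; last by apply: far; rewrite C.
by rewrite adjC p_adj ?near //; slia.
Qed.

End Reroute.

Lemma all_rungs_absurd : (forall i, 0 < i < l -> adj (p i) (c i.+1)) -> False.
Proof.
move=> rungs; have ql : (l - 3).+2 <= l by slia.
have rungs3 i : 0 < i <= l - 3 -> adj (p i) (c i.+1) by move=> Hi; apply: rungs; slia.
have [] := clone_path_length adjC bip (e := l - 2) (f := 3) (w := fun i => p (l - 2 + i)) (l := 1)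
  (reroute_smallest ql rungs3) TF TNF; rewrite ?addn0 //; first by slia.
split=> //; [| | by apply: induced_path_sub Hp _; slia | by slia]; rewrite ?addn0.
  apply: (reroute_clone ql rungs3) => [||k Hk|k Hk]; try slia.
  have [->|j1] := eqVneq k (l - 2).+1; first by rewrite rungs ?orbT //; slia.
  by rewrite (negbTE (inner_nadj _ _ _)); slia.
apply: (reroute_clone ql rungs3) => [||k Hk|k Hk]; try slia.
have -> : l - 2 + 1 = l.-1 by slia.
have [->|kd] := eqVneq k d; first by rewrite pl1cd; slia.
have [->|kl] := eqVneq k l.
  by have := rungs l.-1 ltac:(slia); rewrite prednK; [move=> ->; slia | slia].
by rewrite (negbTE (inner_nadj _ _ _)); slia.
Qed.

(* The rungs stop at [e], and [p i] is the first later vertex of the path with a neighbour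
   on the hole beyond [c e]. *)
Section FirstGap.
Variables e i : nat.
Hypotheses (el : e.+2 <= l) (ei : e < i < l).
Hypothesis rungs : forall k, 0 < k <= e -> adj (p k) (c k.+1).
Hypothesis gap : ~~ adj (p e.+1) (c e.+2).
Hypothesis between : forall t k, e < t < i -> e < k < n -> ~~ adj (p t) (c k).

Let Cq : smallest_unbalanced (reroute e) n. Proof. exact: reroute_smallest. Qed.
Let Hq : hole (reroute e) n. Proof. by case: Cq. Qed.

Lemma rung_foot : adj (p e) (c e.+1).
Proof. by have [->|e0] := posnP e; [rewrite p0 | apply: rungs; slia]. Qed.

Lemma rung_foot_far k : e.+1 < k < n.-1 -> p e != c k /\ ~~ adj (p e) (c k).
Proof.
move=> Hk; have [e0|e0] := posnP e.
  by rewrite e0 p0 (hole_neq Hc) ?(hole_adj Hc); slia.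
by split; [apply: path_off | apply: inner_nadj]; slia.
Qed.

Lemma gap_far t k : e < t < i -> k < n -> k != e ->
  p t != reroute e k /\ ~~ adj (p t) (reroute e k).
Proof.
move=> Ht kn ke; split; first by apply: reroute_off => //; slia.
by rewrite rerouteE //; case: leqP => C; [rewrite adjC p_adj | apply: between]; slia.
Qed.

Lemma gap_length g : i < g <= d -> e.+1 < g -> adj (p i) (c g) ->
  (forall k, e < k < n -> k != g -> ~~ adj (p i) (c k)) ->
  ~~ odd (g - e) /\ (g - e <= (i - e).+1 \/ n - (g - e) <= (i - e).+1).
Proof.
move=> ig eg pg only; have gn : g < n by slia.
pose w t := if t <= i - e then p (e + t) else c g.
have Hw : induced_path w (i - e).+1.
  apply: induced_path_rcons => [||t Ht|t Ht]; rewrite ?subnKC; try slia.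
  - by apply: induced_path_sub Hp _; slia.
  - exact: pg.
  - have [->|t0] := posnP t; last by apply: path_off; slia.
    by rewrite addn0; have [] := rung_foot_far (ltac:(slia) : e.+1 < g < n.-1).
  - have [->|t0] := posnP t; last by apply: between; slia.
    by rewrite addn0; have [] := rung_foot_far (ltac:(slia) : e.+1 < g < n.-1).
apply: (clone_path_length adjC bip (e := e) Cq TF TNF _ (w := w)); first by slia.
split=> // [||t k Ht Hk kg].
- rewrite /w leq0n addn0; have := reroute_clone_self el rungs (ltac:(slia) : e < n).
  by rewrite leqnn.
- rewrite /w ltnn subnKC; last by slia.
  by have := reroute_clone_self el rungs gn; rewrite leqNgt (ltac:(slia) : e < g).
have -> : w t = p (e + t) by rewrite /w; have -> : t <= i - e by slia.
have [k' [Hk' Ek]] := hole_index_window Hq 0 (e + k) ltac:(slia).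
have kE := hole_index_eq Hq Ek ltac:(slia) ltac:(slia).
rewrite -Ek; have [ti|ti] := eqVneq t (i - e); last by apply: gap_far; slia.
rewrite ti subnKC; last by slia.
split; first by apply: reroute_off => //; slia.
by rewrite rerouteE; [case: leqP => C; [rewrite adjC p_adj | apply: only] | ]; slia.
Qed.

Lemma return_linked : i < l.-1 ->
  linked adj (arc p i.+1 l :|: arc c d n :|: arc p 0 e) (p e) (p i).
Proof.
move=> il; set ret := _ :|: _.
have Xp k : i < k < l -> p k \in ret by move=> kI; rewrite !in_setU mem_arc //; slia.
have Xc k : d <= k < n -> c k \in ret by move=> kI; rewrite !in_setU (mem_arc c) ?orbT //; slia.
have Xp0 k : k < e -> p k \in ret.
  by move=> kI; rewrite !in_setU (mem_arc p (lo := 0)) ?orbT //; slia.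
have back : connect (restrict adj ret) (c n.-1) (p i.+1).
  rewrite connect_restrictC //; apply: (@connect_trans _ _ (p l.-1)).
    by apply: connect_segment => [|k Hk|k Hk]; [slia | apply: pS; slia | apply: Xp; slia].
  apply: (@connect_trans _ _ (c d)).
    by apply: connect1; rewrite /restrict /= pl1cd Xp ?Xc //; slia.
  by apply: connect_segment => [|k Hk|k Hk]; [slia | exact: cS | apply: Xc; slia].
have cn0 : adj (c n.-1) (c 0).
  by have := cS n.-1; rewrite prednK; [rewrite -[n]add0n (hole_period Hc) | slia].
have i1 : adj (p i.+1) (p i) by rewrite adjC; apply: pS; slia.
have [e0|e0] := posnP e.
  exists (c n.-1), (p i.+1); split=> //; [by apply: Xc; slia | by apply: Xp; slia |].
  by rewrite e0 p0 adjC.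
exists (p e.-1), (p i.+1); split=> //; [by apply: Xp0; slia | by apply: Xp; slia | |].
  by rewrite adjC; have := pS (ltac:(slia) : e.-1 < l); rewrite prednK.
apply: connect_trans back; rewrite connect_restrictC //; apply: (@connect_trans _ _ (p 0)).
  by apply: connect1; rewrite /restrict /= p0 cn0 -p0 Xc ?Xp0 //; slia.
by apply: connect_segment => [|k Hk|k Hk]; [slia | apply: pS; slia | apply: Xp0; slia].
Qed.

Lemma gap_anticomplete : i < l.-1 ->
  [/\ anticomplete adj (arc p e.+1 i) (arc c e.+1 i.+2),
      anticomplete adj (arc p e.+1 i) (arc p i.+1 l :|: arc c d n :|: arc p 0 e)
    & anticomplete adj (arc c e.+1 i.+2) (arc p i.+1 l :|: arc c d n :|: arc p 0 e)].
Proof.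
move=> il.
have pp a b : a.+1 < b <= l -> p a != p b /\ ~~ adj (p a) (p b).
  by move=> abI; rewrite p_neq ?p_adj; slia.
have pc a b : e < a < i -> e < b < n -> p a != c b /\ ~~ adj (p a) (c b).
  by move=> aI bI; split; [apply: path_off; slia | apply: between].
have cp a b : i < a < l -> e < b < i.+2 -> c b != p a /\ ~~ adj (c b) (p a).
  by move=> aI bI; rewrite eq_sym adjC; split; [apply: path_off | apply: inner_nadj]; slia.
have cp0 a b : a < e -> e < b < i.+2 -> c b != p a /\ ~~ adj (c b) (p a).
  move=> aI bI; rewrite eq_sym adjC; have [->|a0] := posnP a.
    by rewrite p0 (hole_neq Hc) ?(hole_adj Hc); slia.
  by split; [apply: path_off | apply: inner_nadj]; slia.
split; [|do 2?apply: anticompleteU|do 2?apply: anticompleteU];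
  apply: anticomplete_arcs => a b Ha Hb.
- by apply: pc; slia.
- by apply: pp; slia.
- by apply: pc; slia.
- by rewrite eq_sym adjC; apply: pp; slia.
- by apply: cp.
- by apply: (hole_far Hc); slia.
- by apply: cp0.
Qed.

Lemma gap_theta_absurd : i < l.-1 -> odd i != odd e -> e.+1 < i -> adj (p i) (c i.+1) -> False.
Proof.
move=> il par ei1 pi.
apply: (TF (a := p e) (b := p i) (X := arc p e.+1 i) (Y := arc c e.+1 i.+2)
  (Z := arc p i.+1 l :|: arc c d n :|: arc p 0 e)).
split.
- rewrite (induced_path_side bip Hp (ltac:(slia) : e <= l)).
  rewrite (induced_path_side bip Hp (ltac:(slia) : i <= l)).
  by move: par; case: (side _); case: (odd i); case: (odd e).
- by rewrite p_adj; slia.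
- split; last exact: return_linked.
    by apply: linked_inner_arc => [|k Hk]; [slia | apply: pS; slia].
  by apply: linked_arc; rewrite ?rung_foot //; [slia | rewrite adjC].
- exact: gap_anticomplete.
have p_c a b : a < l -> a < b < n -> p a != c b.
  move=> al ab; have [->|a0] := posnP a; last by apply: path_off; slia.
  by rewrite p0; apply: (hole_neq Hc); slia.
rewrite !in_setU3; split; apply/negP => /or3P[||/or3P[||]] /arcP[a Ha /eqP]; apply/negP;
  by first [apply: p_neq; slia | apply: p_c; slia | apply: path_off; slia
    | rewrite eq_sym; apply: p_neq; slia].
Qed.

Lemma last_rung_absurd : i = l.-1 -> adj (p l.-1) (c l) -> False.
Proof.
move=> iE pl1cl; have el3 : e.+3 <= l.
  have : e.+2 != l; last by slia.
  apply: contraNneq gap => eE; rewrite eE; have -> : e.+1 = l.-1 by slia.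
  exact: pl1cl.
have [] := clone_path_length adjC bip (e := e) (f := l.+1 - e) (w := fun t => p (e + t))
  (l := l.-1 - e) Cq TF TNF; [by slia | | by slia].
split=> [|||| t k Ht Hk kf].
- rewrite addn0; have := reroute_clone_self el rungs (ltac:(slia) : e < n).
  by rewrite leqnn.
- rewrite !subnKC; try slia.
  apply: (reroute_clone el rungs) => [||k Hk|k Hk]; try slia.
  have [->|kd] := eqVneq k d; first by rewrite pl1cd; slia.
  have [->|kl] := eqVneq k l; first by rewrite pl1cl; slia.
  by rewrite (negbTE (inner_nadj _ _ _)); slia.
- by apply: induced_path_sub Hp _; slia.
- by slia.
have [k' [Hk' Ek]] := hole_index_window Hq 0 (e + k) ltac:(slia).
have kE := hole_index_eq Hq Ek ltac:(slia) ltac:(slia).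
by rewrite -Ek; apply: gap_far; slia.
Qed.

Lemma first_gap_absurd j : e < j < n -> adj (p i) (c j) -> False.
Proof.
move=> ej pij; have [il|il] := ltnP i l.-1.
  have ji : j = i.+1 by have [] := inner_nbr _ _ pij; slia.
  rewrite {}ji in pij ej.
  have ie : i != e.+1 by apply: contraNneq gap => <-.
  have [||||] := @gap_length i.+1; try by slia.
  - exact: pij.
  - by move=> k Hk ki; apply: inner_nadj; slia.
  by move=> par _; apply: (gap_theta_absurd il) => //; slia.
have iE : i = l.-1 by slia.
have [pl1cl|Npl1cl] := boolP (adj (p l.-1) (c l)); first exact: last_rung_absurd.
have [||||] := @gap_length d; try by slia.
- by rewrite iE.
- move=> k Hk kd; have [->|kl] := eqVneq k l; first by rewrite iE.
  by apply: inner_nadj; slia.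
Qed.

End FirstGap.

Lemma middle_nbr_absurd : False.
Proof.
have ex_gap : exists i, (0 < i) && ((i == l) || ~~ adj (p i) (c i.+1)).
  by exists l; rewrite eqxx; slia.
case: (ex_minnP ex_gap) => e1 /andP[e10 He1] e1_min.
have e1l : e1 <= l by apply: e1_min; rewrite eqxx; slia.
have rungs k : 0 < k < e1 -> adj (p k) (c k.+1).
  by move=> Hk; apply/negPn/negP => no_rung; have := e1_min k; rewrite no_rung orbT; slia.
have [e1E|e1E] := eqVneq e1 l; first by apply: all_rungs_absurd; rewrite -e1E.
case: e1 e10 He1 e1_min e1l rungs e1E => // e _ gap _ el rungs e1E.
rewrite (negbTE e1E) /= in gap.
pose beyond k := (e < k) && [exists j : 'I_n, (e < j) && adj (p k) (c j)].
have beyondI k j : e < k -> e < j < n -> adj (p k) (c j) -> beyond k.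
  move=> ek /andP[ej jn] pj; rewrite /beyond ek /=.
  by apply/existsP; exists (Ordinal jn); rewrite /= ej.
have beyond_l1 : beyond l.-1 by apply: (beyondI _ d) => //; slia.
case: (ex_minnP (ex_intro (fun k => is_true (beyond k)) l.-1 beyond_l1)) => i.
move=> /andP[ei /existsP[j /andP[ej pij]]] i_min.
have il := i_min _ beyond_l1.
apply: (@first_gap_absurd e i _ _ _ gap _ j); rewrite ?ej ?ltn_ord //; try slia.
move=> t k Ht Hk; apply/negP => ptk; have := i_min t (beyondI t k _ Hk ptk).
by slia.
Qed.

End MiddleNbr.

Lemma isometry_step_absurd : False.
Proof.
apply: no_middle_nbr_absurd => i j Hi jn; apply/negP => pij.
have [dE d2n jE] := middle_nbr Hi jn pij.
by rewrite jE in pij; apply: middle_nbr_absurd dE d2n _ Hi pij.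
Qed.

End IsometryStep.

Lemma isometry (T : finType) (adj : rel T) (side : T -> bool) :
  symmetric adj -> (forall x y, adj x y -> side x != side y) ->
  forall c n (A : {pred T}), smallest_unbalanced adj c n -> theta_free adj side -> tent_free adj ->
  (forall i, c i \in A) ->
  (forall v, v \in A -> (forall k, v != c k) -> ~ major adj c n v) ->
  forall l i d, 0 < d < n -> walkb (restrict adj A) l (c i) (c (i + d)) -> long_walk n d l.
Proof.
move=> adjC bip c n A Cm TF TNF cA minor l.
have [N] := ubnP l; elim: N l => // N IH l lN i d dn walk_c.
have [n5 n4 Hc cmin] := Cm.
have half i' d' : 0 < d' -> d'.*2 <= n -> walkb (restrict adj A) l (c i') (c (i' + d')) ->
    long_walk n d' l.
  move=> d0 dn' /walkbP[x [x0 xl xS]]; apply/negPn/negP => short.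
  have l0 : 0 < l.
    rewrite lt0n; apply: contraTneq d0 => l0; move: xl; rewrite l0 x0 => /eqP.
    by apply: contraTN => d0; apply: (hole_neq Hc); slia.
  have xA j : j <= l -> x j \in A.
    by case: j => [|j] jl; [have /and3P[] := xS 0 l0 | have /and3P[] := xS j jl].
  have [|y [m [ml y0 ym Hy [_ yA]]]] := @walk_induced_path _ adj A x l.
    by split=> j Hj; [case/and3P: (xS j Hj) | apply: xA; slia].
  apply: (@isometry_step_absurd _ adj side adjC bip (fun k => c (i' + k)) n A d' m y) => //.
  - exact: smallest_unbalanced_shift.
  - move=> v vA off [a [b [e [? ? ? [? ? ?]]]]]; apply: (minor v) => //.
      move=> k; have [k' [Hk <-]] := hole_index_window Hc i' k ltac:(slia).
      by have := off (k' - i'); rewrite subnKC //; slia.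
    by exists (i' + a), (i' + b), (i' + e); split=> //; slia.
  - by move=> l' j e l'm de; rewrite addnA; apply: IH => //; slia.
  - by rewrite y0 x0 addn0.
  - by rewrite ym xl.
  - move=> j jm; have [->|j0] := posnP j; first by rewrite y0 xA.
    have [->|jm'] := eqVneq j m; first by rewrite ym xA.
    by apply: yA; slia.
  - by move: short; rewrite /long_walk; case: eqP => _; slia.
have [le|gt] := leqP d.*2 n; first by apply: half walk_c; slia.
have := half (i + d) (n - d) ltac:(slia) ltac:(slia); rewrite -addnA subnKC; last by slia.
rewrite (hole_period Hc) => /(_ (walkbC (restrictC adjC _) walk_c)); rewrite /long_walk.
by clear -dn gt; case: eqP; case: eqP; slia.
Qed.
(** * Detecting clean holes *)

Section PathChains.
Variables (T : finType) (adj : rel T).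
Hypothesis adjC : symmetric adj.

Lemma shortest_walk_induced_path (P : {pred T}) x l :
  (forall i, i < l -> restrict adj P (x i) (x i.+1)) ->
  (forall k, k < l -> ~~ walkb (restrict adj P) k (x 0) (x l)) -> induced_path adj x l.
Proof.
move=> xS xmin i j ij; have l0 : 0 < l by slia.
have seg a b : a <= b <= l -> walkb (restrict adj P) (b - a) (x a) (x b).
  by move=> ab; apply: walkb_segment => [|k Hk]; [slia | apply: xS; slia].
have xP k : k <= l -> x k \in P.
  by case: k => [|k] kl; [have /and3P[] := xS 0 l0 | have /and3P[] := xS k kl].
have shortcut d : walkb (restrict adj P) d (x i) (x j) -> j <= i + d.
  move=> W; have := walkb_cat (walkb_cat (seg 0 i ltac:(slia)) W) (seg j l ltac:(slia)).
  by apply: contraTT => ?; apply: xmin; slia.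
split; first by apply/eqP => E; have := shortcut 0; rewrite /= E eqxx => /(_ isT); slia.
have [->|ji] := eqVneq j i.+1; first by have /and3P[] := xS i ltac:(slia).
apply/negbTE/negP => xij; have := shortcut 1.
have -> : walkb (restrict adj P) 1 (x i) (x j).
  by apply/existsP; exists (x j); rewrite /= eqxx andbT /restrict xij !xP //; slia.
by move/(_ isT); slia.
Qed.

Lemma ltn_sumP (a : nat -> nat) K m : m < \sum_(k < K) a k ->
  exists k t, [/\ k < K, t < a k & m = \sum_(j < k) a j + t].
Proof.
elim: K => [|K IH]; first by rewrite big_ord0.
rewrite big_ord_recr /=; case: (ltnP m (\sum_(k < K) a k)) => C Hm.
  by have [k [t [Hk Ht ->]]] := IH C; exists k, t; split=> //; apply: ltnW.
by exists K, (m - \sum_(k < K) a k); rewrite ltnSn subnKC // ltn_subLR.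
Qed.

Lemma induced_path_chain (y : nat -> nat -> T) (a : nat -> nat) K :
  (forall k, k <= K -> induced_path adj (y k) (a k)) ->
  (forall k, k < K -> y k (a k) = y k.+1 0) ->
  (forall k k' s t, k < k' <= K -> s < a k -> 0 < t <= a k' ->
    y k s != y k' t /\ ~~ adj (y k s) (y k' t)) ->
  exists z, induced_path adj z (\sum_(k < K.+1) a k) /\
    forall k t, k <= K -> t <= a k -> z (\sum_(j < k) a j + t) = y k t.
Proof.
elim: K => [|K IH] Hy joint far.
  exists (y 0); rewrite big_ord_recr big_ord0 /= add0n; split; first exact: Hy.
  by move=> k t; rewrite leqn0 => /eqP ->; rewrite big_ord0.
have [k Hk|k Hk|k k' s t Hk|z [Hz zE]] := IH.
- by apply: Hy; slia.
- by apply: joint; slia.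
- by apply: far; slia.
have zL : z (\sum_(k < K.+1) a k) = y K.+1 0.
  by rewrite big_ord_recr /= zE // joint.
eexists; split.
  rewrite big_ord_recr; apply: induced_path_cat Hz (Hy K.+1 (leqnn _)) zL _ => i t Hi Ht.
  have [k [s [Hk Hs ->]]] := ltn_sumP Hi.
  by rewrite zE; [apply: far; slia | slia..].
move=> k t; rewrite leq_eqVlt => /predU1P[-> tl|kK tk] /=.
  case: leqP => C; last by rewrite addKn.
  have -> : t = 0 by slia.
  by rewrite addn0.
have sum_le : \sum_(j < k.+1) a j <= \sum_(j < K.+1) a j.
  by rewrite -!(big_mkord xpredT a) (big_cat_nat (leq0n _) kK) leq_addr.
by move: sum_le; rewrite big_ord_recr /= => sum_le; rewrite ifT ?zE //; slia.
Qed.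

End PathChains.

Section HoleFrame.
Variables (T : finType) (adj : rel T) (side : T -> bool).
Hypothesis adjC : symmetric adj.
Hypothesis bip : forall x y, adj x y -> side x != side y.

Notation induced_path := (induced_path adj).
Notation hole := (hole adj).
Notation smallest_unbalanced := (smallest_unbalanced adj).

Definition in_sector (A : {pred T}) (x : 'I_5 -> T) (a : 'I_5 -> nat) i v : Prop :=
  exists j1 j2, [/\ j1 + j2 = a i, 0 < j2, walkb (restrict adj A) j1 (x i) v
                  & walkb (restrict adj A) j2 v (x (ordS i))].

(* With five sectors, two consecutive ones are shorter than half of the hole, so that
   [isometry] bounds the distances between them. *)
Record hole_frame (A : {pred T}) (x : 'I_5 -> T) (a : 'I_5 -> nat) : Prop := HoleFrame {
  hole_frame_long : forall i, 1 < a i;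
  hole_frame_walk : forall i, walkb (restrict adj A) (a i) (x i) (x (ordS i));
  hole_frame_shortest : forall i b, b < a i -> ~~ walkb (restrict adj A) b (x i) (x (ordS i));
  hole_frame_next : forall i v v', in_sector A x a i v -> in_sector A x a (ordS i) v' ->
    v != v' /\ (adj v v' -> v' = x (ordS i));
  hole_frame_skip : forall i v v', in_sector A x a i v -> in_sector A x a (ordS (ordS i)) v' ->
    v != v' /\ ~~ adj v v';
  hole_frame_length : (\sum_i a i) %% 4 = 2
}.

Section HoleFrameSound.
Variables (A : {pred T}) (x : 'I_5 -> T) (a : 'I_5 -> nat).
Hypothesis F : hole_frame A x a.

Lemma hole_frame_path i : exists y, [/\ induced_path y (a i), y 0 = x i, y (a i) = x (ordS i)
  & forall t, t < a i -> in_sector A x a i (y t)].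
Proof.
have /walkbP[y [y0 ya yS]] := hole_frame_walk F i.
have y_walk j k : j <= k <= a i -> walkb (restrict adj A) (k - j) (y j) (y k).
  by move=> jk; apply: walkb_segment => [|t Ht]; [slia | apply: yS; slia].
exists y; split=> // [|t ta].
  by apply: shortest_walk_induced_path yS _; rewrite y0 ya; apply: hole_frame_shortest.
exists t, (a i - t); rewrite -y0 -ya; split; try slia.
  by have := y_walk 0 t ltac:(slia); rewrite subn0.
by apply: y_walk; slia.
Qed.

(* The paths between consecutive corners, indexed by the natural numbers modulo 5. *)
Section Sectors.
Variables (y : nat -> nat -> T) (b : nat -> nat).
Hypotheses (y5 : forall k, y (k + 5) = y k) (b5 : forall k, b (k + 5) = b k).
Hypotheses (b1 : forall k, 1 < b k) (Hy : forall k, induced_path (y k) (b k)).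
Hypothesis joint : forall k, y k (b k) = y k.+1 0.
Hypothesis near : forall k s t, s < b k -> 0 < t < b k.+1 ->
  y k s != y k.+1 t /\ ~~ adj (y k s) (y k.+1 t).
Hypothesis skip : forall k s t, s < b k -> t < b k.+2 ->
  y k s != y k.+2 t /\ ~~ adj (y k s) (y k.+2 t).

Lemma sector_skip3 k s t : s < b k -> t < b k.+3 -> y k s != y k.+3 t /\ ~~ adj (y k s) (y k.+3 t).
Proof.
move=> Hs Ht; rewrite eq_sym adjC -(y5 k) addnC.
by apply: skip => //; rewrite -[k.+3.+2]/(5 + k) addnC b5.
Qed.

Lemma sectors_apart k k' s t : k < k' <= 3 -> s < b k -> 0 < t <= b k' ->
  y k s != y k' t /\ ~~ adj (y k s) (y k' t).
Proof.
move=> Hk Hs Ht; have [kE|lt] := eqVneq t (b k'); last first.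
  have [kE|[kE|kE]] : k' = k.+1 \/ k' = k.+2 \/ k' = k.+3 by slia.
  - by rewrite kE; apply: near; rewrite -?kE; slia.
  - by rewrite kE; apply: skip; rewrite -?kE; slia.
  - by rewrite kE; apply: sector_skip3; rewrite -?kE; slia.
rewrite kE joint; have [kE2|[kE2|kE2]] : k' = k.+1 \/ k' = k.+2 \/ k' = k.+3 by slia.
- by rewrite kE2; apply: skip => //; apply: ltnW.
- by rewrite kE2; apply: sector_skip3 => //; apply: ltnW.
have [k0 k'3] : k = 0 /\ k' = 3 by slia.
rewrite k0 k'3 in Hs *; have [->|s0] := posnP s; last first.
  rewrite eq_sym adjC -(y5 0); apply: near; first exact: ltnW.
  by rewrite (b5 0); slia.
have y50 : y 0 0 = y 4 (b 4) by rewrite joint -(y5 0).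
have [ne adj4] := @Hy 4 0 (b 4) (ltac:(have := b1 4; slia)).
by rewrite y50 eq_sym adjC ne adj4; have := b1 4; slia.
Qed.

Lemma hole_of_sectors : exists h, hole h (\sum_(k < 5) b k).
Proof.
have [k _|k _|k k' s t|z [Hz zE]] := @induced_path_chain _ adj y b 3.
- exact: Hy.
- exact: joint.
- exact: sectors_apart.
have zL : z (\sum_(k < 4) b k) = y 4 0.
  by rewrite big_ord_recr /= zE // joint.
have z0 : z 0 = y 4 (b 4).
  by rewrite joint (y5 0); have := zE 0 0 isT isT; rewrite big_ord0.
have L1 : 1 < \sum_(k < 4) b k by rewrite big_ord_recr /=; have := b1 3; slia.
have [||||i j Hi Hj|h [Hh _ _]] := hole_of_two_paths adjC Hz (induced_path_rev adjC (@Hy 4)).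
- by rewrite subn0.
- by rewrite subnn.
- by [].
- exact: b1.
- have [k [s [Hk Hs iE]]] := ltn_sumP (ltac:(slia) : i < \sum_(k < 4) b k).
  have Hj' : 0 < b 4 - j < b 4 by slia.
  rewrite iE zE; [|slia|slia]; move: (b 4 - j) Hj' => t Ht.
  case: k Hk Hs iE => [|[|[|[|//]]]] _ Hs iE.
  + rewrite eq_sym adjC -(y5 0); apply: near; first by slia.
    by move: iE; rewrite big_ord0 add0n (b5 0); slia.
  + by apply: sector_skip3; slia.
  + by apply: skip; slia.
  + exact: near.
by exists h; rewrite big_ord_recr.
Qed.

End Sectors.

Lemma hole_frame_sound : has_unbalanced_hole adj.
Proof.
have /fin_all_exists[y Hy] := hole_frame_path.
pose o k : 'I_5 := iter k (@ordS 5) ord0.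
have o5 k : o (k + 5) = o k by rewrite /o iterD; congr iter; apply/val_inj.
have y_sector k t : t < a (o k) -> in_sector A x a (o k) (y (o k) t).
  by have [_ _ _] := Hy (o k); apply.
have y0 k : y (o k) 0 = x (o k) by have [] := Hy (o k).
have Hy_o k : induced_path (y (o k)) (a (o k)) by have [] := Hy (o k).
have [k|k|k|k|k|k s t Hs Ht|k s t Hs Ht|h Hh] :=
  @hole_of_sectors (fun k => y (o k)) (fun k => a (o k)).
- by rewrite o5.
- by rewrite o5.
- exact: hole_frame_long F _.
- exact: Hy_o.
- by have [_ _ -> _] := Hy (o k); rewrite y0.
- have [ne near] := hole_frame_next F (y_sector k s Hs) (y_sector k.+1 t ltac:(slia)).
  split=> //; apply/negP => /near E; have [] := Hy_o k.+1 0 t ltac:(slia).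
  by rewrite E y0 eqxx.
- exact: (hole_frame_skip F (y_sector k s Hs) (y_sector k.+2 t Ht)).
have sumE : \sum_(k < 5) a (o k) = \sum_i a i.
  by rewrite !big_ord_recl !big_ord0; do !congr addn; congr a; apply/val_inj.
exists (\sum_(k < 5) a (o k)), h; split=> //; last by rewrite sumE; apply: hole_frame_length F.
have : \sum_(k < 5) 2 <= \sum_(k < 5) a (o k) by apply: leq_sum => k _; apply: hole_frame_long F _.
by rewrite sum_nat_const card_ord; slia.
Qed.

End HoleFrameSound.

Definition clean (u um up v vm vp : T) : {pred T} := [pred w |
  (adj w u ==> (w == um) || (w == up)) && (adj w v ==> (w == vm) || (w == vp))].

Lemma clean_hole c n : smallest_unbalanced c n -> 6 < n -> theta_free adj side ->
  exists u um up v vm vp, let A := clean u um up v vm vp in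
    (forall i, c i \in A) /\ forall w, w \in A -> (forall k, w != c k) -> ~ major adj c n w.
Proof.
move=> Cm n6 TF; have [_ _ Hc _] := Cm.
have [i Hi] := majors_common_nbr adjC bip Cm true n6 TF.
have [j Hj] := majors_common_nbr adjC bip Cm false n6 TF.
exists (c i), (c (i + n.-1)), (c i.+1), (c j), (c (j + n.-1)), (c j.+1); split=> [t|w].
  have nbrs k : adj (c t) (c k) ==> (c t == c (k + n.-1)) || (c t == c k.+1).
    apply/implyP; have [k' [Hk <-]] := hole_index_window Hc k t ltac:(slia).
    have [->|kk'] := eqVneq k' k; first by rewrite (negbTE (side_nadj bip (erefl _))).
    rewrite adjC (hole_adj Hc); last by slia.
    case/orP => /eqP E; first by rewrite E eqxx orbT.
    have -> : k' = k + n.-1 by slia.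
    by rewrite eqxx.
  by rewrite inE !nbrs.
rewrite inE => /andP[/implyP Ai /implyP Aj] off Mw; case E: (side w).
  by have := Ai (Hi w off Mw E); rewrite !(negbTE (off _)).
by have := Aj (Hj w off Mw E); rewrite !(negbTE (off _)).
Qed.

Section Pentagon.
Variables (c : nat -> T) (n : nat) (A : {pred T}).
Hypotheses (Hc : hole c n) (n4 : n %% 4 = 2) (n6 : 6 < n) (cA : forall i, c i \in A).
Hypothesis iso : forall l i d, 0 < d < n ->
  walkb (restrict adj A) l (c i) (c (i + d)) -> long_walk n d l.

Let q := n %/ 5.
Let r := n %% 5.
Let pos k := k * q + minn k r.
Let b (i : 'I_5) := q + (i < r).
Let x (i : 'I_5) := c (pos i).

Let nE : n = 5 * q + r. Proof. by rewrite /q /r; slia. Qed.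
Let r5 : r < 5. Proof. by rewrite /r; slia. Qed.
Let q2 : 2 <= q. Proof. by rewrite /q; slia. Qed.
Let b2 i : 1 < b i. Proof. by rewrite /b; slia. Qed.

Let b_pair i j : b i + b j < n - (b i + b j).
Proof.
have qr : r = 0 /\ 4 * q < n \/ 4 * q + 4 < n by rewrite /q /r; clear -n4 n6; slia.
by rewrite /b; clear -qr; case: (ltnP i r) => ?; case: (ltnP j r) => ? /=; slia.
Qed.

Lemma corner_next (i : 'I_5) t : c (pos i + b i + t) = c (pos (ordS i) + t).
Proof.
have posS k : pos k.+1 = pos k + (q + (k < r)).
  by rewrite /pos mulSn /minn; clear; case: (ltnP k r); case: (ltnP k.+1 r) => /=; slia.
have i5 := ltn_ord i; rewrite /b -posS /=.
have [E|ne] := eqVneq i.+1 5; last by rewrite modn_small //; slia.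
have -> : pos i.+1 = n by rewrite E /pos nE /minn; clear -r5; case: ltnP; slia.
by rewrite E modnn addnC (hole_period Hc) /pos mul0n min0n.
Qed.

Let xS (i : 'I_5) : c (pos i + b i) = x (ordS i).
Proof. by have := corner_next i 0; rewrite !addn0. Qed.

Lemma sector_dist i l : walkb (restrict adj A) l (x i) (x (ordS i)) -> b i <= l.
Proof.
rewrite -xS => /iso; have := b_pair i i; have := b2 i; move: (b i) => d; clear -d.
by move=> d2 dn /(_ ltac:(slia)); rewrite /long_walk; case: eqP; slia.
Qed.

Lemma two_sectors_dist i l :
  walkb (restrict adj A) l (x i) (x (ordS (ordS i))) -> b i + b (ordS i) <= l.
Proof.
rewrite -xS -corner_next -addnA => /iso; have := b_pair i (ordS i); have := b2 i.
move: (b i) (b (ordS i)) => d d'; clear -d.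
by move=> d2 dn /(_ ltac:(slia)); rewrite /long_walk; case: eqP; slia.
Qed.

Let walk_adj i v w : in_sector A x b i v -> forall i', in_sector A x b i' w -> adj v w ->
  walkb (restrict adj A) 1 v w.
Proof.
have in_A i1 u : in_sector A x b i1 u -> u \in A.
  by move=> [j1 [[|j2] [_ // _ _ /existsP[t /andP[/and3P[]]]]]].
move=> /in_A vA i' /in_A wA vw; apply/existsP; exists w.
by rewrite /= eqxx andbT; apply/and3P.
Qed.

Lemma pentagon_next i v w : in_sector A x b i v -> in_sector A x b (ordS i) w ->
  v != w /\ (adj v w -> w = x (ordS i)).
Proof.
move=> Sv Sw; have [j1 [j2 [bE j0 v1 v2]]] := Sv; have [k1 [k2 [bE2 k0 w1 w2]]] := Sw.
split=> [|vw].
  by apply/eqP => vw; rewrite vw in v1; have := two_sectors_dist (walkb_cat v1 w2); slia.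
have := two_sectors_dist (walkb_cat (walkb_cat v1 (walk_adj Sv Sw vw)) w2) => dist.
have k10 : k1 = 0 by slia.
by move: w1; rewrite k10 => /eqP.
Qed.

Lemma pentagon_skip i v w : in_sector A x b i v -> in_sector A x b (ordS (ordS i)) w ->
  v != w /\ ~~ adj v w.
Proof.
move=> Sv Sw; have [j1 [j2 [bE j0 v1 v2]]] := Sv; have [k1 [k2 [bE2 k0 w1 w2]]] := Sw.
have walkC := fun j s t => walkbC (k := j) (s := s) (t := t) (restrictC adjC A).
have far k : walkb (restrict adj A) k v w -> 1 < k.
  move=> W; have := two_sectors_dist (walkb_cat (walkb_cat v1 W) (walkC _ _ _ w1)).
  have := two_sectors_dist (walkb_cat (walkb_cat (walkC _ _ _ v2) W) w2).
  by have := b2 (ordS i); slia.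
split; first by apply/eqP => vw; have := far 0; rewrite /= vw eqxx => /(_ isT).
by apply/negP => vw; have := far 1 (walk_adj Sv Sw vw).
Qed.

Lemma pentagon_frame : exists x b, (forall i, b i < #|T|) /\ hole_frame A x b.
Proof.
have cS k : adj (c k) (c k.+1) by apply: hole_adjS Hc _ _; slia.
exists x, b; split=> [i|].
  have := max_card (mem (arc c 0 n)); rewrite card_arc_inj => [|s t _ st].
    by have := b_pair i i; slia.
  by apply: (hole_neq Hc); slia.
split=> //; [|move=> i l lb|exact: pentagon_next|exact: pentagon_skip|].
- move=> i; rewrite -xS -{1}[b i](addKn (pos i)); apply: walkb_segment => [|k _].
    exact: leq_addr.
  by rewrite /restrict cS !cA.
- by apply/negP => /sector_dist; slia.
rewrite -[RHS]n4; congr (_ %% _); rewrite nE /b !big_ord_recl big_ord0 /= /bump /=.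
by clear -r5; slia.
Qed.

End Pentagon.

Lemma hole_frame_complete c n : smallest_unbalanced c n -> 6 < n -> theta_free adj side ->
  tent_free adj -> exists u um up v vm vp x a,
    (forall i, a i < #|T|) /\ hole_frame (clean u um up v vm vp) x a.
Proof.
move=> Cm n6 TF TNF; have [_ n4 Hc _] := Cm.
have [u [um [up [v [vm [vp [cA minor]]]]]]] := clean_hole Cm n6 TF.
exists u, um, up, v, vm, vp.
exact: pentagon_frame Hc n4 n6 cA (isometry adjC bip Cm TF TNF cA minor).
Qed.

End HoleFrame.
(** * Balanced matrices and odd suns *)

Definition has_odd_sun (I J : Type) (r : I -> J -> bool) : Prop :=
  exists l (u : 'I_l -> I) (v : 'I_l -> J), [/\ 3 <= l, odd l &
    forall i j, r (u i) (v j) = (j == i) || (j == ordS i)].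

Lemma val_ordS l (i : 'I_l) : ordS i = (if i.+1 == l then 0 else i.+1) :> nat.
Proof.
rewrite /=; have [->|ne] := eqVneq i.+1 l; first exact: modnn.
by rewrite modn_small // ltn_neqAle ne ltn_ord.
Qed.

Lemma ordS_neq l (i : 'I_l) : 2 <= l -> ordS i != i.
Proof. by move=> l2; rewrite -(inj_eq (@ord_inj l)) val_ordS; case: (eqVneq i.+1 l) => ?; slia. Qed.

Lemma ordS2_neq l (i : 'I_l) : 3 <= l -> ordS (ordS i) != i.
Proof.
move=> l3; have il := ltn_ord i; rewrite -(inj_eq (@ord_inj l)) !val_ordS.
by case: (eqVneq i.+1 l) => ?; case: ifP => ?; slia.
Qed.

Lemma sun_row_inj I J r l (u : 'I_l -> I) (v : 'I_l -> J) : 3 <= l ->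
  (forall i j, r (u i) (v j) = (j == i) || (j == ordS i)) -> injective u.
Proof.
move=> l3 sun i i' uE.
have := sun i' i; rewrite -uE sun eqxx /= => /esym/orP[/eqP //|/eqP iE].
have := sun i' (ordS i); rewrite -uE sun eqxx orbT => /esym/orP[/eqP iE2|/eqP/ordS_inj //].
by have := ordS2_neq i' l3; rewrite -iE iE2 eqxx.
Qed.

Lemma sun_col_inj I J r l (u : 'I_l -> I) (v : 'I_l -> J) : 3 <= l ->
  (forall i j, r (u i) (v j) = (j == i) || (j == ordS i)) -> injective v.
Proof.
move=> l3 sun j j' vE.
have := sun j j'; rewrite -vE sun eqxx /= => /esym/orP[/eqP //|/eqP jE].
have := sun (ord_pred j) j'; rewrite -vE sun ord_predK eqxx orbT => /esym/orP[/eqP iE2|/eqP //].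
have := ordS2_neq (ord_pred j) l3; rewrite ord_predK -jE iE2.
by rewrite eqxx.
Qed.

Lemma two_ones_sun l (B : 'M[bool]_l) : 3 <= l ->
  (forall i j, B i j = (j == i) || (j == ordS i)) -> two_ones_mx B.
Proof.
move=> l3 H; split=> [i|j].
  have -> : [set j | B i j] = [set i; ordS i] by apply/setP => j; rewrite !inE H.
  by rewrite cards2 eq_sym ordS_neq //; slia.
have -> : [set i | B i j] = [set j; ord_pred j].
  apply/setP => i; rewrite !inE H eq_sym; congr (_ || _).
  by apply/eqP/eqP => [->|->]; rewrite ?ordSK ?ord_predK.
by rewrite cards2 -{1}(ord_predK j) ordS_neq //; slia.
Qed.

(* The vertices of a disjoint union of even cycles, whose edges are the orbits of two fixed point
   free involutions. An orbit of the product turns around a cycle in one of its two orientations. *)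
Section TwoInvolutions.
Variables (D : finType) (rho tau : D -> D).
Hypotheses (rhoK : involutive rho) (tauK : involutive tau).
Hypotheses (rhoN : forall d, rho d <> d) (tauN : forall d, tau d <> d).

Definition rotation d := rho (tau d).

Lemma rotation_inj : injective rotation.
Proof. by move=> a b /(inv_inj rhoK)/(inv_inj tauK). Qed.

Let iter_inj n : injective (iter n rotation).
Proof. by elim: n => // n IH a b /rotation_inj/IH. Qed.

Lemma iter_rotation_rho d n : iter n rotation (rho (iter n rotation d)) = rho d.
Proof. by elim: n d => // n IH d; rewrite iterS iterSr IH /rotation rhoK tauK. Qed.

Lemma iter_rotation_neq d n : iter n rotation d <> rho d.
Proof.
have nE : n = n./2 + (odd n + n./2) by rewrite addnCA addnn odd_double_half.
move: (n./2) nE => h nE; rewrite -(iter_rotation_rho d h) nE iterD => /iter_inj.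
case: (odd n) => [/(inv_inj rhoK)/tauN //|/esym/rhoN //].
Qed.

Lemma froot_rho d d' : fconnect rotation d d' -> froot rotation (rho d') = froot rotation (rho d).
Proof.
move=> /iter_findex <-; set n := findex _ _ _; apply/eqP.
rewrite root_connect; last exact/fconnect_sym/rotation_inj.
by rewrite -(iter_rotation_rho d n) fconnect_iter.
Qed.

End TwoInvolutions.

Lemma set2_of_card2 (T : finType) (S : {set T}) a :
  #|S| = 2 -> a \in S -> exists2 b, b != a & S = [set a; b].
Proof.
move=> /eqP/cards2P[x [y [xy ->]]] /set2P[->|->]; first by exists y; rewrite // eq_sym.
by exists x; rewrite // setUC.
Qed.

Lemma odd_fiber (I J : finType) (f : I -> J) :
  odd #|I| -> exists i0, odd #|[set i | f i == f i0]|.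
Proof.
have sum_odd (s : seq J) : odd (\sum_(j <- s) #|[set i | f i == j]|) ->
    exists j, odd #|[set i | f i == j]|.
  elim: s => [|j s IH]; first by rewrite big_nil.
  by rewrite big_cons oddD; case E: (odd #|_|); [exists j | rewrite addFb].
rewrite -sum1_card (partition_big f xpredT) //= => odd_sum.
have [|j oj] := sum_odd (index_enum J).
  congr odd: odd_sum; apply: eq_bigr => j _; rewrite -sum1_card.
  by apply: eq_bigl => i; rewrite inE.
have /card_gt0P[i0] : 0 < #|[set i | f i == j]| by move: oj; case: #|_|.
by rewrite inE => /eqP E; exists i0; rewrite E.
Qed.

Section Darts.
Variables (k : nat) (B : 'M[bool]_k).
Hypothesis HB : two_ones_mx B.

Definition dart := {d : 'I_k * 'I_k | B d.1 d.2}.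
Implicit Types d : dart.

Let row d := (sval d).1.
Let col d := (sval d).2.

Let dart_entry d : B (row d) (col d). Proof. exact: (svalP d). Qed.

Let dart_eq d d' : row d = row d' -> col d = col d' -> d = d'.
Proof.
rewrite /row /col; move=> E1 E2; apply: val_inj => /=.
by case: (val d) (val d') E1 E2 => [a b] [a' b'] /= -> ->.
Qed.

Lemma row_mate d : exists d', [/\ row d' = row d, col d' != col d
  & [set j | B (row d) j] = [set col d; col d']].
Proof.
have [|j nj rowE] := set2_of_card2 (a := col d) (HB.1 (row d)); first by rewrite inE.
have Bj : B (row d) j by have := set22 (col d) j; rewrite -rowE inE.
by exists (exist _ (row d, j) Bj).
Qed.

Lemma col_mate d : exists d', [/\ col d' = col d, row d' != row d
  & [set i | B i (col d)] = [set row d; row d']].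
Proof.
have [|i ni colE] := set2_of_card2 (a := row d) (HB.2 (col d)); first by rewrite inE.
have Bi : B i (col d) by have := set22 (row d) i; rewrite -colE inE.
by exists (exist _ (i, col d) Bi).
Qed.

Section Mates.
Variables rho tau : dart -> dart.
Hypothesis Hrho : forall d, [/\ row (rho d) = row d, col (rho d) != col d
  & [set j | B (row d) j] = [set col d; col (rho d)]].
Hypothesis Htau : forall d, [/\ col (tau d) = col d, row (tau d) != row d
  & [set i | B i (col d)] = [set row d; row (tau d)]].

Let row_cases d d' : row d' = row d -> d' = d \/ d' = rho d.
Proof.
move=> E; have [R _ rowE] := Hrho d; have := dart_entry d'.
have -> : B (row d') (col d') = (col d' \in [set j | B (row d) j]) by rewrite inE E.
by rewrite rowE => /set2P[C|C]; [left | right]; apply: dart_eq; rewrite ?R.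
Qed.

Let col_cases d d' : col d' = col d -> d' = d \/ d' = tau d.
Proof.
move=> E; have [R _ colE] := Htau d; have := dart_entry d'.
have -> : B (row d') (col d') = (row d' \in [set i | B i (col d)]) by rewrite inE E.
by rewrite colE => /set2P[C|C]; [left | right]; apply: dart_eq; rewrite ?R.
Qed.

Let rhoN d : rho d <> d. Proof. by have [_ N _] := Hrho d; move=> E; rewrite E eqxx in N. Qed.
Let tauN d : tau d <> d. Proof. by have [_ N _] := Htau d; move=> E; rewrite E eqxx in N. Qed.

Let rhoK : involutive rho.
Proof.
move=> d; have [|/esym/rhoN //|//] := @row_cases (rho d) d.
by have [] := Hrho d.
Qed.

Let tauK : involutive tau.
Proof.
move=> d; have [|/esym/tauN //|//] := @col_cases (tau d) d.
by have [] := Htau d.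
Qed.

Notation phi := (rotation rho tau).

Let phi_inj : injective phi. Proof. exact: rotation_inj. Qed.

Let orbit_neq_rho d d1 d2 : fconnect phi d d1 -> fconnect phi d d2 -> d1 <> rho d2.
Proof.
move=> c1 c2; rewrite (fconnect_sym phi_inj) in c2.
by have /iter_findex <- := connect_trans c2 c1; apply: iter_rotation_neq.
Qed.

Let row_orbit_inj d : {in fconnect phi d &, injective row}.
Proof. by move=> d1 d2 c1 c2 /row_cases[//|/(orbit_neq_rho c1 c2)]. Qed.

Let col_orbit_inj d : {in fconnect phi d &, injective col}.
Proof.
move=> d1 d2 c1 c2 /col_cases[//|E]; case: (@orbit_neq_rho d (phi d2) d1) => //.
  by apply: connect_trans c2 (fconnect1 _ _).
by rewrite E.
Qed.

Let cycles i := [set froot phi d | d : dart & row d == i].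

Let cycles_row d : cycles (row d) = [set froot phi d; froot phi (rho d)].
Proof.
apply/setP => z; apply/imsetP/set2P => [[d']|].
  by rewrite inE => /eqP/row_cases[->|->] ->; [left | right].
case=> ->; first by exists d; rewrite ?inE.
by exists (rho d) => //; rewrite inE; have [-> _] := Hrho d.
Qed.

(* The orbit of a dart has one element in each row that is met by its cycle. *)
Lemma odd_orbit : odd k -> exists d, odd (order phi d).
Proof.
move=> k_odd; have [|i0 odd_i0] := odd_fiber cycles; first by rewrite card_ord.
have [j0 Bj0] : exists j, B i0 j.
  have /card_gt0P[j] : 0 < #|[set j | B i0 j]| by rewrite HB.1.
  by rewrite inE; exists j.
pose d0 : dart := exist _ (i0, j0) Bj0; exists d0.
rewrite /order -(card_in_imset (@row_orbit_inj d0)); congr odd: odd_i0.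
apply: eq_card => i; rewrite inE (_ : i0 = row d0) //; apply/eqP/imsetP => [E|[d c ->]].
  have : froot phi d0 \in cycles i by rewrite E cycles_row set21.
  case/imsetP => d; rewrite inE => /eqP <- /eqP.
  by rewrite (root_connect (fconnect_sym phi_inj)); exists d.
rewrite !cycles_row (froot_rho rhoK tauK c); congr [set _; _].
by apply/esym/eqP; rewrite root_connect //; apply: fconnect_sym.
Qed.

Lemma orbit_sun d : odd (order phi d) -> has_odd_sun (fun i j => B i j).
Proof.
set l := order phi d => l_odd; pose e (i : 'I_l) := iter i phi d.
have ce i : fconnect phi d (e i) by apply: fconnect_iter.
have e_inj : injective e.
  move=> i i' E; apply/val_inj; have := congr1 (findex phi d) E.
  by rewrite !findex_iter ?ltn_ord.
have eS i : e (ordS i) = phi (e i).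
  rewrite /e val_ordS -iterS; have [->|//] := eqVneq i.+1 l.
  by rewrite iter_order.
have phi_row d' : row (phi d') != row d'.
  by have [-> _ _] := Hrho (tau d'); have [_] := Htau d'.
have l0 : 0 < l by apply: order_gt0.
have l1 : l != 1.
  apply/eqP => E; have := phi_row (e (Ordinal l0)); rewrite -eS.
  by have -> : ordS (Ordinal l0) = Ordinal l0 by [apply/val_inj; rewrite /= E modn1]; rewrite eqxx.
exists l, (fun i => row (e i)), (fun j => col (e (ord_pred j))); split=> // [|i j].
  by move: l_odd l0 l1; slia.
have col_e i' : col (e (ord_pred i')) = col (rho (e i')).
  by rewrite -{2}[i']ord_predK eS /rotation rhoK; have [-> _ _] := Htau (e (ord_pred i')).
have col_eq i1 i2 : (col (e i1) == col (e i2)) = (i1 == i2).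
  by apply/eqP/eqP => [E|->//]; apply/e_inj/(@col_orbit_inj d); rewrite ?inE.
have [_ _ rowE] := Hrho (e i); have -> : B (row (e i)) (col (e (ord_pred j))) =
  (col (e (ord_pred j)) \in [set j | B (row (e i)) j]) by rewrite inE.
rewrite rowE in_set2 -col_e !col_eq orbC; congr (_ || _).
  by apply/eqP/eqP => [/(congr1 (@ordS l))|->//]; rewrite !ord_predK.
by apply/eqP/eqP => [<-|->]; rewrite ?ord_predK ?ordSK.
Qed.

End Mates.

Lemma two_ones_odd_sun : odd k -> has_odd_sun (fun i j => B i j).
Proof.
move=> k_odd; have /fin_all_exists[rho Hrho] := row_mate.
have /fin_all_exists[tau Htau] := col_mate.
by have [d /(orbit_sun Hrho Htau)] := odd_orbit Hrho Htau k_odd.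
Qed.

End Darts.

Lemma balanced_mx_odd_sun m n (A : 'M[bool]_(m, n)) :
  balanced_mx A <-> ~ has_odd_sun (fun i j => A i j).
Proof.
split=> [balanced [l [u [v [l3 lo sun]]]]|no_sun k f g ko fI gI].
  apply: (balanced l u v lo) => //.
  - exact: sun_row_inj sun.
  - exact: sun_col_inj sun.
  - by apply: two_ones_sun => // i j; rewrite mxE.
move=> /two_ones_odd_sun-/(_ ko)[l [u [v [l3 lo sun]]]].
apply: no_sun; exists l, (fun i => f (u i)), (fun j => g (v j)); split=> // i j.
by have := sun i j; rewrite mxE.
Qed.

(** * Square roots and maximal cliques *)

Section Squares.
Variables (T : finType).
Implicit Types (e h : rel T) (K S : {set T}).

Lemma cliqueP e K : reflect {in K &, forall x y, x != y -> e x y} (clique e K).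
Proof.
apply: (iffP forall_inP) => [H x y xK yK xy|H x xK].
  by have /forall_inP/(_ y yK)/implyP := H x xK; apply.
by apply/forall_inP => y yK; apply/implyP; apply: H.
Qed.

Lemma independentP e S : reflect {in S &, forall x y, ~~ e x y} (independent e S).
Proof.
apply: (iffP forall_inP) => [H x y xS yS|H x xS]; first by have /forall_inP := H x xS; apply.
by apply/forall_inP => y yS; apply: H.
Qed.

Definition closed_adj e x y : bool := (x == y) || e x y.

Lemma squareE h x y : simple_graph h ->
  square h x y = (x != y) && [exists z, closed_adj h x z && closed_adj h y z].
Proof.
move=> [hC hI].
have walk0 : has_walk h x y 0 = (x == y).
  by apply/existsP/idP => [[p]|xy]; [rewrite (tuple0 p) | exists [tuple]].
have walk1 : has_walk h x y 1 = h x y.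
  apply/existsP/idP => [[p]|xy]; last by exists [tuple y]; rewrite /= xy eqxx.
  by case/tupleP: p => z p; rewrite (tuple0 p) /= andbT => /andP[xz /eqP <-].
have walk2 : has_walk h x y 2 = [exists z, h x z && h y z].
  apply/existsP/existsP => [[p]|[z /andP[xz yz]]].
    case/tupleP: p => z p; case/tupleP: p => w p; rewrite (tuple0 p) /= andbT.
    by move=> /andP[/andP[xz zw] /eqP <-]; exists z; rewrite xz hC.
  by exists [tuple z; y]; rewrite /= xz hC yz eqxx.
rewrite /square /at_distance walk2.
have -> : [forall j : 'I_2, ~~ has_walk h x y j] = (x != y) && ~~ h x y.
  apply/forallP/andP => [no_walk|[ne nadj] [[|[|//]] Hj]]; rewrite /= ?walk0 ?walk1 //.
  by have := no_walk ord0; have := no_walk (lift ord0 ord0); rewrite /= walk0 walk1.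
have [->|xy] := eqVneq x y; first by rewrite hI.
have [hxy|Nhxy] /= := boolP (h x y).
  by apply/esym/existsP; exists y; rewrite /closed_adj hxy eqxx orbT.
rewrite andbT; apply: eq_existsb => z; rewrite /closed_adj; have [<-|xz] := eqVneq x z.
  by rewrite hI hC (negbTE Nhxy) eq_sym (negbTE xy).
by have [<-|yz] := eqVneq y z; rewrite /= ?hI ?(negbTE Nhxy).
Qed.

Definition edge_cliques e : {set {set T}} := [set K in max_cliques e | 1 < #|K|].

Lemma max_cliqueP e K : reflect (clique e K /\ forall K', clique e K' -> K \subset K' -> K' = K)
  (K \in max_cliques e).
Proof. by rewrite inE; apply: maxsetP. Qed.

Lemma clique_max e K : clique e K -> exists2 K', K' \in max_cliques e & K \subset K'.
Proof. by move=> /maxset_exists[K' M sub]; exists K' => //; rewrite inE. Qed.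

Lemma clique2 e x y : symmetric e -> e x y -> clique e [set x; y].
Proof.
by move=> eC xy; apply/cliqueP => a b /set2P[]-> /set2P[]->; rewrite ?eqxx // eC.
Qed.

Lemma edge_clique e x y : simple_graph e -> e x y ->
  exists2 K, K \in edge_cliques e & (x \in K) && (y \in K).
Proof.
move=> [eC eI] xy; have [K KM] := clique_max (clique2 eC xy).
rewrite subUset !sub1set => /andP[xK yK]; exists K; rewrite ?xK //.
rewrite inE KM; apply/card_gt1P; exists x, y; split=> //.
by apply: contraTneq xy => ->; rewrite eI.
Qed.

Lemma clique_adj e K x y : K \in edge_cliques e -> x \in K -> y \in K -> x != y -> e x y.
Proof. by rewrite inE => /andP[/max_cliqueP[/cliqueP H _] _]; apply: H. Qed.

Section SplitGraph.
Variables (h : rel T) (K0 : {set T}).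
Hypotheses (hS : simple_graph h) (K0_clique : clique h K0) (K0_ind : independent h (~: K0)).

Definition cross_adj x w : bool := [&& x \notin K0, w \in K0 & h x w].

Lemma outer_nbr x z : x \notin K0 -> h x z -> z \in K0.
Proof. by move=> xN; apply: contraTT => zN; apply: (independentP _ _ K0_ind); rewrite inE. Qed.

Lemma induced_sun_of_cross_adj : has_odd_sun cross_adj ->
  exists l, [/\ 3 <= l, odd l & induced_subgraph (@sun_adj l) h].
Proof.
move=> [l [u [v [l3 lo sun]]]]; exists l; split=> //; have [hC hI] := hS.
have uN i : u i \notin K0 by have := sun i i; rewrite eqxx => /and3P[].
have vK i : v i \in K0 by have := sun i i; rewrite eqxx => /and3P[].
have adj_uv i j : h (u i) (v j) = (j == i) || (j == ordS i) by rewrite -sun /cross_adj uN vK.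
have uv i j : u i != v j by apply: contraNneq (uN i) => ->.
exists (fun a => match a with inl i => u i | inr j => v j end).
split=> [[i|i] [j|j] eq_im|[i|i] [j|j]] /=.
- by rewrite (sun_row_inj l3 sun eq_im).
- by have := uv i j; rewrite eq_im eqxx.
- by have := uv j i; rewrite eq_im eqxx.
- by rewrite (sun_col_inj l3 sun eq_im).
- by apply/negbTE; apply: contra (uN j) => /outer_nbr; apply.
- exact: adj_uv.
- by rewrite hC adj_uv.
have [->|ij] := eqVneq i j; first by rewrite hI.
apply: (cliqueP _ _ K0_clique) => //; apply: contra_neq ij; exact: sun_col_inj l3 sun _ _.
Qed.

Lemma cross_adj_of_induced_sun l : 3 <= l -> odd l -> induced_subgraph (@sun_adj l) h ->
  has_odd_sun cross_adj.
Proof.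
move=> l3 lo [phi [phi_inj Hphi]].
have in_K0 a b : phi a \in K0 -> phi b \in K0 -> a != b -> sun_adj a b.
  move=> aK bK ab; rewrite -Hphi; apply: (cliqueP _ _ K0_clique) => //.
  by rewrite (inj_eq phi_inj).
have vK j : phi (inr j) \in K0.
  apply/negPn/negP => vN; have [hC _] := hS.
  have uK i : (j == i) || (j == ordS i) -> phi (inl i) \in K0.
    by move=> ji; apply: (outer_nbr vN); rewrite hC Hphi.
  have := in_K0 _ _ (uK j _) (uK (ord_pred j) _).
  rewrite ord_predK !eqxx orbT => /(_ isT isT)/implyP; rewrite implybF negbK => /eqP[E].
  by have := ordS_neq (ord_pred j) (ltac:(slia) : 2 <= l); rewrite ord_predK -E eqxx.
have uN i : phi (inl i) \notin K0.
  apply/negP => uK; have := in_K0 _ _ uK (vK (ordS (ordS i))) isT.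
  rewrite /= (negbTE (ordS2_neq i l3)) (negbTE (ordS_neq _ _)) //; slia.
exists l, (fun i => phi (inl i)), (fun j => phi (inr j)); split=> // i j.
by rewrite /cross_adj uN vK Hphi.
Qed.

Lemma split_odd_sun_free : odd_sun_free h <-> ~ has_odd_sun cross_adj.
Proof.
split=> [F /induced_sun_of_cross_adj[l [l3 lo]]|N l l3 lo /(cross_adj_of_induced_sun l3 lo) //].
exact: F.
Qed.

End SplitGraph.

Definition clique_odd_sun e : Prop :=
  has_odd_sun (fun x K => (x \in K) && (K \in edge_cliques e)).

Section SplitRoot.
Variables (e h : rel T) (K0 : {set T}).
Hypotheses (hS : simple_graph h) (eh : e =2 square h).
Hypotheses (K0_clique : clique h K0) (K0_ind : independent h (~: K0)) (F : odd_sun_free h).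

Let closed_nbh v := [set x | closed_adj h x v].

Lemma closed_nbh_clique v : clique e (closed_nbh v).
Proof.
apply/cliqueP => x y; rewrite !inE => xv yv xy.
by rewrite eh squareE // xy; apply/existsP; exists v; rewrite xv.
Qed.

Lemma sub_closed_nbh v : v \in K0 -> K0 \subset closed_nbh v.
Proof.
move=> vK; apply/subsetP => x xK; rewrite inE /closed_adj; case: eqVneq => //= xv.
exact: (cliqueP _ _ K0_clique).
Qed.

Lemma root_common_nbr x y : e x y -> exists2 v, v \in K0 & closed_adj h x v && closed_adj h y v.
Proof.
rewrite eh squareE // => /andP[xy /existsP[z /andP[xz yz]]].
have [zK|zN] := boolP (z \in K0); first by exists z; rewrite ?xz.
have [hC _] := hS; have outer w : closed_adj h w z -> w != z -> h w z /\ w \in K0.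
  by rewrite /closed_adj => /predU1P[->|wz _]; rewrite ?eqxx // (outer_nbr K0_ind zN) // hC.
have [xE|xz'] := eqVneq x z.
  have [|yz' yK] := outer y yz; first by rewrite -xE eq_sym.
  by exists y; rewrite // /closed_adj eqxx xE hC yz' orbT.
have [xz'' xK] := outer x xz xz'; exists x; rewrite // {1}/closed_adj eqxx /=.
have [->|yz'] := eqVneq y z; first by rewrite /closed_adj hC xz'' orbT.
have [_ yK] := outer y yz yz'.
by have /subsetP/(_ y yK) := sub_closed_nbh xK; rewrite inE.
Qed.

(* As there is no 3-sun, vertices with pairwise common neighbours in K0 have a common one. *)
Lemma edge_clique_closed_nbh K : K \in edge_cliques e -> exists2 v, v \in K0 & K = closed_nbh v.
Proof.
move=> KE; have /andP[/max_cliqueP[_ Kmax] K_gt1] : (K \in max_cliques e) && (1 < #|K|).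
  by rewrite inE in KE.
have /card_gt1P[x0 [y0 [x0K y0K xy0]]] := K_gt1.
have pair x y : x \in K -> y \in K -> x != y ->
    exists v, ((v \in K0) && closed_adj h x v) && ((v \in K0) && closed_adj h y v).
  move=> xK yK xy; have [v vK /andP[xv yv]] := root_common_nbr (clique_adj KE xK yK xy).
  by exists v; rewrite vK xv.
have [x y xK yK|x1 x2 x3 j1 j2 j3 _ _ _||v Hv] :=
  @helly_of_triples _ _ (fun x v => (v \in K0) && closed_adj h x v) K.
- have [<-|xy] := eqVneq x y; last exact: pair.
  have [z zK xz] : exists2 z, z \in K & x != z.
    by have [->|xx] := eqVneq x x0; [exists y0 | exists x0].
  by have [v /andP[xv _]] := pair x z xK zK xz; exists v; rewrite xv.
- case/and5P=> /andP[j2K a12] /andP[j3K a13] /andP[j1K a21] /andP[_ a23].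
  move=> /andP[/andP[_ a31] /andP[_ a32]]; rewrite j1K j2K j3K /=.
  apply/negPn/negP => /norP[n11 /norP[n22 n33]].
  have outer x j : j \in K0 -> ~~ closed_adj h x j -> x \notin K0.
    move=> jK; apply: contra => xK; have /subsetP/(_ x xK) := sub_closed_nbh jK.
    by rewrite inE.
  have x1N := outer _ _ j1K n11; have x2N := outer _ _ j2K n22; have x3N := outer _ _ j3K n33.
  have cross x j : x \notin K0 -> j \in K0 -> cross_adj h K0 x j = closed_adj h x j.
    by move=> xN jK; rewrite /cross_adj /closed_adj xN jK; case: eqVneq xN => // ->; rewrite jK.
  apply: (proj1 (split_odd_sun_free hS K0_clique K0_ind) F).
  exists 3, (nth x1 [:: x3; x1; x2]), (nth j1 [:: j1; j2; j3]); split=> //.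
  by move=> [[|[|[|//]]] Hi] [[|[|[|//]]] Hj]; rewrite /= cross // ?a12 ?a13 ?a21 ?a23 ?a31 ?a32
    ?(negbTE n11) ?(negbTE n22) ?(negbTE n33).
- by apply/set0Pn; exists x0.
exists v; first by have /andP[] := Hv x0 x0K.
apply/esym/Kmax; first exact: closed_nbh_clique.
by apply/subsetP => y yK; rewrite inE; have /andP[_ ->] := Hv y yK.
Qed.

Lemma root_no_clique_odd_sun : ~ clique_odd_sun e.
Proof.
move=> [l [u [v [l3 lo sun]]]].
have vE j : v j \in edge_cliques e by have := sun j j; rewrite eqxx => /andP[].
have /fin_all_exists2[w wK vw] j : exists2 x, x \in K0 & v j = closed_nbh x.
  exact: edge_clique_closed_nbh.
have uN i : u i \notin K0.
  apply/negP => uK; have := sun i (ordS (ordS i)).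
  rewrite (negbTE (ordS2_neq i l3)) (negbTE (ordS_neq _ _)); last by slia.
  rewrite vE andbT vw => /negbT/negP; apply.
  exact: (subsetP (sub_closed_nbh (wK _))).
apply: (proj1 (split_odd_sun_free hS K0_clique K0_ind) F).
exists l, u, w; split=> // i j; rewrite -sun vE andbT vw inE /cross_adj /closed_adj uN wK.
by case: eqVneq => // E; have := uN i; rewrite E wK.
Qed.

Lemma root_count : #|edge_cliques e| <= #|\bigcap_(K in edge_cliques e) K|.
Proof.
apply: (@leq_trans #|K0|).
  apply: leq_trans (leq_imset_card closed_nbh K0); apply: subset_leq_card.
  by apply/subsetP => K /edge_clique_closed_nbh[v vK ->]; apply/imsetP; exists v.
apply: subset_leq_card; apply/subsetP => x xK; apply/bigcapP => K /edge_clique_closed_nbh[v vK ->].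
exact: (subsetP (sub_closed_nbh vK)).
Qed.

End SplitRoot.

Lemma edgeless_osf_root e : simple_graph e -> (forall x y, ~~ e x y) -> has_osf_split_root e.
Proof.
move=> eS e0; exists e; split=> //.
- exists set0; split; first by apply/cliqueP => x y; rewrite inE.
  by apply/independentP => x y _ _; apply: e0.
- move=> l l3 lo [phi [_ H]]; have l0 : 0 < l by slia.
  have := H (inl (Ordinal l0)) (inr (Ordinal l0)).
  by rewrite (negbTE (e0 _ _)) /sun_adj eqxx.
- move=> x y; rewrite squareE // (negbTE (e0 _ _)); apply/esym/negP => /andP[xy /existsP[z]].
  by rewrite /closed_adj !(negbTE (e0 _ _)) !orbF => /andP[/eqP xz /eqP yz];
  rewrite xz yz eqxx in xy.
Qed.

Lemma injection_of_card (I J : finType) (E : {set I}) (U : {set J}) :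
  #|E| <= #|U| -> E != set0 -> exists2 f, {in E, forall i, f i \in U} & {in E &, injective f}.
Proof.
move=> EU /set0Pn[i0 i0E]; have E0 : 0 < #|E| by apply/card_gt0P; exists i0.
have /card_gt0P[x0 _] := leq_trans E0 EU; rewrite !cardE in EU.
have index_lt i : i \in E -> index i (enum E) < size (enum U).
  by move=> iE; apply: leq_trans EU; rewrite index_mem mem_enum.
exists (fun i => nth x0 (enum U) (index i (enum E))) => [i iE|i j iE jE /eqP].
  by rewrite -mem_enum mem_nth ?index_lt.
rewrite nth_uniq ?index_lt ?enum_uniq // => /eqP Eij.
by rewrite -[i](nth_index i0 (s := enum E)) ?mem_enum // Eij nth_index ?mem_enum.
Qed.

(* Every edge clique is attached to a vertex of its own in the common intersection, which
   becomes the clique of the split graph. *)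
Section BuildRoot.
Variables (e : rel T) (center : {set T} -> T).
Hypothesis eS : simple_graph e.
Let U := \bigcap_(K in edge_cliques e) K.
Hypothesis center_U : {in edge_cliques e, forall K, center K \in U}.
Hypothesis center_inj : {in edge_cliques e &, injective center}.

Let attached x y := [exists K in edge_cliques e, (center K == y) && (x \in K)].

Let root_adj : rel T := fun x y =>
  (x != y) && [|| (x \in U) && (y \in U), attached x y | attached y x].

Let sub_U K x : K \in edge_cliques e -> x \in U -> x \in K.
Proof. by move=> KE /bigcapP; apply. Qed.

Let attachedU x y : attached x y -> y \in U.
Proof. by case/exists_inP=> K KE /andP[/eqP <- _]; apply: center_U. Qed.

Lemma root_adj_simple : simple_graph root_adj.
Proof.
split=> [x y|x]; last by rewrite /root_adj eqxx.
by rewrite /root_adj eq_sym [(y \in U) && _]andbC [attached x y || _]orbC.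
Qed.

Lemma root_adj_clique : clique root_adj U.
Proof. by apply/cliqueP => x y xU yU xy; rewrite /root_adj xy xU yU. Qed.

Lemma root_adj_outer x y : x \notin U -> root_adj x y = attached x y.
Proof.
move=> xN; rewrite /root_adj (negbTE xN) /= (negbTE (contra (@attachedU y x) xN)) orbF.
case: eqVneq => //= <-; apply/esym/negbTE.
exact: contra (@attachedU x x) xN.
Qed.

Lemma root_adj_independent : independent root_adj (~: U).
Proof.
apply/independentP => x y; rewrite !inE => xN yN; rewrite root_adj_outer //.
exact: contra (@attachedU x y) yN.
Qed.

Lemma root_adj_odd_sun_free : ~ clique_odd_sun e -> odd_sun_free root_adj.
Proof.
move=> no_sun.
apply/(split_odd_sun_free root_adj_simple root_adj_clique root_adj_independent).
move=> [l [u [w [l3 lo sun]]]]; apply: no_sun.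
have uN i : u i \notin U by have := sun i i; rewrite eqxx => /and3P[].
have wU j : w j \in U by have := sun j j; rewrite eqxx => /and3P[].
have uw i j : attached (u i) (w j) = (j == i) || (j == ordS i).
  by rewrite -sun /cross_adj uN wU root_adj_outer.
have /fin_all_exists2[v vE vw] j : exists2 K, K \in edge_cliques e & center K = w j.
  by have := uw j j; rewrite eqxx => /exists_inP[K KE /andP[/eqP wK _]]; exists K.
exists l, u, v; split=> // i j; rewrite -uw vE andbT.
apply/idP/exists_inP => [uv|[K KE /andP[/eqP wK uK]]]; first by exists (v j); rewrite ?vw ?eqxx.
by rewrite (center_inj (vE j) KE) // vw.
Qed.

Lemma closed_root_adj_center K x : K \in edge_cliques e -> x \in K ->
  closed_adj root_adj x (center K).
Proof.
move=> KE xK; rewrite /closed_adj /root_adj; case: eqVneq => //= _.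
by rewrite [attached x _](_ : _ = true) ?orbT //; apply/exists_inP; exists K; rewrite ?eqxx.
Qed.

Lemma root_adj_nbh z : edge_cliques e != set0 -> (exists2 K, K \in edge_cliques e &
  forall x, closed_adj root_adj x z -> x \in K) \/ forall x, closed_adj root_adj x z -> x = z.
Proof.
have [hC _] := root_adj_simple; move=> /set0Pn[K1 K1E]; have [zU|zN] := boolP (z \in U).
  left; have [[K KE zK]|none] : (exists2 K, K \in edge_cliques e & center K = z) \/
      forall K, K \in edge_cliques e -> center K != z.
    have [/exists_inP[K KE /eqP zK]|/exists_inPn] :=
      boolP [exists K in edge_cliques e, center K == z]; [by left; exists K | by right].
  - exists K => // x /predU1P[->|]; first exact: sub_U.
    have [xU _|xN] := boolP (x \in U); first exact: sub_U.
    rewrite root_adj_outer // -zK => /exists_inP[K' KE' /andP[/eqP/center_inj E xK]].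
    by rewrite -(E KE' KE).
  exists K1 => // x /predU1P[->|]; first exact: sub_U.
  have [xU _|xN] := boolP (x \in U); first exact: sub_U.
  by rewrite root_adj_outer // => /exists_inP[K KE /andP[zK _]]; have := none K KE; rewrite zK.
have [/existsP[K /andP[KE zK]]|none] := boolP [exists K, (K \in edge_cliques e) && (z \in K)].
  left; exists K => // x /predU1P[-> //|]; rewrite hC root_adj_outer //.
  by move/attachedU; apply: sub_U.
right=> x /predU1P[//|]; rewrite hC root_adj_outer // => /exists_inP[K KE /andP[_ zK]].
by case/existsP: none; exists K; rewrite KE.
Qed.

Lemma square_root_adj : edge_cliques e != set0 -> e =2 square root_adj.
Proof.
move=> E0 x y; rewrite (squareE _ _ root_adj_simple).
apply/idP/andP => [exy|[xy /existsP[z /andP[xz yz]]]].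
  have [K KE /andP[xK yK]] := edge_clique eS exy; split.
    by apply: contraTneq exy => ->; have [_ ->] := eS.
  by apply/existsP; exists (center K); rewrite !closed_root_adj_center.
have [[K KE sub]|sub] := root_adj_nbh z E0; first by apply: clique_adj KE _ _ xy; apply: sub.
by rewrite (sub x xz) (sub y yz) eqxx in xy.
Qed.

Lemma root_adj_osf_root : edge_cliques e != set0 -> ~ clique_odd_sun e -> has_osf_split_root e.
Proof.
move=> ne0 no_sun; exists root_adj; split; [exact: root_adj_simple | |exact: root_adj_odd_sun_free
  |exact: square_root_adj].
by exists U; split; [exact: root_adj_clique | exact: root_adj_independent].
Qed.

End BuildRoot.

Lemma osf_root_iff e : simple_graph e -> has_osf_split_root e <->
  ~ clique_odd_sun e /\ #|edge_cliques e| <= #|\bigcap_(K in edge_cliques e) K|.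
Proof.
move=> eS; split=> [[h [hS [K0 [cK iK]] F eh]]|[no_sun count]].
  by split; [apply: (root_no_clique_odd_sun hS eh cK iK F) | apply: (root_count hS eh cK iK F)].
have [edgeless|nonempty] := eqVneq (edge_cliques e) set0; last first.
  have [f fU f_inj] := injection_of_card count nonempty.
  exact: root_adj_osf_root fU f_inj nonempty no_sun.
apply: edgeless_osf_root => // x y.
by apply/negP => /(edge_clique eS)[K]; rewrite edgeless inE.
Qed.

Lemma balanced_graph_odd_sun e : balanced_graph e <-> ~ clique_odd_sun e.
Proof.
rewrite /balanced_graph /balanced_hypergraph balanced_mx_odd_sun.
split=> no_sun [l [u [v [l3 lo sun]]]]; apply: no_sun.
  have vM j : v j \in max_cliques e.
    by have := sun j j; rewrite eqxx => /andP[_]; rewrite inE => /andP[].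
  exists l, (fun i => enum_rank (u i)), (fun j => enum_rank_in (vM j) (v j)); split=> // i j.
  rewrite mxE enum_rankK enum_rankK_in //.
  have := sun i j; have := sun j j; rewrite eqxx => /andP[_ ->].
  by rewrite andbT.
exists l, (fun i => enum_val (u i)), (fun j => enum_val (v j)); split=> // i j.
rewrite -sun mxE; case: (boolP (enum_val (u i) \in enum_val (v j))) => //= uv.
rewrite inE enum_valP /=; apply/card_gt1P.
exists (enum_val (u j)), (enum_val (u (ord_pred j))); split.
- by have := sun j j; rewrite mxE eqxx.
- by have := sun (ord_pred j) j; rewrite mxE ord_predK eqxx orbT.
apply/eqP => /enum_val_inj/(sun_row_inj l3 sun) jE.
by have := ordS_neq (ord_pred j) (ltac:(slia) : 2 <= l); rewrite ord_predK -jE eqxx.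
Qed.

Lemma edge_cliques_max e : simple_graph e -> 0 < #|T| -> (forall y, exists z, e y z) ->
  edge_cliques e = max_cliques e.
Proof.
move=> [eC eI] T0 nbr; apply/setP => K; rewrite inE.
case: (boolP (K \in max_cliques e)) => //= /max_cliqueP[KC Kmax].
have no_singleton y : ~ K \subset [set y].
  move=> sub; have [z yz] := nbr y.
  have E := Kmax _ (clique2 eC yz) (subset_trans sub (subsetUl _ _)).
  by have := subsetP sub z; rewrite -E set22 => /(_ isT)/set1P zy; rewrite zy eI in yz.
have /card_gt0P[x _] := T0; apply/negPn/negP; rewrite -leqNgt => K1.
have [K0|[y yK]] := set_0Vmem K; first by apply: (no_singleton x); rewrite K0 sub0set.
apply: (no_singleton y); apply/subsetP => z zK.
by rewrite inE (card_le1_eqP K1 z y zK yK).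
Qed.

Lemma cliques_of_card1 e : #|T| = 1 -> max_cliques e = [set setT] /\ edge_cliques e = set0.
Proof.
move=> T1; have T_clique : clique e setT.
  by apply/cliqueP => x y _ _ /eqP[]; apply: (card_le1_eqP (A := predT)); rewrite ?T1.
have M : max_cliques e = [set setT].
  apply/setP => K; rewrite [RHS]inE; apply/max_cliqueP/eqP => [[_ Kmax]|->].
    by rewrite -(Kmax _ T_clique (subsetT K)).
  by split=> // K' _; rewrite subTset => /eqP.
split=> //; apply/setP => K; rewrite inE M !inE; apply/negP => /andP[/eqP ->].
by rewrite cardsT T1.
Qed.

Lemma clique_count_edge e : simple_graph e -> 0 < #|T| ->
  (1 < #|T| -> forall y, exists z, e y z) ->
  (#|max_cliques e| <= #|\bigcap_(K in max_cliques e) K|) =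
  (#|edge_cliques e| <= #|\bigcap_(K in edge_cliques e) K|).
Proof.
move=> eS T0 nbr; have [T1|T1] : #|T| = 1 \/ 1 < #|T| by slia.
  by have [-> ->] := cliques_of_card1 e T1; rewrite cards1 big_set1 cardsT T1 cards0.
by rewrite edge_cliques_max //; apply: nbr.
Qed.

Lemma square_nbr h y : simple_graph h -> connected h -> 1 < #|T| -> exists z, square h y z.
Proof.
move=> hS [_ con] T1; have /card_gt0P[z] : 0 < #|[set~ y]| by have := cardsC1 y; slia.
rewrite !inE => zy; have /connectP[[|w p] /=] := con y z; first by move=> _ E; rewrite E eqxx in zy.
case/andP=> yw _ _; exists w; rewrite squareE //; apply/andP; split.
  by apply: contraTneq yw => ->; have [_ ->] := hS.
by apply/existsP; exists w; rewrite /closed_adj yw eqxx orbT.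
Qed.

Lemma universal_vertex e : #|max_cliques e| <= #|\bigcap_(K in max_cliques e) K| ->
  exists x, forall y, y != x -> e x y.
Proof.
move=> count; have [|K0 K0M _] := @clique_max e set0; first by apply/cliqueP => x y; rewrite inE.
have /card_gt0P[x xU] : 0 < #|\bigcap_(K in max_cliques e) K|.
  by apply: leq_trans count; apply/card_gt0P; exists K0.
exists x => y yx; have [|K KM] := @clique_max e [set y].
  by apply/cliqueP => a b /set1P -> /set1P ->; rewrite eqxx.
rewrite sub1set => yK; move/bigcapP: xU => /(_ K KM) xK.
by move/max_cliqueP: KM => [/cliqueP KC _]; apply: KC => //; rewrite eq_sym.
Qed.

Lemma square_connect h x y : simple_graph h -> square h x y -> connect h x y.
Proof.
move=> hS; rewrite squareE // => /andP[_ /existsP[z /andP[xz yz]]].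
have step w : closed_adj h w z -> connect h w z.
  by move=> /predU1P[->|wz]; [exact: connect0 | exact: connect1].
apply: connect_trans (step x xz) _.
by rewrite (sym_connect_sym (proj1 hS)) step.
Qed.

Lemma connected_osf_root_iff e : simple_graph e ->
  has_connected_osf_split_root e <->
  balanced_graph e /\ #|max_cliques e| <= #|\bigcap_(K in max_cliques e) K|.
Proof.
move=> eS; rewrite balanced_graph_odd_sun; split=> [[h [hS hcon hK F eh]]|[no_sun count]].
  have [no_sun count] := proj1 (osf_root_iff eS) (ex_intro _ h (And4 hS hK F eh)).
  split=> //; rewrite clique_count_edge //; first by case: hcon.
  by move=> T1 y; have [z yz] := square_nbr y hS hcon T1; exists z; rewrite eh.
have [x univ] := universal_vertex count.
have T0 : 0 < #|T| by apply/card_gt0P; exists x.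
have nbr : 1 < #|T| -> forall y, exists z, e y z.
  move=> T1 y; have [eC _] := eS; have [->|yx] := eqVneq y x; last by exists x; rewrite eC univ.
  have /card_gt0P[z] : 0 < #|[set~ x]| by have := cardsC1 x; slia.
  by rewrite !inE => zx; exists z; apply: univ.
rewrite clique_count_edge // in count.
have [h [hS hK F eh]] := proj2 (osf_root_iff eS) (conj no_sun count).
exists h; split=> //; split=> // y z; have hsym := sym_connect_sym (proj1 hS).
have cx w : connect h x w.
  have [->|wx] := eqVneq w x; first exact: connect0.
  by apply: square_connect => //; rewrite -eh univ.
by apply: connect_trans (cx z); rewrite hsym.
Qed.

End Squares.

(** * Cliques as common neighbourhoods *)

Section UnbalancedHoles.
Variables (V : finType) (adj : rel V) (side : V -> bool).
Hypothesis adjC : symmetric adj.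
Hypothesis bip : forall x y, adj x y -> side x != side y.

Lemma odd_sun_of_hole c n : 5 < n -> n %% 4 = 2 -> hole adj c n -> ~~ side (c 0) ->
  has_odd_sun (fun x y => ~~ side x && adj x y).
Proof.
move=> n5 n4 Hc s0; pose l := n./2; have nE : n = l.*2 by rewrite /l; slia.
pose before j := if j is j'.+1 then j'.*2.+1 else n.-1.
exists l, (fun i : 'I_l => c i.*2), (fun j : 'I_l => c (before j)).
split; try by rewrite /l; slia.
move=> i j; rewrite (hole_side bip _ Hc); last by slia.
rewrite odd_double addbF s0 /= -!(inj_eq (@ord_inj l)) val_ordS.
have il := ltn_ord i; have jl := ltn_ord j.
case: (j : nat) jl => [|j'] jl /=.
  rewrite (hole_adj Hc); last by slia.
  by clear -nE il n5; case: (eqVneq i.+1 l) => C; slia.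
have [lt|ge] := ltnP i.*2 j'.*2.+1.
  rewrite (hole_adj Hc); last by slia.
  by clear -nE il lt jl; case: (eqVneq i.+1 l) => C; slia.
rewrite adjC (hole_adj Hc); last by slia.
by clear -nE il ge jl; case: (eqVneq i.+1 l) => C; slia.
Qed.

Lemma hole_of_odd_sun l (u v : 'I_l -> V) : 3 <= l ->
  (forall i, ~~ side (u i)) -> (forall j, side (v j)) -> injective u -> injective v ->
  (forall i j, adj (u i) (v j) = (j == i) || (j == ordS i)) -> exists c, hole adj c l.*2.
Proof.
move=> l3 su sv u_inj v_inj uv; have l0 : 0 < l by slia.
pose o k : 'I_l := Ordinal (ltn_pmod k l0).
have oE k : k < l -> o k = k :> nat by move=> kl; rewrite /= modn_small.
pose f t := if odd t then v (ordS (o t./2)) else u (o t./2).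
have fs t : side (f t) = odd t by rewrite /f; case: ifP; rewrite ?sv // (negbTE (su _)).
have uv_o a b : a < l -> b < l ->
    adj (u (o a)) (v (ordS (o b))) = [|| b == a, b.+1 == a | (a == 0) && (b.+1 == l)].
  move=> al bl; rewrite uv (inj_eq (@ordS_inj l)) -!(inj_eq (@ord_inj l)) val_ordS !oE //.
  by case: (eqVneq b.+1 l) => C; slia.
exists (fun t => f (t %% l.*2)); apply: (@hole_of_range _ adj adjC f); first by slia.
move=> i j ij; have [E|E] := eqVneq (odd i) (odd j); last split.
- have -> : adj (f i) (f j) = false by apply/negbTE/(side_nadj bip); rewrite !fs E.
  split; last by move: E ij; clear; slia.
  have o_neq : o i./2 != o j./2 by rewrite -(inj_eq (@ord_inj l)) !oE; slia.
  rewrite /f -E; case: ifP => oi; apply: contra_neq o_neq; last exact: u_inj.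
  by move/v_inj/ordS_inj.
- by apply: contra_neq E; rewrite -!fs => ->.
rewrite /f; move: E; case: ifP => oi; case: ifP => // oj _.
  by rewrite adjC uv_o; clear -oi oj ij l3; slia.
by rewrite uv_o; clear -oi oj ij l3; slia.
Qed.

Lemma unbalanced_hole_odd_sun :
  has_unbalanced_hole adj <-> has_odd_sun (fun x y => ~~ side x && adj x y).
Proof.
split=> [[n [c [n5 n4 Hc]]]|[l [u [v [l3 lo H]]]]].
  have [s0|s0] := boolP (side (c 0)); last exact: (odd_sun_of_hole n5 n4 Hc s0).
  apply: (odd_sun_of_hole n5 n4 (hole_shift Hc 1)).
  by rewrite (hole_side bip _ Hc) ?s0 //; slia.
have su i : ~~ side (u i) by have := H i i; rewrite eqxx => /andP[].
have [|||i j|c Hc] := hole_of_odd_sun (u := u) (v := v) l3 su.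
- by move=> j; have := H j j; rewrite eqxx => /andP[/negbTE sj /bip]; rewrite sj; case: side.
- exact: (sun_row_inj (r := fun x y => ~~ side x && adj x y) l3 H).
- exact: (sun_col_inj (r := fun x y => ~~ side x && adj x y) l3 H).
- by rewrite -H su.
by exists l.*2, c; split=> //; slia.
Qed.

End UnbalancedHoles.

Section CliquePairs.
Variables (T : finType) (e : rel T).
Hypothesis eS : simple_graph e.

Notation closed_adj := (closed_adj e).

Definition common_nbh (x y : T) : {set T} := [set z | closed_adj x z && closed_adj y z].
Definition clique_pair (p : T * T) : bool := e p.1 p.2 && clique e (common_nbh p.1 p.2).

(* A triangle with each of its edges in a clique that avoids the third vertex. *)
Definition extended_triangle : Prop := exists x y z a b c,
  [/\ [&& e x y, e y z & e x z], [&& closed_adj x a, closed_adj y a & ~~ closed_adj z a],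
      [&& closed_adj y b, closed_adj z b & ~~ closed_adj x b]
    & [&& closed_adj x c, closed_adj z c & ~~ closed_adj y c]].

Let eC : symmetric e. Proof. by case: eS. Qed.
Let eI : irreflexive e. Proof. by case: eS. Qed.

Let closed_adjC x y : closed_adj x y = closed_adj y x.
Proof. by rewrite /closed_adj eq_sym eC. Qed.

Let closed_adjxx x : closed_adj x x. Proof. by rewrite /closed_adj eqxx. Qed.

Lemma clique_closed_adj K x y : clique e K -> x \in K -> y \in K -> closed_adj x y.
Proof.
by move=> /cliqueP KC xK yK; rewrite /closed_adj; case: eqVneq => //= xy; apply: KC.
Qed.

Let edge_clique_clique K : K \in edge_cliques e -> clique e K.
Proof. by rewrite inE => /andP[/max_cliqueP[]]. Qed.

Lemma edge_clique3 x y z : e x y -> closed_adj x z -> closed_adj y z ->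
  exists2 K, K \in edge_cliques e & [&& x \in K, y \in K & z \in K].
Proof.
move=> xy xz yz; have xyz : clique e [set x; y; z].
  have closed_e u w : closed_adj u w -> u != w -> e u w by move=> /predU1P[->|//]; rewrite eqxx.
  have xy' : closed_adj x y by rewrite /closed_adj xy orbT.
  apply/cliqueP => a b; rewrite !inE => /orP[/orP[]|] /eqP -> /orP[/orP[]|] /eqP -> //;
    by apply: closed_e; rewrite // closed_adjC.
have [K KM] := clique_max xyz.
rewrite !subUset !sub1set => /andP[/andP[xK yK] zK]; exists K; rewrite ?xK ?yK //.
rewrite inE KM; apply/card_gt1P; exists x, y; split=> //.
by apply: contraTneq xy => ->; rewrite eI.
Qed.

Lemma extended_triangle_odd_sun : extended_triangle -> clique_odd_sun e.
Proof.
move=> [x [y [z [a [b [c [/and3P[xy yz xz]]]]]]]].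
move=> /and3P[xa ya za] /and3P[yb zb xb] /and3P[xc zc yc].
have [K1 E1 /and3P[xK1 yK1 aK1]] := edge_clique3 xy xa ya.
have [K2 E2 /and3P[yK2 zK2 bK2]] := edge_clique3 yz yb zb.
have [K3 E3 /and3P[xK3 zK3 cK3]] := edge_clique3 xz xc zc.
have outside K u w : K \in edge_cliques e -> w \in K -> ~~ closed_adj u w -> u \notin K.
  by move=> /edge_clique_clique KC wK; apply: contra => uK; apply: clique_closed_adj KC uK wK.
have zK1 := outside _ _ _ E1 aK1 za.
have xK2 := outside _ _ _ E2 bK2 xb.
have yK3 := outside _ _ _ E3 cK3 yc.
exists 3, (nth x [:: x; y; z]), (nth K1 [:: K3; K1; K2]); split=> //.
by move=> [[|[|[|//]]] Hi] [[|[|[|//]]] Hj]; rewrite /= ?E1 ?E2 ?E3 ?xK1 ?yK1 ?yK2 ?zK2 ?xK3 ?zK3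
  ?(negbTE zK1) ?(negbTE xK2) ?(negbTE yK3).
Qed.

Lemma clique_pair_edge_clique p : clique_pair p -> common_nbh p.1 p.2 \in edge_cliques e.
Proof.
case: p => x y /andP[/= xy cl].
have xC : x \in common_nbh x y by rewrite inE closed_adjxx closed_adjC /closed_adj xy orbT.
have yC : y \in common_nbh x y by rewrite inE closed_adjxx andbT /closed_adj xy orbT.
rewrite inE; apply/andP; split; last first.
  by apply/card_gt1P; exists x, y; split=> //; apply: contraTneq xy => ->; rewrite eI.
apply/max_cliqueP; split=> // K KC sub; apply/eqP; rewrite eqEsubset sub andbT.
by apply/subsetP => z zK; rewrite inE !(clique_closed_adj KC) //; apply: (subsetP sub).
Qed.

Lemma edge_clique_no_universal K v : K \in edge_cliques e ->
  (forall x, x \in K -> closed_adj x v) -> v \in K.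
Proof.
rewrite inE => /andP[/max_cliqueP[KC Kmax] _] Kv; suff <- : v |: K = K by apply: setU11.
apply: Kmax; last exact: subsetUr.
have vK x : x \in K -> x != v -> e x v by move=> /Kv /predU1P[->|//]; rewrite eqxx.
apply/cliqueP => a b; rewrite !inE => /predU1P[->|aK] /predU1P[->|bK]; rewrite ?eqxx // eq_sym.
- by rewrite eC; apply: vK.
- by rewrite eq_sym; apply: vK.
- by rewrite eq_sym; apply: (cliqueP _ _ KC).
Qed.

Lemma edge_clique_common_nbh K : ~ extended_triangle -> K \in edge_cliques e ->
  exists x y, [/\ x \in K, y \in K, x != y & common_nbh x y \subset K].
Proof.
move=> no_tri KE; have /andP[_ /card_gt1P[x0 [y0 [x0K y0K xy0]]]] :
  (K \in max_cliques e) && (1 < #|K|) by rewrite inE in KE.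
have [/existsP[x /existsP[y /and4P[]]]|N] := boolP [exists x, exists y,
  [&& x \in K, y \in K, x != y & common_nbh x y \subset K]]; first by exists x, y.
have outer x y : x \in K -> y \in K -> x != y ->
    exists v, ((v \notin K) && closed_adj x v) && ((v \notin K) && closed_adj y v).
  move=> xK yK xy; move/existsPn: N => /(_ x)/existsPn/(_ y).
  by rewrite xK yK xy => /subsetPn[v]; rewrite inE => /andP[xv yv] vN; exists v; rewrite vN xv.
have [x y xK yK|x1 x2 x3 j1 j2 j3 X1 X2 X3||v Hv] :=
  @helly_of_triples _ _ (fun x v => (v \notin K) && closed_adj x v) K.
- have [<-|xy] := eqVneq x y; last exact: outer.
  have [z zK xz] : exists2 z, z \in K & x != z.
    by have [->|xx] := eqVneq x x0; [exists y0 | exists x0].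
  by have [v /andP[xv _]] := outer x z xK zK xz; exists v; rewrite xv.
- case/and5P=> /andP[J2 a12] /andP[J3 a13] /andP[J1 a21] /andP[_ a23].
  move=> /andP[/andP[_ a31] /andP[_ a32]]; rewrite J1 J2 J3 /=.
  apply/negPn/negP => /norP[n11 /norP[n22 n33]]; apply: no_tri.
  have ne x y j : closed_adj x j -> ~~ closed_adj y j -> x != y.
    by move=> xj; apply: contraNneq => <-.
  exists x1, x2, x3, j3, j1, j2; rewrite a12 a13 a21 a23 a31 a32 n11 n22 n33; split=> //.
  by rewrite !(clique_adj KE) // ?(ne _ _ _ a12 n22) ?(ne _ _ _ a13 n33) ?(ne _ _ _ a23 n33).
- by apply/set0Pn; exists x0.
have /andP[/negP[]] := Hv x0 x0K; apply: edge_clique_no_universal KE _.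
by move=> x /Hv/andP[].
Qed.

Lemma edge_clique_pair K : ~ extended_triangle -> K \in edge_cliques e ->
  exists2 p, clique_pair p & common_nbh p.1 p.2 = K.
Proof.
move=> no_tri KE; have [x [y [xK yK xy sub]]] := edge_clique_common_nbh no_tri KE.
have KC := edge_clique_clique KE; have E : common_nbh x y = K.
  apply/eqP; rewrite eqEsubset sub; apply/subsetP => z zK.
  by rewrite inE !(clique_closed_adj KC).
by exists (x, y); rewrite // /clique_pair /= E KC andbT (clique_adj KE).
Qed.

(* A pair (x, x) stands for the vertex x, and a clique pair for its clique. *)
Definition pair_adj (p q : T * T) : bool :=
  [&& p.1 == p.2, clique_pair q & p.1 \in common_nbh q.1 q.2] ||
  [&& q.1 == q.2, clique_pair p & q.1 \in common_nbh p.1 p.2].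

Definition pair_side (p : T * T) : bool := p.1 != p.2.

Lemma pair_adjC : symmetric pair_adj.
Proof. by move=> p q; rewrite /pair_adj orbC. Qed.

Lemma clique_pair_side p : clique_pair p -> pair_side p.
Proof. by case/andP=> xy _; apply: contraTneq xy => ->; rewrite eI. Qed.

Lemma pair_bip p q : pair_adj p q -> pair_side p != pair_side q.
Proof.
by rewrite /pair_adj => /orP[] /and3P[/eqP E /clique_pair_side -> _]; rewrite /pair_side E eqxx.
Qed.

Lemma pair_adj_unbalanced_hole :
  ~ extended_triangle -> has_unbalanced_hole pair_adj <-> clique_odd_sun e.
Proof.
move=> no_tri; rewrite (unbalanced_hole_odd_sun pair_adjC pair_bip).
have aE p q : ~~ pair_side p -> pair_adj p q = clique_pair q && (p.1 \in common_nbh q.1 q.2).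
  move=> sp; rewrite /pair_adj; have /negPn -> := sp; rewrite /=.
  have [/clique_pair_side|] := boolP (clique_pair p); first by rewrite (negbTE sp).
  by rewrite andbF orbF.
split=> [[l [u [v [l3 lo sun]]]]|[l [u [v [l3 lo sun]]]]].
  have us i : ~~ pair_side (u i) by have := sun i i; rewrite eqxx => /andP[].
  have vg j : clique_pair (v j) by have := sun j j; rewrite eqxx aE // => /and3P[].
  exists l, (fun i => (u i).1), (fun j => common_nbh (v j).1 (v j).2); split=> // i j.
  by rewrite clique_pair_edge_clique // andbT -sun us aE // vg.
have vE j : v j \in edge_cliques e by have := sun j j; rewrite eqxx => /andP[].
have /fin_all_exists[q Hq] j : exists q, clique_pair q /\ common_nbh q.1 q.2 = v j.
  by have [q] := edge_clique_pair no_tri (vE j); exists q.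
exists l, (fun i => (u i, u i)), q; split=> // i j; have [gq qv] := Hq j.
by rewrite aE /pair_side /= ?eqxx // gq qv -sun vE andbT.
Qed.

Definition central (v : T) : bool := [forall p, clique_pair p ==> (v \in common_nbh p.1 p.2)].

Definition pair_cliques : {set {set T}} := [set common_nbh p.1 p.2 | p : T * T & clique_pair p].

Lemma pair_cliquesE : ~ extended_triangle -> pair_cliques = edge_cliques e.
Proof.
move=> NT; apply/setP => K; apply/imsetP/idP => [[p] | /(edge_clique_pair NT)[p pK <-]].
  by rewrite inE => pK ->; apply: clique_pair_edge_clique.
by exists p; rewrite ?inE.
Qed.

Lemma centralE : [set v | central v] = \bigcap_(K in pair_cliques) K.
Proof.
apply/setP => v; rewrite inE; apply/forallP/bigcapP => [H K /imsetP[p]|H p].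
  by rewrite inE => pK ->; apply: (implyP (H p)).
by apply/implyP => pK; apply: H; apply/imsetP; exists p; rewrite ?inE.
Qed.

Lemma osf_root_pairs : has_osf_split_root e <->
  [/\ ~ extended_triangle, ~ has_unbalanced_hole pair_adj
    & #|pair_cliques| <= #|[set v | central v]|].
Proof.
rewrite osf_root_iff // centralE; split=> [[NO count]|[NT NU count]].
  have NT : ~ extended_triangle by move/extended_triangle_odd_sun.
  by rewrite pair_cliquesE //; split=> // /(pair_adj_unbalanced_hole NT).
by rewrite pair_cliquesE // in count; split=> // /(pair_adj_unbalanced_hole NT).
Qed.

End CliquePairs.

(** * Polynomial time functions on trees *)

Inductive nat_poly : (nat -> nat) -> Prop :=
  | nat_poly_const k : nat_poly (fun=> k)
  | nat_poly_id : nat_poly (fun n => n)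
  | nat_poly_add p q : nat_poly p -> nat_poly q -> nat_poly (fun n => p n + q n)
  | nat_poly_mul p q : nat_poly p -> nat_poly q -> nat_poly (fun n => p n * q n).

Lemma nat_poly_mono p m n : nat_poly p -> m <= n -> p m <= p n.
Proof. by move=> Hp mn; elim: Hp => //= *; [apply: leq_add | apply: leq_mul]. Qed.

Lemma nat_poly_comp p q : nat_poly p -> nat_poly q -> nat_poly (fun n => p (q n)).
Proof. by move=> Hp Hq; elim: Hp => [k||p1 p2 _ H1 _ H2|p1 p2 _ H1 _ H2] //; constructor. Qed.

Lemma nat_poly_bound p : nat_poly p -> exists a k, forall n, p n <= a * n ^ k + a.
Proof.
have expn_le n k1 k2 : n ^ k1 <= n ^ (k1 + k2) + 1.
  case: n => [|n]; first by case: k1 => [|k1]; rewrite ?expn0 ?addn1 // exp0n.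
  by rewrite (leq_trans _ (leq_addr _ _)) // leq_pexp2l // leq_addr.
elim=> [k||p1 p2 _ [a1 [k1 le1]] _ [a2 [k2 le2]]|p1 p2 _ [a1 [k1 le1]] _ [a2 [k2 le2]]].
- by exists k, 0 => n; rewrite leq_addl.
- by exists 1, 1 => n; rewrite expn1 mul1n leq_addr.
- exists (2 * (a1 + a2)), (k1 + k2) => n.
  have := expn_le n k1 k2; have := expn_le n k2 k1; rewrite [k2 + k1]addnC.
  have := le1 n; have := le2 n; move: (n ^ k1) (n ^ k2) (n ^ (k1 + k2)) (p1 n) (p2 n).
  by move=> x y z u v *; nia.
exists (4 * (a1 * a2)), (k1 + k2) => n; apply: leq_trans (leq_mul (le1 n) (le2 n)) _.
have := expn_le n k1 k2; have := expn_le n k2 k1; rewrite [k2 + k1]addnC expnD.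
move: (n ^ k1) (n ^ k2) => x y y_le x_le.
have -> : (a1 * x + a1) * (a2 * y + a2) = a1 * a2 * (x * y + x + y + 1) by lia.
have -> : 4 * (a1 * a2) * (x * y) + 4 * (a1 * a2) = a1 * a2 * (4 * (x * y) + 4) by lia.
by rewrite leq_mul //; lia.
Qed.

Fixpoint dec_seq (t : tree) : seq tree := if t is Node a b then a :: dec_seq b else [::].

Lemma dec_seqK s : dec_seq (enc_seq s) = s.
Proof. by elim: s => //= x s ->. Qed.

Lemma size_dec_seq t : size (dec_seq t) < tree_size t.
Proof. by elim: t => //= a _ b; slia. Qed.

Lemma tree_size_hd t : tree_size (hd_tree t) <= tree_size t.
Proof. by case: t => //= a b; slia. Qed.

Lemma tree_size_tl t : tree_size (tl_tree t) <= tree_size t.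
Proof. by case: t => //= a b; slia. Qed.

Definition runs (s : store) (c : cmd) (b : nat) (s' : store) : Prop :=
  exists2 t, exec s c t s' & t <= b.

Lemma runs_assign s x e : runs s (CAssign x e) (eval_cost s e) (update s x (eval s e)).
Proof. by exists (eval_cost s e) => //; apply: ExecAssign. Qed.

Lemma runs_seq s c1 b1 s1 c2 b2 s2 :
  runs s c1 b1 s1 -> runs s1 c2 b2 s2 -> runs s (CSeq c1 c2) (b1 + b2) s2.
Proof.
by move=> [t1 E1 T1] [t2 E2 T2]; exists (t1 + t2); [apply: ExecSeq E1 E2 | apply: leq_add].
Qed.

Lemma runs_if s e c1 c2 b s' :
  runs s (if eval s e is Leaf then c2 else c1) b s' -> runs s (CIf e c1 c2) (eval_cost s e + b) s'.
Proof.
case E: (eval s e) => [|d1 d2] [t Et Tt]; exists (eval_cost s e + t); rewrite ?leq_add2l //.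
  exact: ExecIfFalse.
by apply: ExecIfTrue => //; rewrite E.
Qed.

Lemma runs_while_false s e c : eval s e = Leaf -> runs s (CWhile e c) (eval_cost s e) s.
Proof. by exists (eval_cost s e) => //; apply: ExecWhileFalse. Qed.

Lemma runs_while_true s e c b1 s1 b2 s2 : eval s e <> Leaf -> runs s c b1 s1 ->
  runs s1 (CWhile e c) b2 s2 -> runs s (CWhile e c) (eval_cost s e + b1 + b2) s2.
Proof.
move=> ne [t1 E1 T1] [t2 E2 T2]; exists (eval_cost s e + t1 + t2); last by rewrite !leq_add.
exact: ExecWhileTrue E1 E2.
Qed.

Lemma runs_leq s c b b' s' : b <= b' -> runs s c b s' -> runs s c b' s'.
Proof. by move=> bb' [t E T]; exists t => //; apply: leq_trans T bb'. Qed.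

(* [f] is computed in variable 0 by a program that touches only the variables
   below [m] and whose behaviour depends only on the content of variable 0. *)
Definition computes (c : cmd) (m : nat) (p : nat -> nat) (f : tree -> tree) : Prop :=
  forall s, tree_size (f (s 0)) <= p (tree_size (s 0)) /\
    exists s', [/\ runs s c (p (tree_size (s 0))) s', s' 0 = f (s 0)
                 & forall x, m <= x -> s' x = s x].

Definition ptime f : Prop := exists c m p, [/\ 0 < m, nat_poly p & computes c m p f].

Lemma eq_ptime f g : f =1 g -> ptime f -> ptime g.
Proof.
move=> fg [c [m [p [m0 Hp H]]]]; exists c, m, p; split=> // s; rewrite -fg.
exact: H.
Qed.

Lemma ptime_size f :
  ptime f -> exists2 q, nat_poly q & forall d, tree_size (f d) <= q (tree_size d).
Proof. by move=> [c [m [p [_ Hp H]]]]; exists p => // d; have [] := H (fun=> d). Qed.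

Lemma ptime_assign e f p : nat_poly p -> (forall s, eval s e = f (s 0)) ->
  (forall s, eval_cost s e <= p (tree_size (s 0))) -> ptime f.
Proof.
move=> Hp ef cost; exists (CAssign 0 e), 1, p; split=> // s; split.
  by rewrite -ef; apply: leq_trans (cost s); case: e {ef cost} => *; apply: leq_addr.
exists (update s 0 (eval s e)); split=> [||[]//].
  by apply: runs_leq (cost s) _; apply: runs_assign.
by rewrite -ef.
Qed.

Lemma ptime_id : ptime (fun d => d).
Proof.
by apply: (@ptime_assign (EVar 0) _ (fun n => n)) => [|//|s]; [constructor | rewrite /= addn0].
Qed.

Lemma ptime_leaf : ptime (fun=> Leaf).
Proof. by apply: (@ptime_assign ELeaf _ (fun=> 1)) => //; constructor. Qed.

Lemma ptime_hd_tree : ptime hd_tree.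
Proof.
apply: (@ptime_assign (EHd (EVar 0)) _ (fun n => n + n)) => [|//|s]; first by do 2 constructor.
by rewrite /= addn0 leq_add2r tree_size_hd.
Qed.

Lemma ptime_tl_tree : ptime tl_tree.
Proof.
apply: (@ptime_assign (ETl (EVar 0)) _ (fun n => n + n)) => [|//|s]; first by do 2 constructor.
by rewrite /= addn0 leq_add2r tree_size_tl.
Qed.

Lemma computes_leq c m m' p f : m <= m' -> computes c m p f -> computes c m' p f.
Proof.
move=> mm' H s; have [fs [s' [R s'0 frame]]] := H s; split=> //; exists s'; split=> // x Hx.
by apply: frame; apply: leq_trans Hx.
Qed.

Lemma ptime_comp f g : ptime f -> ptime g -> ptime (fun d => g (f d)).
Proof.
move=> [c1 [m1 [p1 [m10 P1 H1]]]] [c2 [m2 [p2 [m20 P2 H2]]]].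
exists (CSeq c1 c2), (maxn m1 m2), (fun n => p1 n + p2 (p1 n)); split; first by slia.
  by apply: nat_poly_add => //; apply: nat_poly_comp.
move=> s; have [fs [s1 [R1 s10 frame1]]] := computes_leq (leq_maxl m1 m2) H1 s.
have [gs [s2 [R2 s20 frame2]]] := computes_leq (leq_maxr m1 m2) H2 s1; rewrite s10 in gs R2 s20.
have p2_mono := nat_poly_mono P2 fs; split; first by slia.
exists s2; split=> // [|x Hx]; last by rewrite frame2 ?frame1.
by apply: runs_leq (runs_seq R1 R2); rewrite leq_add2l.
Qed.

Lemma ptime_hd f : ptime f -> ptime (fun d => hd_tree (f d)).
Proof. by move=> Hf; apply: ptime_comp Hf ptime_hd_tree. Qed.

Lemma ptime_tl f : ptime f -> ptime (fun d => tl_tree (f d)).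
Proof. by move=> Hf; apply: ptime_comp Hf ptime_tl_tree. Qed.

Definition call (c : cmd) (x : nat) (e : expr) : cmd :=
  CSeq (CAssign 0 e) (CSeq c (CAssign x (EVar 0))).

Lemma runs_call c m p f s x e : computes c m p f -> 0 < m -> m <= x ->
  exists s', [/\ runs s (call c x e) (eval_cost s e + (p (tree_size (eval s e)) +
                                                       p (tree_size (eval s e)))) s',
    s' x = f (eval s e) & forall y, m <= y -> y != x -> s' y = s y].
Proof.
move=> H m0 mx; have [fs [s1 [R s10 frame]]] := H (update s 0 (eval s e)).
exists (update s1 x (s1 0)); split=> [||y my yx].
- apply: runs_seq (runs_assign _ _ _) (runs_seq R (runs_leq _ (runs_assign _ _ _))).
  by rewrite /= addn0 s10.
- by rewrite /update eqxx s10.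
by rewrite /update (negbTE yx) frame // /update; case: eqP => // y0; rewrite y0 leqNgt m0 in my.
Qed.

Ltac nat_poly_tac := repeat first [ assumption | lazymatch goal with
  | |- nat_poly (fun x => x) => exact nat_poly_id
  | |- nat_poly (addn ?k) => exact (nat_poly_add (nat_poly_const k) nat_poly_id)
  | |- nat_poly (fun x => _ + _) => apply nat_poly_add
  | |- nat_poly (fun x => _ * _) => apply nat_poly_mul
  | |- nat_poly (fun _ => ?k) => exact (nat_poly_const k)
  end ].

Lemma ptime_node f g : ptime f -> ptime g -> ptime (fun d => Node (f d) (g d)).
Proof.
move=> [c1 [m1 [p1 [m10 P1 H1]]]] [c2 [m2 [p2 [m20 P2 H2]]]].
pose M := maxn m1 m2; have M0 : 0 < M by rewrite /M; slia.
have {}H1 : computes c1 M p1 f := computes_leq (leq_maxl _ _) H1.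
have {}H2 : computes c2 M p2 g := computes_leq (leq_maxr _ _) H2.
exists (CSeq (CAssign M (EVar 0)) (CSeq (call c1 M.+1 (EVar M)) (CSeq (call c2 M.+2 (EVar M))
  (CAssign 0 (ENode (EVar M.+1) (EVar M.+2)))))), M.+3,
  (fun n => n + (n + (p1 n + p1 n)) + (n + (p2 n + p2 n)) + (1 + p1 n + p2 n + (p1 n + p2 n))).
split=> // [|s]; first by nat_poly_tac.
have [fs _] := H1 s; have [gs _] := H2 s; split; first by rewrite /=; slia.
pose s1 := update s M (s 0); have s1M : s1 M = s 0 by rewrite /s1 /update eqxx.
have [s2 [R2 s2f frame2]] := runs_call s1 (EVar M) H1 M0 (leqnSn M).
have [s3 [R3 s3g frame3]] := runs_call s2 (EVar M) H2 M0 (ltac:(slia) : M <= M.+2).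
have s2M : s2 M = s 0 by rewrite frame2 //; slia.
rewrite /= s1M in R2 s2f; rewrite /= s2M in R3 s3g.
have s3f : s3 M.+1 = f (s 0) by rewrite frame3 ?s2f //; slia.
exists (update s3 0 (Node (s3 M.+1) (s3 M.+2))); split=> [||x Hx].
- apply: runs_leq (runs_seq (runs_assign s M (EVar 0)) (runs_seq R2 (runs_seq R3
    (runs_assign s3 0 (ENode (EVar M.+1) (EVar M.+2)))))).
  by rewrite /= s3f s3g; move: fs gs; clear; lia.
- by rewrite s3f s3g.
have x0 : x == 0 = false by slia.
by rewrite /update x0 frame3 ?frame2 ?/s1 /update //; [case: eqP => //; slia | slia..].
Qed.

Definition tree_if (c a b : tree) : tree := if c is Leaf then b else a.

Lemma ptime_tree_if c f g :
  ptime c -> ptime f -> ptime g -> ptime (fun d => tree_if (c d) (f d) (g d)).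
Proof.
move=> [c0 [m0 [p0 [m00 P0 H0]]]] [c1 [m1 [p1 [m10 P1 H1]]]] [c2 [m2 [p2 [m20 P2 H2]]]].
pose M := maxn m0 (maxn m1 m2); have M0 : 0 < M by rewrite /M; slia.
have {}H0 : computes c0 M p0 c := computes_leq (leq_maxl _ _) H0.
have {}H1 : computes c1 M p1 f := computes_leq (ltac:(rewrite /M; slia) : m1 <= M) H1.
have {}H2 : computes c2 M p2 g := computes_leq (ltac:(rewrite /M; slia) : m2 <= M) H2.
exists (CSeq (CAssign M (EVar 0)) (CSeq (call c0 M.+1 (EVar M)) (CSeq (CAssign 0 (EVar M))
  (CIf (EVar M.+1) c1 c2)))), M.+2,
  (fun n => n + (n + (p0 n + p0 n)) + n + (p0 n + (p1 n + p2 n))).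
split=> // [|s]; first by nat_poly_tac.
have [cs _] := H0 s.
pose s1 := update s M (s 0); have s1M : s1 M = s 0 by rewrite /s1 /update eqxx.
have [s2 [R2 s2c frame2]] := runs_call s1 (EVar M) H0 M0 (leqnSn M).
have s2M : s2 M = s 0 by rewrite frame2 //; slia.
rewrite /= s1M in R2 s2c; pose s3 := update s2 0 (s2 M).
have s30 : s3 0 = s 0 by rewrite -s2M.
have s3c : s3 M.+1 = c (s 0) by rewrite -s2c.
have [size_if [s4 [R4 s40 frame4]]] : tree_size (tree_if (c (s 0)) (f (s 0)) (g (s 0))) <=
    p1 (tree_size (s 0)) + p2 (tree_size (s 0)) /\
    exists s4, [/\ runs s3 (CIf (EVar M.+1) c1 c2) (eval_cost s3 (EVar M.+1) +
      (p1 (tree_size (s 0)) + p2 (tree_size (s 0)))) s4,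
      s4 0 = tree_if (c (s 0)) (f (s 0)) (g (s 0)) & forall x, M <= x -> s4 x = s3 x].
  have [fs [sf [Rf sf0 framef]]] := H1 s3; have [gs [sg [Rg sg0 frameg]]] := H2 s3.
  rewrite s30 in fs gs Rf Rg sf0 sg0; case E: (c (s 0)) => [|d1 d2] /=.
    split; first by slia.
    by exists sg; split=> //; apply: runs_if; rewrite /= s3c E; apply: runs_leq Rg; apply: leq_addl.
  split; first by slia.
  by exists sf; split=> //; apply: runs_if; rewrite /= s3c E; apply: runs_leq Rf; apply: leq_addr.
split; first by slia.
exists s4; split=> // [|x Hx].
  apply: runs_leq (runs_seq (runs_assign s M (EVar 0)) (runs_seq R2
    (runs_seq (runs_assign s2 0 (EVar M)) R4))).
  by rewrite /= s2M s3c; move: cs; clear; lia.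
rewrite frame4 /s3 /update ?(ltac:(slia) : x == 0 = false) ?frame2 /s1 /update; try slia.
by case: eqP => //; slia.
Qed.

Section Fold.
Variables (f a l : tree -> tree).

Let step d := fun acc x => f (Node acc (Node x d)).

Section Loop.
Variables (cf : cmd) (M : nat) (p : nat -> nat).
Hypotheses (M0 : 0 < M) (Hp : nat_poly p) (Hf : computes cf M p f).

Definition fold_body : cmd :=
  CSeq (call cf M.+2 (ENode (EVar M.+2) (ENode (EHd (EVar M.+1)) (EVar M))))
       (CAssign M.+1 (ETl (EVar M.+1))).

Definition fold_body_cost S Q := 9 * S + 2 * Q + 3 + (p (Q + 2 * S + 2) + p (Q + 2 * S + 2)).

Lemma runs_fold_body s S Q x t : s M.+1 = Node x t -> tree_size (s M) <= S ->
  tree_size (s M.+1) <= S -> tree_size (s M.+2) <= Q ->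
  exists s', [/\ runs s fold_body (fold_body_cost S Q) s', s' M = s M, s' M.+1 = t,
    s' M.+2 = step (s M) (s M.+2) x & forall y, M.+2 < y -> s' y = s y].
Proof.
move=> sE dS tS accQ; pose e := ENode (EVar M.+2) (ENode (EHd (EVar M.+1)) (EVar M)).
have [s1 [R1 s1f frame]] := runs_call s e Hf M0 (ltac:(slia) : M <= M.+2).
have s1t : s1 M.+1 = Node x t by rewrite frame ?sE //; slia.
have R2 : runs s1 (CAssign M.+1 (ETl (EVar M.+1))) (eval_cost s1 (ETl (EVar M.+1)))
    (update s1 M.+1 t).
  by have := runs_assign s1 M.+1 (ETl (EVar M.+1)); rewrite [eval _ _]/= s1t.
exists (update s1 M.+1 t); split=> [|||| y My]; rewrite ?[update _ _ _ _]/update ?eqxx //.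
- apply: runs_leq (runs_seq R1 R2).
  have p_mono : p (tree_size (eval s e)) <= p (Q + 2 * S + 2).
    by apply: nat_poly_mono => //; move: dS tS accQ; rewrite /= sE /=; slia.
  rewrite /fold_body_cost; move: p_mono dS tS accQ; rewrite /= s1t sE /=.
  by move: (p _) (p _) => u v; clear; lia.
- by rewrite ltn_eqF // frame //; slia.
- by rewrite gtn_eqF // s1f /= sE.
by rewrite gtn_eqF 1?ltnW // frame //; slia.
Qed.

Lemma runs_fold_loop S Q t s : s M.+1 = t -> tree_size (s M) <= S -> tree_size t <= S ->
  (forall k, tree_size (foldl (step (s M)) (s M.+2) (take k (dec_seq t))) <= Q) ->
  exists s', [/\ runs s (CWhile (EVar M.+1) fold_body)
                   (size (dec_seq t) * (S + fold_body_cost S Q) + S) s',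
    s' M.+2 = foldl (step (s M)) (s M.+2) (dec_seq t) & forall y, M.+2 < y -> s' y = s y].
Proof.
elim: t s => [|x _ t IH] s sE dS tS bound.
  exists s; split=> //; apply: runs_leq (runs_while_false _ _); last by rewrite /= sE.
  by rewrite /= sE /= in tS *.
have [s1 [R1 s1d s1t s1f frame1]] : exists s1, [/\ runs s fold_body (fold_body_cost S Q) s1,
    s1 M = s M, s1 M.+1 = t, s1 M.+2 = step (s M) (s M.+2) x & forall y, M.+2 < y -> s1 y = s y].
  by apply: (runs_fold_body sE dS); [rewrite sE | have := bound 0; rewrite take0].
have [|||s2 [R2 s2f frame2]] := IH s1 s1t; rewrite ?s1d //.
- by move: tS => /=; slia.
- by move=> k; have := bound k.+1; rewrite s1f.
exists s2; split=> [||y My]; [|by rewrite s2f s1d s1f|by rewrite frame2 ?frame1].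
have ne : eval s (EVar M.+1) <> Leaf by rewrite /= sE.
apply: runs_leq (runs_while_true ne R1 R2).
by rewrite /= sE addn0 mulSn -addnA; move: tS => /=; slia.
Qed.

End Loop.

Lemma ptime_fold q : ptime f -> ptime a -> ptime l -> nat_poly q ->
  (forall d k, tree_size (foldl (step d) (a d) (take k (dec_seq (l d)))) <= q (tree_size d)) ->
  ptime (fun d => foldl (step d) (a d) (dec_seq (l d))).
Proof.
move=> [cf [mf [pf [mf0 Pf Hf]]]] [ca [ma [pa [ma0 Pa Ha]]]] [cl [ml [pl [ml0 Pl Hl]]]] Hq bound.
pose M := maxn mf (maxn ma ml); have M0 : 0 < M by rewrite /M; slia.
have {}Hf : computes cf M pf f := computes_leq (leq_maxl _ _) Hf.
have {}Ha : computes ca M pa a := computes_leq (ltac:(rewrite /M; slia) : ma <= M) Ha.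
have {}Hl : computes cl M pl l := computes_leq (ltac:(rewrite /M; slia) : ml <= M) Hl.
pose S n := n + pl n; pose loop_cost n := S n * (S n + fold_body_cost pf (S n) (q n)) + S n.
exists (CSeq (CAssign M (EVar 0)) (CSeq (call ca M.+2 (EVar M)) (CSeq (call cl M.+1 (EVar M))
  (CSeq (CWhile (EVar M.+1) (fold_body cf M)) (CAssign 0 (EVar M.+2)))))), M.+3,
  (fun n => n + (n + (pa n + pa n)) + (n + (pl n + pl n)) + loop_cost n + q n).
split=> // [|s].
  rewrite /loop_cost /fold_body_cost /S; nat_poly_tac;
    by apply: (nat_poly_comp Pf); nat_poly_tac.
have bound_all d := bound d (size (dec_seq (l d))).
split; first by have := bound_all (s 0); rewrite take_size; slia.
pose s1 := update s M (s 0); have s1M : s1 M = s 0 by rewrite /s1 /update eqxx.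
have [s2 [R2 s2a frame2]] := runs_call s1 (EVar M) Ha M0 (ltac:(slia) : M <= M.+2).
have s2M : s2 M = s 0 by rewrite frame2 //; slia.
have [s3 [R3 s3l frame3]] := runs_call s2 (EVar M) Hl M0 (leqnSn M).
have s3M : s3 M = s 0 by rewrite frame3 ?s2M //; slia.
rewrite /= s1M in R2 s2a; rewrite /= s2M in R3 s3l.
have s3a : s3 M.+2 = a (s 0) by rewrite frame3 ?s2a //; slia.
have [ls _] := Hl s; have [||k|s4 [R4 s4f frame4]] :=
  @runs_fold_loop cf M pf M0 Pf Hf (S (tree_size (s 0))) (q (tree_size (s 0))) _ s3 s3l.
- by rewrite s3M leq_addr.
- by apply: leq_trans ls (leq_addl _ _).
- by rewrite s3M s3a.
rewrite s3M s3a in s4f; exists (update s4 0 (s4 M.+2)); split=> // [|x Hx].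
  apply: runs_leq (runs_seq (runs_assign s M (EVar 0)) (runs_seq R2 (runs_seq R3
    (runs_seq R4 (runs_assign s4 0 (EVar M.+2)))))).
  have size_l : size (dec_seq (l (s 0))) <= S (tree_size (s 0)).
    by apply: leq_trans (leq_trans (ltnW (size_dec_seq _)) ls) (leq_addl _ _).
  have := leq_mul size_l (leqnn (S (tree_size (s 0)) +
    fold_body_cost pf (S (tree_size (s 0))) (q (tree_size (s 0))))).
  have := bound_all (s 0); rewrite take_size /= s4f !addn0 /loop_cost.
  by move: (_ * _) (_ * _) => u v; clear; lia.
rewrite /update (ltac:(slia) : x == 0 = false) frame4 ?frame3 ?frame2 /s1 /update; try slia.
by case: eqP => //; slia.
Qed.

End Fold.

Lemma ptime_foldl (g : tree -> tree -> tree -> tree) (a l : tree -> tree) q :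
  ptime (fun e => g (hd_tree e) (hd_tree (tl_tree e)) (tl_tree (tl_tree e))) ->
  ptime a -> ptime l -> nat_poly q ->
  (forall d k, tree_size (foldl (fun acc x => g acc x d) (a d) (take k (dec_seq (l d))))
               <= q (tree_size d)) ->
  ptime (fun d => foldl (fun acc x => g acc x d) (a d) (dec_seq (l d))).
Proof. by move=> Hg Ha Hl Hq bound; exact: (ptime_fold Hg Ha Hl Hq bound). Qed.

Lemma tree_size_foldl (g : tree -> tree -> tree) a t c k :
  (forall acc x, tree_size x <= tree_size t -> tree_size (g acc x) <= tree_size acc + c) ->
  tree_size (foldl g a (take k (dec_seq t))) <= tree_size a + tree_size t * c.
Proof.
elim: t a k => [|x _ t IH] a [|k] growth /=; [by slia..|].
have {IH} := IH (g a x) k (fun acc y Hy => growth acc y (ltac:(rewrite /=; slia))).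
have {growth} := growth a x ltac:(rewrite /=; slia).
clear; move: (tree_size x) (tree_size t) (tree_size _) (tree_size _) (tree_size a) => *; nia.
Qed.

Definition ptimeb (P : tree -> bool) : Prop := ptime (fun d => enc_bool (P d)).

Lemma eq_ptimeb P Q : P =1 Q -> ptimeb P -> ptimeb Q.
Proof. by move=> PQ; apply: eq_ptime => d; rewrite PQ. Qed.

Lemma ptimeb_comp f P : ptime f -> ptimeb P -> ptimeb (fun d => P (f d)).
Proof. by move=> Hf HP; exact: (ptime_comp Hf HP). Qed.

Lemma ptimeb_true : ptimeb (fun=> true).
Proof. exact: (ptime_node ptime_leaf ptime_leaf). Qed.

Lemma ptimeb_not P : ptimeb P -> ptimeb (fun d => ~~ P d).
Proof.
by move=> HP; apply: eq_ptime (ptime_tree_if HP ptime_leaf ptimeb_true) => d; case: (P d).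
Qed.

Lemma ptimeb_and P Q : ptimeb P -> ptimeb Q -> ptimeb (fun d => P d && Q d).
Proof.
by move=> HP HQ; apply: eq_ptime (ptime_tree_if HP HQ ptime_leaf) => d; case: (P d).
Qed.

Lemma ptimeb_or P Q : ptimeb P -> ptimeb Q -> ptimeb (fun d => P d || Q d).
Proof.
by move=> HP HQ; apply: eq_ptime (ptime_tree_if HP ptimeb_true HQ) => d; case: (P d).
Qed.

Lemma ptime_if P f g :
  ptimeb P -> ptime f -> ptime g -> ptime (fun d => if P d then f d else g d).
Proof. by move=> HP Hf Hg; apply: eq_ptime (ptime_tree_if HP Hf Hg) => d; case: (P d). Qed.

Definition is_node (t : tree) : bool := if t is Node _ _ then true else false.

Lemma ptimeb_is_node f : ptime f -> ptimeb (fun d => is_node (f d)).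
Proof.
by move=> Hf; apply: eq_ptime (ptime_tree_if Hf ptimeb_true ptime_leaf) => d; case: (f d).
Qed.

Ltac ptime_step := first [ assumption | lazymatch goal with
  | |- ptimeb (fun _ => true) => exact ptimeb_true
  | |- ptimeb (fun _ => _ && _) => apply ptimeb_and
  | |- ptimeb (fun _ => _ || _) => apply ptimeb_or
  | |- ptimeb (fun _ => ~~ _) => apply ptimeb_not
  | |- ptimeb (fun _ => is_node _) => apply ptimeb_is_node
  | |- ptime (fun x => x) => exact ptime_id
  | |- ptime (fun _ => Leaf) => exact ptime_leaf
  | |- ptime hd_tree => exact ptime_hd_tree
  | |- ptime tl_tree => exact ptime_tl_tree
  | |- ptime (fun _ => hd_tree _) => apply ptime_hd
  | |- ptime (fun _ => tl_tree _) => apply ptime_tl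
  | |- ptime (fun _ => Node _ _) => apply ptime_node
  | |- ptime (Node ?a) => refine (@ptime_node (fun _ => a) (fun d => d) _ _)
  | |- ptime (fun _ => if _ then _ else _) => apply ptime_if
  end ].
Ltac ptime_tac := repeat ptime_step.

Lemma ptimeb_has (P : tree -> tree -> bool) l :
  ptimeb (fun e => P (hd_tree e) (tl_tree e)) -> ptime l ->
  ptimeb (fun d => has (fun x => P x d) (dec_seq (l d))).
Proof.
move=> HP Hl; pose step acc x d := if is_node acc || P x d then enc_bool true else Leaf.
have foldE d s b : foldl (fun acc x => step acc x d) (enc_bool b) s
    = enc_bool (b || has (fun x => P x d) s).
  elim: s b => [|x s IH] b /=; first by rewrite orbF.
  have := IH (b || P x d); rewrite -orbA => <-; congr foldl.
  by rewrite /step; case: b; case: (P x d).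
have fold_ptime : ptime (fun d => foldl (fun acc x => step acc x d) Leaf (dec_seq (l d))).
  apply: (@ptime_foldl step (fun=> Leaf) l (fun=> 3)) => //.
  - apply: ptime_if; last exact: ptime_leaf; last exact: ptimeb_true.
    apply: ptimeb_or; first by ptime_tac.
    by apply: (@ptimeb_comp tl_tree (fun e => P (hd_tree e) (tl_tree e))) => //; ptime_tac.
  - exact: ptime_leaf.
  - exact: nat_poly_const.
  - by move=> d k; rewrite (foldE d _ false); case: (_ || _).
by apply: eq_ptime fold_ptime => d; rewrite (foldE d _ false).
Qed.

Definition tree_filter (P : tree -> bool) (t : tree) : tree :=
  foldl (fun acc x => if P x then Node x acc else acc) Leaf (dec_seq t).

Lemma has_tree_filter (P Q : tree -> bool) t :
  has Q (dec_seq (tree_filter P t)) = has (fun x => P x && Q x) (dec_seq t).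
Proof.
rewrite /tree_filter -[RHS]/(has Q (dec_seq Leaf) || _).
elim: (dec_seq t) Leaf => [|x s IH] acc /=; first by rewrite orbF.
rewrite IH; case: (P x) => //=.
by rewrite orbA [Q x || _]orbC.
Qed.

Lemma size_tree_filter P t : size (dec_seq (tree_filter P t)) = count P (dec_seq t).
Proof.
rewrite /tree_filter -[RHS]/(size (dec_seq Leaf) + _).
elim: (dec_seq t) Leaf => [|x s IH] acc /=; first by rewrite addn0.
by rewrite IH; case: (P x) => /=; slia.
Qed.

Lemma tree_size_filter P t : tree_size (tree_filter P t) <= 1 + tree_size t * (1 + tree_size t).
Proof.
rewrite /tree_filter -[dec_seq t in X in X <= _]take_size; apply: tree_size_foldl => acc x Hx.
by case: (P x) => /=; slia.
Qed.

Lemma ptime_filter (P : tree -> tree -> bool) l :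
  ptimeb (fun e => P (hd_tree e) (tl_tree e)) -> ptime l ->
  ptime (fun d => tree_filter (fun x => P x d) (l d)).
Proof.
move=> HP Hl; have [q Hq l_size] := ptime_size Hl.
apply: (@ptime_foldl (fun acc x d => if P x d then Node x acc else acc) (fun=> Leaf) l
  (fun n => 1 + q n * (1 + q n))) => //.
- apply: ptime_if; try by ptime_tac.
  by apply: (@ptimeb_comp tl_tree (fun e => P (hd_tree e) (tl_tree e))) => //; ptime_tac.
- exact: ptime_leaf.
- by nat_poly_tac.
move=> d k; apply: leq_trans (tree_size_foldl (c := 1 + tree_size (l d)) _ _ _) _.
  by move=> acc x Hx; case: (P x d) => /=; slia.
by rewrite leq_add2l leq_mul // leq_add2l.
Qed.

Definition tree_nat (t : tree) : nat := size (dec_seq t).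
Definition nat_tree (k : nat) : tree := enc_seq (nseq k Leaf).

Lemma tree_nat_treeK k : tree_nat (nat_tree k) = k.
Proof. by rewrite /tree_nat dec_seqK size_nseq. Qed.

Lemma tree_nat_enc_seq s : tree_nat (enc_seq s) = size s.
Proof. by rewrite /tree_nat dec_seqK. Qed.

Definition tree_cat (t u : tree) : tree := foldl (fun acc x => Node x acc) u (dec_seq t).

Lemma tree_nat_cat t u : tree_nat (tree_cat t u) = tree_nat t + tree_nat u.
Proof.
by rewrite /tree_nat /tree_cat; elim: (dec_seq t) u => //= x s IH u; rewrite IH /=; slia.
Qed.

Lemma ptime_cat f g : ptime f -> ptime g -> ptime (fun d => tree_cat (f d) (g d)).
Proof.
move=> Hf Hg; have [q Hq f_size] := ptime_size Hf; have [r Hr g_size] := ptime_size Hg.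
apply: (@ptime_foldl (fun acc x d => Node x acc) g f (fun n => r n + q n * (1 + q n))) => //.
- by ptime_tac.
- by nat_poly_tac.
move=> d k; apply: leq_trans (tree_size_foldl (c := 1 + tree_size (f d)) _ _ _) _.
  by move=> acc x Hx /=; slia.
by rewrite leq_add // leq_mul // leq_add2l.
Qed.

Definition tree_drop (t u : tree) : tree := foldl (fun acc _ => tl_tree acc) u (dec_seq t).

Lemma dec_seq_tl t : dec_seq (tl_tree t) = behead (dec_seq t). Proof. by case: t. Qed.

Lemma dec_seq_drop t u : dec_seq (tree_drop t u) = drop (tree_nat t) (dec_seq u).
Proof.
rewrite /tree_drop /tree_nat; elim: (dec_seq t) u => [|x s IH] u /=; first by rewrite drop0.
by rewrite IH dec_seq_tl -drop1 drop_drop addn1.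
Qed.

Lemma is_nodeE t : is_node t = (0 < tree_nat t). Proof. by case: t. Qed.

Lemma ptime_drop f g : ptime f -> ptime g -> ptime (fun d => tree_drop (f d) (g d)).
Proof.
move=> Hf Hg; have [r Hr g_size] := ptime_size Hg.
apply: (@ptime_foldl (fun acc x d => tl_tree acc) g f r) => //; first by ptime_tac.
move=> d k; apply: leq_trans (tree_size_foldl (c := 0) _ _ _) _.
  by move=> acc x _; rewrite addn0 tree_size_tl.
by rewrite muln0 addn0.
Qed.

Lemma ptimeb_leq f g : ptime f -> ptime g -> ptimeb (fun d => tree_nat (f d) <= tree_nat (g d)).
Proof.
move=> Hf Hg; apply: eq_ptimeb (ptimeb_not (ptimeb_is_node (ptime_drop Hg Hf))) => d.
by rewrite is_nodeE /tree_nat dec_seq_drop size_drop /tree_nat; slia.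
Qed.

Lemma ptimeb_eq f g : ptime f -> ptime g -> ptimeb (fun d => tree_nat (f d) == tree_nat (g d)).
Proof.
move=> Hf Hg; apply: eq_ptimeb (ptimeb_and (ptimeb_leq Hf Hg) (ptimeb_leq Hg Hf)) => d.
by rewrite -eqn_leq.
Qed.

Definition succ_mod4 (t : tree) : tree :=
  if is_node (tl_tree (tl_tree t)) then Leaf else Node Leaf t.

Lemma succ_mod4E k : succ_mod4 (nat_tree (k %% 4)) = nat_tree (k.+1 %% 4).
Proof.
rewrite -[k.+1]addn1 -modnDml.
by move: (k %% 4) (ltn_pmod k (isT : 0 < 4)); do 4 case=> //.
Qed.

Lemma foldl_succ_mod4 (s : seq tree) :
  foldl (fun acc _ => succ_mod4 acc) Leaf s = nat_tree (size s %% 4).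
Proof.
by elim/last_ind: s => //= s x IH; rewrite foldl_rcons IH succ_mod4E size_rcons.
Qed.

Lemma ptimeb_mod4 f : ptime f -> ptimeb (fun d => tree_nat (f d) %% 4 == 2).
Proof.
move=> Hf; have fold_ptime :
    ptime (fun d => foldl (fun acc _ => succ_mod4 acc) Leaf (dec_seq (f d))).
  apply: (@ptime_foldl (fun acc x d => succ_mod4 acc) (fun=> Leaf) f (fun=> 8)) => //.
  - by rewrite /succ_mod4; ptime_tac.
  - exact: ptime_leaf.
  - exact: nat_poly_const.
  move=> d k; rewrite foldl_succ_mod4.
  by move: (_ %% 4) (ltn_pmod (size (take k (dec_seq (f d)))) (isT : 0 < 4)); do 4 case=> //.
have two : ptime (fun=> nat_tree 2) by rewrite /nat_tree /=; ptime_tac.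
apply: eq_ptimeb (ptimeb_eq fold_ptime two) => d.
by rewrite foldl_succ_mod4 !tree_nat_treeK.
Qed.

Fixpoint nat_trees (k : nat) : tree :=
  if k is k'.+1 then Node (nat_tree k') (nat_trees k') else Leaf.

Lemma has_nat_trees P k : has P (dec_seq (nat_trees k)) = [exists i : 'I_k, P (nat_tree i)].
Proof.
elim: k => [|k IH] /=; first by apply/esym/existsP => -[[]].
rewrite IH; apply/orP/existsP => [[Pk|/existsP[i Pi]]|[i Pi]].
- by exists ord_max.
- by exists (lift ord_max i); rewrite lift_max.
- have [ik|ik] := eqVneq (i : nat) k; first by left; rewrite -ik.
  have ik' : i < k by have := ltn_ord i; slia.
  by right; apply/existsP; exists (Ordinal ik').
Qed.

Lemma tree_size_nat_tree k : tree_size (nat_tree k) = k.*2.+1.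
Proof. by elim: k => //= k; rewrite /nat_tree /= => ->; slia. Qed.

Lemma tree_size_nat_trees k : tree_size (nat_trees k) = 1 + k * k.+1.
Proof. by elim: k => //= k ->; rewrite tree_size_nat_tree; nia. Qed.

Definition push_nat_tree (t : tree) : tree :=
  Node (if is_node t then Node Leaf (hd_tree t) else Leaf) t.

Lemma foldl_push_nat_tree (s : seq tree) :
  foldl (fun acc _ => push_nat_tree acc) Leaf s = nat_trees (size s).
Proof.
elim/last_ind: s => //= s x IH; rewrite foldl_rcons IH size_rcons.
by case: (size s).
Qed.

Lemma ptime_nat_trees f : ptime f -> ptime (fun d => nat_trees (tree_nat (f d))).
Proof.
move=> Hf; have [q Hq f_size] := ptime_size Hf.
have fold_ptime : ptime (fun d => foldl (fun acc _ => push_nat_tree acc) Leaf (dec_seq (f d))).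
  apply: (@ptime_foldl (fun acc x d => push_nat_tree acc) (fun=> Leaf) f
    (fun n => 1 + q n * (1 + q n))) => //; try by rewrite /push_nat_tree; ptime_tac.
    by nat_poly_tac.
  move=> d k; rewrite foldl_push_nat_tree tree_size_nat_trees leq_add2l.
  have size_q : size (take k (dec_seq (f d))) <= q (tree_size d).
    apply: leq_trans (f_size d); apply: leq_trans (ltnW (size_dec_seq (f d))).
    by rewrite size_take_min geq_minr.
  by apply: leq_mul => //; rewrite add1n.
by apply: eq_ptime fold_ptime => d; rewrite foldl_push_nat_tree.
Qed.

Definition pair_with (x acc u : tree) : tree :=
  foldl (fun acc' y => Node (Node x y) acc') acc (dec_seq u).

Definition tree_prod (t u : tree) : tree :=
  foldl (fun acc x => pair_with x acc u) Leaf (dec_seq t).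

Lemma dec_seq_pair_with x acc u :
  dec_seq (pair_with x acc u) = rev [seq Node x y | y <- dec_seq u] ++ dec_seq acc.
Proof.
rewrite /pair_with; elim: (dec_seq u) acc => //= y s IH acc.
by rewrite IH rev_cons cat_rcons.
Qed.

Lemma dec_seq_prod t u :
  dec_seq (tree_prod t u) = rev [seq Node x y | x <- dec_seq t, y <- dec_seq u].
Proof.
rewrite /tree_prod -[RHS]cats0 -[X in _ ++ X]/(dec_seq Leaf).
elim: (dec_seq t) Leaf => //= x s IH acc.
by rewrite IH dec_seq_pair_with rev_cat catA.
Qed.

Lemma tree_size_pair_with x acc u :
  tree_size (pair_with x acc u) <= tree_size acc + tree_size u * (2 + tree_size x + tree_size u).
Proof.
rewrite /pair_with -[dec_seq u]take_size; apply: tree_size_foldl => acc' y Hy /=.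
by slia.
Qed.

Lemma ptime_pair_with f g h :
  ptime f -> ptime g -> ptime h -> ptime (fun d => pair_with (f d) (g d) (h d)).
Proof.
move=> Hf Hg Hh; have [p Hp f_size] := ptime_size Hf.
have [q Hq g_size] := ptime_size Hg; have [r Hr h_size] := ptime_size Hh.
apply: (@ptime_foldl (fun acc y d => Node (Node (f d) y) acc) g h
  (fun n => q n + r n * (2 + p n + r n))) => //; last first.
- move=> d k; apply: leq_trans
    (tree_size_foldl (c := 2 + tree_size (f d) + tree_size (h d)) _ _ _) _.
    by move=> acc y Hy /=; slia.
  by rewrite leq_add // leq_mul // leq_add // leq_add2l.
- by nat_poly_tac.
have Hf' : ptime (fun e => f (tl_tree (tl_tree e))).
  by apply: (@ptime_comp (fun e => tl_tree (tl_tree e))) => //; ptime_tac.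
by ptime_tac.
Qed.

Lemma ptime_prod f g : ptime f -> ptime g -> ptime (fun d => tree_prod (f d) (g d)).
Proof.
move=> Hf Hg; have [q Hq f_size] := ptime_size Hf; have [r Hr g_size] := ptime_size Hg.
apply: (@ptime_foldl (fun acc x d => pair_with x acc (g d)) (fun=> Leaf) f
   (fun n => 1 + q n * (r n * (2 + q n + r n)))) => //.
- apply: ptime_pair_with; try by ptime_tac.
  by apply: (@ptime_comp (fun e => tl_tree (tl_tree e))) => //; ptime_tac.
- exact: ptime_leaf.
- by nat_poly_tac.
move=> d k; apply: leq_trans (tree_size_foldl
  (c := tree_size (g d) * (2 + tree_size (f d) + tree_size (g d))) _ _ _) _.
  move=> acc x Hx; apply: leq_trans (tree_size_pair_with _ _ _) _.
  by rewrite leq_add2l leq_mul // leq_add2r leq_add2l.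
rewrite leq_add2l; do 2 (apply: leq_mul => //).
by rewrite leq_add // leq_add2l.
Qed.

Definition env_get (x : nat) (env : tree) : tree := hd_tree (iter x tl_tree env).

Fixpoint env_set (x : nat) (v env : tree) : tree :=
  if x is x'.+1 then Node (hd_tree env) (env_set x' v (tl_tree env)) else Node v (tl_tree env).

Lemma env_get_set x v env y : env_get y (env_set x v env) = if x == y then v else env_get y env.
Proof.
elim: x y env => [|x IH] [|y] env //=; rewrite /env_get ?iterSr //=.
exact: IH.
Qed.

Lemma ptime_env_get x f : ptime f -> ptime (fun d => env_get x (f d)).
Proof. by move=> Hf; apply: ptime_hd; elim: x => //= x; apply: ptime_tl. Qed.

Lemma ptime_env_set x f g : ptime f -> ptime g -> ptime (fun d => env_set x (f d) (g d)).
Proof. by move=> Hf; elim: x g => [|x IH] g Hg /=; ptime_tac; apply: IH; ptime_tac. Qed.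

Ltac ptime_env_tac := repeat first [ ptime_step | lazymatch goal with
  | |- ptime (fun _ => env_get _ _) => apply ptime_env_get
  | |- ptime (fun _ => env_set _ _ _) => apply ptime_env_set
  end ].

Lemma ptimeb_comp3 (P : tree -> tree -> tree -> bool) f g h :
  ptimeb (fun e => P (hd_tree e) (hd_tree (tl_tree e)) (tl_tree (tl_tree e))) ->
  ptime f -> ptime g -> ptime h -> ptimeb (fun d => P (f d) (g d) (h d)).
Proof.
move=> HP Hf Hg Hh; exact: (ptimeb_comp (ptime_node Hf (ptime_node Hg Hh)) HP).
Qed.

(* The end points of the walks of length [k] that start at [a], as a subset of [U]. *)
Definition tree_walk (e : tree -> tree -> bool) (U a k : tree) : tree :=
  foldl (fun acc _ => tree_filter (fun v => has (fun u => e u v) (dec_seq acc)) U)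
    (Node a Leaf) (dec_seq k).

Lemma ptime_tree_walk (P : tree -> tree -> tree -> bool) U a k :
  ptimeb (fun e => P (hd_tree e) (hd_tree (tl_tree e)) (tl_tree (tl_tree e))) ->
  ptime U -> ptime a -> ptime k ->
  ptime (fun d => tree_walk (fun u v => P u v d) (U d) (a d) (k d)).
Proof.
move=> HP HU Ha Hk; have [q Hq U_size] := ptime_size HU; have [r Hr a_size] := ptime_size Ha.
apply: (@ptime_foldl
  (fun acc _ d => tree_filter (fun v => has (fun u => P u v d) (dec_seq acc)) (U d))
  (fun d => Node (a d) Leaf) k (fun n => (r n + 2) + (1 + q n * (1 + q n)))) => //.
- apply: (@ptime_filter
    (fun v e => has (fun u => P u v (tl_tree (tl_tree e))) (dec_seq (hd_tree e)))
    (fun e => U (tl_tree (tl_tree e)))).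
    apply: (@ptimeb_has (fun u e => P u (hd_tree e) (tl_tree (tl_tree (tl_tree e))))
      (fun e => hd_tree (tl_tree e))); last by ptime_tac.
    by apply: ptimeb_comp3 => //; ptime_tac.
  by apply: (@ptime_comp (fun e => tl_tree (tl_tree e))) => //; ptime_tac.
- by ptime_tac.
- by nat_poly_tac.
move=> d m; case: (lastP (take m _)) => [|s x].
  by rewrite /=; have := a_size d; slia.
rewrite foldl_rcons; apply: leq_trans (leq_addl _ _).
apply: leq_trans (tree_size_filter _ _) _.
by rewrite leq_add2l leq_mul // leq_add2l.
Qed.

(** * Formulas over graphs *)

(* Formulas over a finite graph with two sorts of variables, vertices and numbers below
   the number of vertices.  [FMod l] says that the sum of the variables in [l] is 2
   modulo 4, and [FWalk x y f s t k] that some walk of length [k] leads from [s] to [t],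
   with steps [x, y] satisfying [f]. *)
Inductive formula :=
  | FAdj of nat & nat
  | FEq of nat & nat
  | FSum of nat & nat & nat
  | FMod of seq nat
  | FNot of formula
  | FAnd of formula & formula
  | FEx of nat & formula
  | FExN of nat & formula
  | FWalk of nat & nat & formula & nat & nat & nat.

Definition assign (A : Type) x (v : A) (r : nat -> A) : nat -> A :=
  fun y => if x == y then v else r y.

Lemma eq_assign (A : Type) x (v : A) r r' : r =1 r' -> assign x v r =1 assign x v r'.
Proof. by move=> E y; rewrite /assign E. Qed.

Section Semantics.
Variables (V : finType) (adj : rel V).

Fixpoint sat (rv : nat -> V) (rn : nat -> nat) (f : formula) : bool :=
  match f with
  | FAdj x y => adj (rv x) (rv y)
  | FEq x y => rv x == rv y
  | FSum i j k => rn i + rn j == rn k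
  | FMod l => (\sum_(i <- l) rn i) %% 4 == 2
  | FNot f => ~~ sat rv rn f
  | FAnd f g => sat rv rn f && sat rv rn g
  | FEx x f => [exists v, sat (assign x v rv) rn f]
  | FExN i f => [exists k : 'I_#|V|, sat rv (assign i (k : nat) rn) f]
  | FWalk x y f s t k =>
      walkb (fun u v => sat (assign y v (assign x u rv)) rn f) (rn k) (rv s) (rv t)
  end.

Lemma eq_sat f rv rv' rn rn' : rv =1 rv' -> rn =1 rn' -> sat rv rn f = sat rv' rn' f.
Proof.
elim: f rv rv' rn rn' => [x y|x y|i j k|l|f IH|f IHf g IHg|x f IH|i f IH|x y f IH s t k]
  rv rv' rn rn' Ev En /=; rewrite ?Ev ?En //.
- by under eq_bigr do rewrite En.
- by rewrite (IH rv rv' rn rn').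
- by rewrite (IHf rv rv' rn rn') // (IHg rv rv' rn rn').
- by apply: eq_existsb => v; apply: IH => //; apply: eq_assign.
- by apply: eq_existsb => v; apply: IH => //; apply: eq_assign.
- by apply: eq_walkb => u v; apply: IH => //; do 2 apply: eq_assign.
Qed.

End Semantics.

Section Program.
Variables (adjt eqt : tree -> tree -> tree -> bool) (univ : tree -> tree).

(* The variables of the two sorts have their values in the lists [venv] and [nenv]. *)
Fixpoint eval_formula (inp venv nenv : tree) (f : formula) : bool :=
  match f with
  | FAdj x y => adjt (env_get x venv) (env_get y venv) inp
  | FEq x y => eqt (env_get x venv) (env_get y venv) inp
  | FSum i j k =>
      tree_nat (env_get i nenv) + tree_nat (env_get j nenv) == tree_nat (env_get k nenv)
  | FMod l => (\sum_(i <- l) tree_nat (env_get i nenv)) %% 4 == 2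
  | FNot f => ~~ eval_formula inp venv nenv f
  | FAnd f g => eval_formula inp venv nenv f && eval_formula inp venv nenv g
  | FEx x f => has (fun v => eval_formula inp (env_set x v venv) nenv f) (dec_seq (univ inp))
  | FExN i f => has (fun k => eval_formula inp venv (env_set i k nenv) f)
                    (dec_seq (nat_trees (tree_nat (univ inp))))
  | FWalk x y f s t k =>
      has (fun v => eqt v (env_get t venv) inp)
        (dec_seq (tree_walk (fun u v => eval_formula inp (env_set y v (env_set x u venv)) nenv f)
                            (univ inp) (env_get s venv) (env_get k nenv)))
  end.

Section Complexity.
Hypothesis adjt_ptime :
  ptimeb (fun e => adjt (hd_tree e) (hd_tree (tl_tree e)) (tl_tree (tl_tree e))).
Hypothesis eqt_ptime :
  ptimeb (fun e => eqt (hd_tree e) (hd_tree (tl_tree e)) (tl_tree (tl_tree e))).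
Hypothesis univ_ptime : ptime univ.

Lemma ptimeb_sum_mod4 env l : ptime env ->
  ptimeb (fun d => (\sum_(i <- l) tree_nat (env_get i (env d))) %% 4 == 2).
Proof.
move=> Henv; have [g Hg gE] : exists2 g, ptime g &
    forall d, tree_nat (g d) = \sum_(i <- l) tree_nat (env_get i (env d)).
  elim: l => [|i l [g Hg gE]].
    by exists (fun=> Leaf) => [|d]; [exact: ptime_leaf | rewrite big_nil].
  exists (fun d => tree_cat (env_get i (env d)) (g d)) => [|d].
    by apply: ptime_cat => //; apply: ptime_env_get.
  by rewrite tree_nat_cat big_cons gE.
by apply: eq_ptimeb (ptimeb_mod4 Hg) => d; rewrite gE.
Qed.

Lemma ptimeb_eval_formula f :
  ptimeb (fun d => eval_formula (tl_tree (tl_tree d)) (hd_tree d) (hd_tree (tl_tree d)) f).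
Proof.
have Huniv : ptime (fun d => univ (tl_tree (tl_tree d))).
  by apply: (ptime_comp (f := fun d => tl_tree (tl_tree d))) => //; ptime_tac.
elim: f => [x y|x y|i j k|l|f IH|f IHf g IHg|x f IH|i f IH|x y f IH s t k] /=.
- by apply: ptimeb_comp3 => //; ptime_env_tac.
- by apply: ptimeb_comp3 => //; ptime_env_tac.
- have var_ptime x : ptime (fun d => env_get x (hd_tree (tl_tree d))) by ptime_env_tac.
  apply: eq_ptimeb (ptimeb_eq (ptime_cat (var_ptime i) (var_ptime j)) (var_ptime k)) => d.
  by rewrite tree_nat_cat.
- by apply: ptimeb_sum_mod4; ptime_tac.
- exact: ptimeb_not.
- exact: ptimeb_and.
- apply: (@ptimeb_has (fun v d =>
    eval_formula (tl_tree (tl_tree d)) (env_set x v (hd_tree d)) (hd_tree (tl_tree d)) f)) => //.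
  by apply: (ptimeb_comp3 (P := fun ev en d => eval_formula d ev en f)) => //; ptime_env_tac.
- apply: (@ptimeb_has (fun k d =>
    eval_formula (tl_tree (tl_tree d)) (hd_tree d) (env_set i k (hd_tree (tl_tree d))) f)).
    by apply: (ptimeb_comp3 (P := fun ev en d => eval_formula d ev en f)) => //; ptime_env_tac.
  exact: ptime_nat_trees.
apply: (@ptimeb_has (fun v d => eqt v (env_get t (hd_tree d)) (tl_tree (tl_tree d)))).
  by apply: ptimeb_comp3 => //; ptime_env_tac.
apply: (@ptime_tree_walk (fun u v d => eval_formula (tl_tree (tl_tree d))
  (env_set y v (env_set x u (hd_tree d))) (hd_tree (tl_tree d)) f)) => //; try by ptime_env_tac.
by apply: (ptimeb_comp3 (P := fun ev en d => eval_formula d ev en f)) => //; ptime_env_tac.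
Qed.

End Complexity.

Section Correctness.
Variables (V : finType) (adj : rel V) (R : tree -> V -> Prop) (inp : tree).
Hypothesis adjtE : forall t t' u v, R t u -> R t' v -> adjt t t' inp = adj u v.
Hypothesis eqtE : forall t t' u v, R t u -> R t' v -> eqt t t' inp = (u == v).
Variables (enc : V -> tree) (vs : seq V).
Hypotheses (univE : dec_seq (univ inp) = map enc vs) (enc_R : forall v, R (enc v) v).
Hypotheses (vs_all : forall v, v \in vs) (size_vs : size vs = #|V|).

Lemma has_univ P (p : pred V) :
  (forall t v, R t v -> P t = p v) -> has P (dec_seq (univ inp)) = [exists v, p v].
Proof.
move=> Pp; rewrite univE has_map; apply/hasP/existsP => [[v _ /=]|[v pv]].
  by rewrite (Pp _ v) //; exists v.
by exists v => //=; rewrite (Pp _ v).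
Qed.

Lemma has_tree_walk e (r : rel V) a s k P (p : pred V) :
  (forall t t' u v, R t u -> R t' v -> e t t' = r u v) -> R a s ->
  (forall t v, R t v -> P t = p v) ->
  has P (dec_seq (tree_walk e (univ inp) a k)) = [exists v, walkb r (tree_nat k) s v && p v].
Proof.
move=> er as_R; rewrite /tree_walk /tree_nat.
elim/last_ind: (dec_seq k) P p => [|l z IH] P p Pp.
  rewrite /= (Pp _ _ as_R) orbF; apply/idP/existsP => [ps|[v /andP[/eqP <-]] //].
  by exists s; rewrite eqxx.
rewrite foldl_rcons has_tree_filter size_rcons.
apply: has_univ => t v tv; rewrite walkb_rcons (Pp _ _ tv); congr (_ && _).
by apply: IH => t' u tu; apply: er.
Qed.

Lemma eval_formulaE f venv nenv rv rn :
  (forall x, R (env_get x venv) (rv x)) -> (forall i, tree_nat (env_get i nenv) = rn i) ->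
  eval_formula inp venv nenv f = sat adj rv rn f.
Proof.
have R_set x t v venv' rv' : (forall x, R (env_get x venv') (rv' x)) -> R t v ->
    forall y, R (env_get y (env_set x t venv')) (assign x v rv' y).
  by move=> Rv tv y; rewrite env_get_set /assign; case: ifP.
elim: f venv nenv rv rn => [x y|x y|i j k|l|f IH|f IHf g IHg|x f IH|i f IH|x y f IH s t k]
  venv nenv rv rn Rv nE /=.
- exact: adjtE.
- exact: eqtE.
- by rewrite !nE.
- by under eq_bigr do rewrite nE.
- by rewrite (IH venv nenv rv rn).
- by rewrite (IHf venv nenv rv rn) // (IHg venv nenv rv rn).
- by apply: has_univ => t v tv; apply: IH => //; apply: R_set.
- rewrite has_nat_trees /tree_nat univE size_map size_vs; apply: eq_existsb => k.
  by apply: IH => // j; rewrite env_get_set /assign; case: eqP; rewrite ?tree_nat_treeK.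
rewrite (@has_tree_walk _ (fun u v => sat adj (assign y v (assign x u rv)) rn f) _ (rv s) _ _
  (pred1 (rv t))) => [||//|t' v tv]; last exact: eqtE.
  by rewrite nE; apply/existsP/idP => [[v /andP[W /eqP <-]] //|W]; exists (rv t); rewrite W /=.
by move=> t1 t2 u v tu tv; apply: IH => //; do 2 (apply: (R_set) => //).
Qed.

End Correctness.
End Program.

Definition FTrue := FEq 0 0.
Definition FOr f g := FNot (FAnd (FNot f) (FNot g)).
Definition FImp f g := FNot (FAnd f (FNot g)).
Definition FAll x f := FNot (FEx x (FNot f)).
Definition FAllN x f := FNot (FExN x (FNot f)).
Definition FBig (I : finType) (F : I -> formula) :=
  foldr FAnd FTrue [seq F i | i <- enum I].
Definition FExs (l : seq nat) f := foldr FEx f l.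
Definition FExNs (l : seq nat) f := foldr FExN f l.

Section Derived.
Variables (V : finType) (adj : rel V).
Notation sat := (sat adj).

Lemma sat_or rv rn f g : sat rv rn (FOr f g) = sat rv rn f || sat rv rn g.
Proof. by rewrite /= negb_and !negbK. Qed.

Lemma sat_imp rv rn f g : sat rv rn (FImp f g) = (sat rv rn f ==> sat rv rn g).
Proof. by rewrite /= negb_and negbK implybE. Qed.

Lemma sat_all rv rn x f : sat rv rn (FAll x f) = [forall v, sat (assign x v rv) rn f].
Proof. by rewrite /= negb_exists; under eq_forallb do rewrite negbK. Qed.

Lemma sat_alln rv rn x f : sat rv rn (FAllN x f) =
  [forall k : 'I_#|V|, sat rv (assign x (k : nat) rn) f].
Proof. by rewrite /= negb_exists; under eq_forallb do rewrite negbK. Qed.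

Lemma sat_big rv rn (I : finType) (F : I -> formula) :
  sat rv rn (FBig F) = [forall i, sat rv rn (F i)].
Proof.
have all_sat s : sat rv rn (foldr FAnd FTrue [seq F i | i <- s]) = all (fun i => sat rv rn (F i)) s.
  by elim: s => [|i s IH] /=; rewrite ?eqxx // IH.
rewrite /FBig all_sat; apply/allP/forallP => [F_sat i|F_sat i _ //].
by apply: F_sat; apply: mem_enum.
Qed.

Let assign_notin (A : Type) x (v : A) (r : nat -> A) y l :
  y \notin x :: l -> assign x v r y = r y /\ y \notin l.
Proof. by rewrite inE negb_or /assign eq_sym => /andP[/negbTE ->]. Qed.

Let assign_agree (A : Type) x (r r' : nat -> A) l : (forall y, y \notin x :: l -> r' y = r y) ->
  forall y, y \notin l -> r' y = assign x (r' x) r y.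
Proof.
move=> E y yl; rewrite /assign; case: eqP => [<- //|xy]; apply: E.
by rewrite inE negb_or yl andbT eq_sym; apply/eqP.
Qed.

Lemma sat_exs l rv rn f : sat rv rn (FExs l f) <->
  exists2 rv', (forall y, y \notin l -> rv' y = rv y) & sat rv' rn f.
Proof.
elim: l rv => [|x l IH] rv /=.
  split=> [f_sat|[rv' agree]]; first by exists rv.
  by rewrite (@eq_sat _ adj f rv' rv rn rn) // => y; rewrite agree.
split=> [/existsP[v /IH[rv' agree f_sat]]|[rv' agree f_sat]].
  by exists rv' => // y xl; have [<- yl] := assign_notin v rv xl; apply: agree.
by apply/existsP; exists (rv' x); apply/IH; exists rv' => //; apply: assign_agree.
Qed.

Lemma sat_exns l rv rn f : sat rv rn (FExNs l f) <->
  exists rn', [/\ forall y, y \notin l -> rn' y = rn y, forall y, y \in l -> rn' y < #|V|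
                & sat rv rn' f].
Proof.
elim: l rn => [|x l IH] rn /=.
  split=> [f_sat|[rn' [agree _]]]; first by exists rn.
  by rewrite (@eq_sat _ adj f rv rv rn' rn) // => y; rewrite agree.
split=> [/existsP[k /IH[rn' [agree bound f_sat]]]|[rn' [agree bound f_sat]]].
  exists rn'; split=> // y.
    by move=> xl; have [<- yl] := assign_notin (k : nat) rn xl; apply: agree.
  rewrite inE; have [yl _|yl] := boolP (y \in l); first exact: bound.
  by rewrite orbF => /eqP yx; rewrite agree // yx /assign eqxx ltn_ord.
have xb : rn' x < #|V| by apply: bound; rewrite inE eqxx.
apply/existsP; exists (Ordinal xb); apply/IH; exists rn'; split=> // [|y yl].
  exact: assign_agree.
by apply: bound; rewrite inE yl orbT.
Qed.

End Derived.

(** * The formula for unbalanced holes *)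

Local Infix "&&&" := FAnd (at level 60, right associativity).

Definition FNadj x y := FNot (FAdj x y).

(* [f] is about variable 0 and [g] about variable 1. *)
Definition FAllPairs f g h := FAll 0 (FAll 1 (FImp f (FImp g h))).

Definition hexagon_formula : formula := FExs (iota 0 6)
  ((FAdj 0 4 &&& FAdj 0 5 &&& FAdj 1 3 &&& FAdj 1 5 &&& FAdj 2 3 &&& FAdj 2 4) &&&
   FNadj 0 3 &&& FNadj 1 4 &&& FNadj 2 5).

(* The temporary variables come first, so that updating them leaves the frame variables
   unchanged by mere computation. *)
Definition end_var (b : bool) := b.+4.
Definition start_var (i : 'I_3) (b : bool) := (2 * i + b).+4.+2.
Definition mid_var (i : 'I_3) (b : bool) := (2 * i + b).+4.+4.+4.
Definition len_var (i : 'I_3) := i.+2.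

Definition free_formula (i : 'I_3) v : formula :=
  FBig (fun c : bool => FNadj v (end_var c)) &&&
  FBig (fun i' : 'I_3 =>
    if i' == i then FTrue else FBig (fun c : bool => FNadj v (start_var i' c))).

Definition free_walk_formula i s t k : formula :=
  FWalk 2 3 (FAdj 2 3 &&& free_formula i 3) s t k.

Definition between_formula i b v : formula := FExNs [:: 0; 1]
  (FSum 0 1 (len_var i) &&&
   free_walk_formula i (start_var i b) v 0 &&& free_walk_formula i v (mid_var i b) 1).

Definition theta_frame_formula : formula :=
  FNadj (end_var false) (end_var true) &&&
  FBig (fun i => FBig (fun b => FAdj (end_var b) (start_var i b))) &&&
  FBig (fun i => FAdj (mid_var i false) (mid_var i true)) &&&
  FBig (fun i => FBig (fun b =>
    free_walk_formula i (start_var i b) (mid_var i b) (len_var i))) &&&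
  FBig (fun i => FBig (fun i' => FBig (fun b => FBig (fun b' =>
    if i == i' then FTrue else
    FAllPairs (between_formula i b 0) (between_formula i' b' 1) (FNot (FEq 0 1) &&& FNadj 0 1))))).

Definition theta_formula : formula := FExs (iota 4 14) (FExNs (iota 2 3) theta_frame_formula).

Definition component_formula (x y : nat) (F : nat -> formula) r v : formula :=
  F r &&& FExN 0 (FWalk x y (FAdj x y &&& F x &&& F y) r v 0).

Definition joined_formula a b r (K : nat -> formula) : formula :=
  FOr (FAdj a b) (FAdj a r &&& FEx 0 (K 0 &&& FAdj 0 b)).

Definition tent_zone1_formula v : formula :=
  FNadj v 6 &&& FNadj v 7 &&& FNadj v 8 &&& FNadj v 9 &&& FNadj v 13 &&& FNadj v 14.

Definition tent_part1_formula v : formula :=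
  FOr (FEq v 10) (FOr (FEq v 11) (component_formula 4 5 tent_zone1_formula 12 v)).

Definition tent_zone2_formula v : formula :=
  (FNadj v 6 &&& FNadj v 7 &&& FNadj v 8 &&& FNadj v 9) &&&
  FAll 1 (FImp (tent_part1_formula 1) (FNot (FEq 1 v) &&& FNadj 1 v)).

Definition tent_frame_formula : formula :=
  FAdj 6 7 &&&
  (FAdj 6 10 &&& FAdj 6 13 &&& FAdj 8 10 &&& FAdj 8 13) &&&
  (FAdj 7 11 &&& FAdj 7 14 &&& FAdj 9 11 &&& FAdj 9 14) &&&
  (FNadj 8 9 &&& FNadj 8 7 &&& FNadj 6 9) &&&
  joined_formula 10 11 12 (component_formula 4 5 tent_zone1_formula 12) &&&
  joined_formula 13 14 15 (component_formula 2 3 tent_zone2_formula 15) &&&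
  FAll 0 (FImp (tent_part1_formula 0)
    (FNot (FEq 0 13) &&& FNot (FEq 0 14) &&& FNadj 0 13 &&& FNadj 0 14)).

Definition tent_formula : formula := FExs (iota 6 10) tent_frame_formula.

Definition corner_var (i : 'I_5) := i.+4.+4.+2.
Definition gap_var (i : 'I_5) := i.+3.

Definition clean_formula v : formula :=
  FImp (FAdj v 4) (FOr (FEq v 5) (FEq v 6)) &&& FImp (FAdj v 7) (FOr (FEq v 8) (FEq v 9)).

Definition clean_walk_formula s t k : formula :=
  FWalk 2 3 (FAdj 2 3 &&& clean_formula 2 &&& clean_formula 3) s t k.

Definition pos_formula k : formula := FNot (FSum k k k).

Definition gt1_formula k : formula :=
  FExNs [:: 0; 1] (FSum 0 1 k &&& pos_formula 0 &&& pos_formula 1).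

Definition shortest_formula (i : 'I_5) : formula :=
  FAllN 0 (FAllN 1 (FImp (FSum 0 1 (gap_var i) &&& pos_formula 1)
    (FNot (clean_walk_formula (corner_var i) (corner_var (ordS i)) 0)))).

Definition sector_formula (i : 'I_5) v : formula := FExNs [:: 0; 1]
  (FSum 0 1 (gap_var i) &&& pos_formula 1 &&&
   clean_walk_formula (corner_var i) v 0 &&& clean_walk_formula v (corner_var (ordS i)) 1).

Definition hole_frame_formula : formula :=
  FBig (fun i => gt1_formula (gap_var i)) &&&
  FBig (fun i => clean_walk_formula (corner_var i) (corner_var (ordS i)) (gap_var i)) &&&
  FBig shortest_formula &&&
  FBig (fun i => FAllPairs (sector_formula i 0) (sector_formula (ordS i) 1)
    (FNot (FEq 0 1) &&& FImp (FAdj 0 1) (FEq 1 (corner_var (ordS i))))) &&&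
  FBig (fun i => FAllPairs (sector_formula i 0) (sector_formula (ordS (ordS i)) 1)
    (FNot (FEq 0 1) &&& FNadj 0 1)) &&&
  FMod (iota 3 5).

Definition hole_formula : formula := FExs (iota 4 11) (FExNs (iota 3 5) hole_frame_formula).

Definition unbalanced_formula : formula :=
  FOr hexagon_formula (FOr theta_formula (FOr tent_formula hole_formula)).

Section Meaning.
Variables (T : finType) (adj : rel T).
Notation sat := (sat adj).

Lemma sat_and rv rn f g : sat rv rn (FAnd f g) = sat rv rn f && sat rv rn g.
Proof. by []. Qed.

Lemma sat_not rv rn f : sat rv rn (FNot f) = ~~ sat rv rn f.
Proof. by []. Qed.

Lemma sat_sum rv rn i j k : sat rv rn (FSum i j k) = (rn i + rn j == rn k).
Proof. by []. Qed.

Lemma sat_exn rv rn i f :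
  sat rv rn (FExN i f) = [exists k : 'I_#|T|, sat rv (assign i (k : nat) rn) f].
Proof. by []. Qed.

Lemma sat_walk rv rn x y f s t k : sat rv rn (FWalk x y f s t k) =
  walkb (fun u v => sat (assign y v (assign x u rv)) rn f) (rn k) (rv s) (rv t).
Proof. by []. Qed.

Lemma sat_bigP rv rn (I : finType) (F : I -> formula) :
  reflect (forall i, sat rv rn (F i)) (sat rv rn (FBig F)).
Proof. by rewrite sat_big; apply: forallP. Qed.

Lemma sat_exn2 rv rn f : sat rv rn (FExNs [:: 0; 1] f) <->
  exists j1 j2, [/\ j1 < #|T|, j2 < #|T| & sat rv (assign 1 j2 (assign 0 j1 rn)) f].
Proof.
split=> [/existsP[j1 /existsP[j2 f_sat]]|[j1 [j2 [b1 b2 f_sat]]]].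
  by exists j1, j2; split=> //; apply: ltn_ord.
by apply/existsP; exists (Ordinal b1); apply/existsP; exists (Ordinal b2).
Qed.

Lemma sat_all_pairs rv rn f g h (P Q : T -> Prop) :
  (forall v v', sat (assign 1 v' (assign 0 v rv)) rn f <-> P v) ->
  (forall v v', sat (assign 1 v' (assign 0 v rv)) rn g <-> Q v') ->
  sat rv rn (FAllPairs f g h) <->
  forall v v', P v -> Q v' -> sat (assign 1 v' (assign 0 v rv)) rn h.
Proof.
move=> fP gQ; rewrite /FAllPairs sat_all; split=> [/forallP sat_fgh v v' /fP fv /gQ gv'|h_sat].
  have := sat_fgh v; rewrite sat_all => /forallP/(_ v'); rewrite !sat_imp.
  by move=> /implyP/(_ (fv _))/implyP/(_ (gv' _)).
apply/forallP => v; rewrite sat_all; apply/forallP => v'; rewrite !sat_imp.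
by apply/implyP => /fP Pv; apply/implyP => /gQ; apply: h_sat.
Qed.

Lemma sat_pos rv rn k : sat rv rn (pos_formula k) = (0 < rn k).
Proof. by rewrite sat_not sat_sum; slia. Qed.

Section ThetaFormula.

Let ends (rv : nat -> T) b := rv (end_var b).
Let starts (rv : nat -> T) i b := rv (start_var i b).
Let mids (rv : nat -> T) i b := rv (mid_var i b).
Let lens (rn : nat -> nat) i := rn (len_var i).

Lemma sat_free rv rn i v :
  sat rv rn (free_formula i v) = free_of_ends adj (ends rv) (starts rv) i (rv v).
Proof.
rewrite sat_and !sat_big /free_of_ends; congr (_ && _); apply: eq_forallb => i'.
by case: eqVneq => _ /=; [exact: eqxx | rewrite sat_big].
Qed.

Lemma sat_free_walk rv rn i s t k : sat rv rn (free_walk_formula i s t k) =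
  walkb (free_step adj (ends rv) (starts rv) i) (rn k) (rv s) (rv t).
Proof.
by rewrite sat_walk; apply: eq_walkb => u v; rewrite sat_and sat_free.
Qed.

Lemma sat_between rv rn i b v : lens rn i < #|T| -> sat rv rn (between_formula i b v) <->
  between adj (ends rv) (starts rv) (mids rv) (lens rn) i b (rv v).
Proof.
move=> kb; rewrite /between_formula sat_exn2; split=> [[j1 [j2 [_ _]]]|[j1 [j2 [E W1 W2]]]].
  by rewrite !sat_and !sat_free_walk => /and3P[/eqP E W1 W2]; exists j1, j2.
exists j1, j2; split; try by move: kb; rewrite -E; slia.
by rewrite !sat_and !sat_free_walk sat_sum; apply/and3P; split=> //; apply/eqP.
Qed.

Lemma sat_between_pairs rv rn i i' b b' h : (forall i, lens rn i < #|T|) ->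
  let P i b := between adj (ends rv) (starts rv) (mids rv) (lens rn) i b in
  sat rv rn (FAllPairs (between_formula i b 0) (between_formula i' b' 1) h) <->
  forall v v', P i b v -> P i' b' v' -> sat (assign 1 v' (assign 0 v rv)) rn h.
Proof.
move=> kb; apply: sat_all_pairs => v v'.
  exact: (sat_between (assign 1 v' (assign 0 v rv)) b 0 (kb i)).
exact: (sat_between (assign 1 v' (assign 0 v rv)) b' 1 (kb i')).
Qed.

Lemma sat_theta_frame rv rn : (forall i, lens rn i < #|T|) ->
  sat rv rn theta_frame_formula <-> theta_frame adj (ends rv) (starts rv) (mids rv) (lens rn).
Proof.
move=> kb; rewrite /theta_frame_formula !sat_and; split.
  move=> /and5P[ends_nadj /sat_bigP first /sat_bigP middle /sat_bigP walk /sat_bigP apart].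
  split=> // [i b|i b|i i' b b' v v' ii' Pv Pv'].
  - by have /sat_bigP := first i; apply.
  - by have /sat_bigP/(_ b) := walk i; rewrite sat_free_walk.
  have /sat_bigP/(_ i')/sat_bigP/(_ b)/sat_bigP/(_ b') := apart i; rewrite (negbTE ii').
  by move=> /(sat_between_pairs _ _ _ _ _ _ kb)/(_ v v' Pv Pv'); rewrite sat_and => /andP[].
move=> [ends_nadj first middle walk apart]; apply/and5P; split=> //; apply/sat_bigP => i.
- by apply/sat_bigP => b; apply: first.
- exact: middle.
- by apply/sat_bigP => b; rewrite sat_free_walk; apply: walk.
apply/sat_bigP => i'; apply/sat_bigP => b; apply/sat_bigP => b'.
case: eqVneq => [_|ii']; first exact: eqxx.
apply/sat_between_pairs => // v v' Pv Pv'; rewrite sat_and; apply/andP.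
exact: (apart i i' b b').
Qed.

Lemma sat_theta rv rn : sat rv rn theta_formula <->
  exists r s m k, (forall i, k i < #|T|) /\ theta_frame adj r s m k.
Proof.
rewrite /theta_formula sat_exs; split.
  move=> [rv' _ /sat_exns[rn' [_ bound frame]]].
  have kb i : lens rn' i < #|T|.
    by apply: bound; rewrite mem_iota /len_var; have := ltn_ord i; slia.
  by exists (ends rv'), (starts rv'), (mids rv'), (lens rn'); split=> //; apply/sat_theta_frame.
move=> [r [s [m [k [kb frame]]]]].
pose rv' y := if y < 4 then rv y else if y < 6 then r (odd y) else
  if y < 12 then s (inord (y - 6)./2) (odd y) else
  if y < 18 then m (inord (y - 12)./2) (odd y) else rv y.
pose rn' y := if 2 <= y < 5 then k (inord (y - 2)) else rn y.
have rE : ends rv' = r by apply: functional_extensionality => -[].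
have sE : starts rv' = s.
  by apply: functional_extensionality => -[[|[|[|//]]] Hi]; apply: functional_extensionality => -[];
    rewrite /starts /rv' /=; congr (s _ _); apply/val_inj; rewrite /= inordK.
have mE : mids rv' = m.
  by apply: functional_extensionality => -[[|[|[|//]]] Hi]; apply: functional_extensionality => -[];
    rewrite /mids /rv' /=; congr (m _ _); apply/val_inj; rewrite /= inordK.
have kE : lens rn' = k.
  apply: functional_extensionality => -[[|[|[|//]]] Hi];
    by rewrite /lens /rn' /=; congr k; apply/val_inj; rewrite /= inordK.
exists rv' => [y|]; first by rewrite mem_iota /rv'; do ?[case: ifP => ?] => //; slia.
apply/sat_exns; exists rn'; split=> [y|y|].
- by rewrite mem_iota => yl; rewrite /rn' ifF //; slia.
- by rewrite mem_iota => yl; rewrite /rn' ifT //; slia.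
by apply/sat_theta_frame; rewrite ?rE ?sE ?mE kE.
Qed.

End ThetaFormula.

Section TentFormula.

(* [F] may use the variables from 6 on as parameters and variable 1 as a temporary one. *)
Definition defines (rv : nat -> T) (F : nat -> formula) (P : pred T) : Prop :=
  forall rv' rn z, (forall k, rv' k.+4.+2 = rv k.+4.+2) -> z != 1 ->
    sat rv' rn (F z) = P (rv' z).

Lemma sat_component rv rv' rn F (P : pred T) x y r v : defines rv F P ->
  (forall k, rv' k.+4.+2 = rv k.+4.+2) -> r != 1 -> 1 < x < y -> y < 6 ->
  sat rv' rn (component_formula x y F r v) = component adj P (rv' r) (rv' v).
Proof.
move=> FP E r1 xy y6; rewrite sat_and (FP rv' rn r E r1); congr (_ && _).
have walkE k : sat rv' (assign 0 k rn) (FWalk x y (FAdj x y &&& F x &&& F y) r v 0) =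
    walkb (restrict adj P) k (rv' r) (rv' v).
  rewrite sat_walk; apply: eq_walkb => u w; set rv2 := assign y w _.
  have E' k' : rv2 k'.+4.+2 = rv k'.+4.+2.
    rewrite /rv2 /assign; case: eqP => [?|_]; first by slia.
    by case: eqP => [?|_]; [slia | exact: E].
  have rx : rv2 x = u by rewrite /rv2 /assign eqxx gtn_eqF //; case/andP: xy.
  have ry : rv2 y = w by rewrite /rv2 /assign eqxx.
  by rewrite !sat_and !(FP _ _ _ E') /= ?rx ?ry //; slia.
rewrite sat_exn; apply/existsP/idP => [[k]|/connect_walkb[k kT W]].
  by rewrite walkE => /walkb_connect.
by exists (Ordinal kT); rewrite walkE.
Qed.

Lemma sat_joined rv rn a b r (K : nat -> formula) (P : pred T) :
  (forall v, sat (assign 0 v rv) rn (K 0) = P v) ->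
  sat rv rn (joined_formula a.+1 b.+1 r.+1 K) = joined adj (rv a.+1) (rv b.+1) (rv r.+1) P.
Proof.
move=> KP; rewrite sat_or /joined; congr (_ || _); rewrite /=; congr (_ && _).
by apply: eq_existsb => v; rewrite KP.
Qed.

Variable rv : nat -> T.

Let zone1 := tent_zone1 adj (rv 6) (rv 7) (rv 8) (rv 9) (rv 13) (rv 14).
Let part1 :=
  tent_part1 adj (rv 6) (rv 7) (rv 8) (rv 9) (rv 10) (rv 11) (rv 12) (rv 13) (rv 14).
Let zone2 :=
  tent_zone2 adj (rv 6) (rv 7) (rv 8) (rv 9) (rv 10) (rv 11) (rv 12) (rv 13) (rv 14).

Lemma tent_zone1_defines : defines rv tent_zone1_formula zone1.
Proof.
move=> rv' rn z E _; rewrite /= /zone1 /tent_zone1 !negb_or.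
by rewrite (E 0) (E 1) (E 2) (E 3) (E 7) (E 8).
Qed.

Lemma sat_zone1_component rv' rn z : (forall k, rv' k.+4.+2 = rv k.+4.+2) ->
  sat rv' rn (component_formula 4 5 tent_zone1_formula 12 z) =
  component adj zone1 (rv 12) (rv' z).
Proof. by move=> E; rewrite (sat_component rn z tent_zone1_defines E) // -(E 6). Qed.

Lemma sat_tent_part1 rv' rn z : (forall k, rv' k.+4.+2 = rv k.+4.+2) ->
  sat rv' rn (tent_part1_formula z) = part1 (rv' z).
Proof. by move=> E; rewrite !sat_or sat_zone1_component // /part1 /tent_part1 /= (E 4) (E 5). Qed.

Lemma tent_zone2_defines : defines rv tent_zone2_formula zone2.
Proof.
move=> rv' rn z E z1; rewrite sat_and sat_all /zone2 /tent_zone2; congr (_ && _).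
  by rewrite /= !negb_or (E 0) (E 1) (E 2) (E 3).
apply: eq_forallb => u; rewrite sat_imp sat_tent_part1 => [|k]; last by rewrite /assign /= E.
by congr (_ ==> _); rewrite sat_and /= /assign [1 == z]eq_sym (negbTE z1).
Qed.

Lemma sat_zone2_component rv' rn z : (forall k, rv' k.+4.+2 = rv k.+4.+2) ->
  sat rv' rn (component_formula 2 3 tent_zone2_formula 15 z) =
  component adj zone2 (rv 15) (rv' z).
Proof. by move=> E; rewrite (sat_component rn z tent_zone2_defines E) // -(E 9). Qed.

Lemma sat_tent_frame rn : sat rv rn tent_frame_formula =
  tent_frame adj (rv 6) (rv 7) (rv 8) (rv 9) (rv 10) (rv 11) (rv 12) (rv 13) (rv 14) (rv 15).
Proof.
have apartE : sat rv rn (FAll 0 (FImp (tent_part1_formula 0)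
    (FNot (FEq 0 13) &&& FNot (FEq 0 14) &&& FNadj 0 13 &&& FNadj 0 14))) =
  [forall u, part1 u ==> [&& u != rv 13, u != rv 14, ~~ adj u (rv 13) & ~~ adj u (rv 14)]].
  by rewrite sat_all; apply: eq_forallb => v; rewrite sat_imp sat_tent_part1.
rewrite /tent_frame -/zone1 -/zone2 -/part1 -apartE.
rewrite -(@sat_joined rv rn 9 10 11 (component_formula 4 5 tent_zone1_formula 12)) => [|v];
  last by rewrite sat_zone1_component.
rewrite -(@sat_joined rv rn 12 13 14 (component_formula 2 3 tent_zone2_formula 15)) => [|v];
  last by rewrite sat_zone2_component.
by [].
Qed.

End TentFormula.

Lemma sat_tent rv rn : sat rv rn tent_formula <->
  exists p1 p2 c1 c2 a1 b1 r1 a2 b2 r2, tent_frame adj p1 p2 c1 c2 a1 b1 r1 a2 b2 r2.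
Proof.
rewrite /tent_formula sat_exs; split=> [[rv' _]|].
  by rewrite sat_tent_frame => frame; do 10 eexists; exact: frame.
move=> [p1 [p2 [c1 [c2 [a1 [b1 [r1 [a2 [b2 [r2 frame]]]]]]]]]].
pose l := [:: p1; p2; c1; c2; a1; b1; r1; a2; b2; r2].
exists (fun y => if y < 6 then rv y else nth (rv y) l (y - 6)) => [y|].
  by rewrite mem_iota => yl; case: ltnP => // y6; rewrite nth_default //=; slia.
by rewrite sat_tent_frame.
Qed.

Section HoleFormula.

Let clean_at (rv : nat -> T) := clean adj (rv 4) (rv 5) (rv 6) (rv 7) (rv 8) (rv 9).
Let corners (rv : nat -> T) i := rv (corner_var i).
Let gaps (rn : nat -> nat) i := rn (gap_var i).

Lemma sat_clean rv rn v : sat rv rn (clean_formula v) = (rv v \in clean_at rv).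
Proof. by rewrite inE /clean_formula /= !negb_and !negbK -!implybE. Qed.

Lemma sat_clean_walk rv rn s t k : sat rv rn (clean_walk_formula s t k) =
  walkb (restrict adj (clean_at rv)) (rn k) (rv s) (rv t).
Proof. by rewrite sat_walk; apply: eq_walkb => u v; rewrite 2!sat_and !sat_clean. Qed.

Lemma sat_gt1 rv rn k : rn k.+2 < #|T| -> sat rv rn (gt1_formula k.+2) <-> 1 < rn k.+2.
Proof.
move=> kb; rewrite /gt1_formula sat_exn2; split=> [[j1 [j2 [_ _]]]|k1].
  by rewrite !sat_and !sat_pos sat_sum /assign /= => /and3P[/eqP]; slia.
exists 1, (rn k.+2 - 1); split; try by slia.
by rewrite !sat_and !sat_pos sat_sum /assign /=; apply/andP; split; [apply/eqP |]; slia.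
Qed.

Lemma sat_shortest rv rn i : gaps rn i < #|T| -> sat rv rn (shortest_formula i) <->
  forall b, b < gaps rn i ->
    ~~ walkb (restrict adj (clean_at rv)) b (corners rv i) (corners rv (ordS i)).
Proof.
move=> kb; rewrite /shortest_formula sat_alln; split=> [/forallP none b ba|none].
  have := none (Ordinal (ltn_trans ba kb)); rewrite sat_alln => /forallP.
  have cb : gaps rn i - b < #|T| by slia.
  move=> /(_ (Ordinal cb)); rewrite sat_imp sat_and sat_not sat_pos sat_clean_walk.
  by move=> /implyP; apply; rewrite sat_sum /assign /= subn_gt0 ba subnKC ?(ltnW ba) ?eqxx.
apply/forallP => b; rewrite sat_alln; apply/forallP => b'.
rewrite sat_imp sat_and sat_not sat_sum sat_pos sat_clean_walk /assign /=.
by apply/implyP => /andP[/eqP E b'0]; apply: none; rewrite /gaps -E; slia.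
Qed.

Lemma sat_sector rv rn i v : gaps rn i < #|T| -> sat rv rn (sector_formula i v) <->
  in_sector adj (clean_at rv) (corners rv) (gaps rn) i (rv v).
Proof.
move=> kb; rewrite /sector_formula sat_exn2; split=> [[j1 [j2 [_ _]]]|[j1 [j2 [E j0 W1 W2]]]].
  by rewrite !sat_and !sat_clean_walk sat_pos => /and4P[/eqP E P W1 W2]; exists j1, j2.
exists j1, j2; split; try by move: kb; rewrite -E; slia.
by rewrite !sat_and !sat_clean_walk sat_pos sat_sum; apply/and4P; split=> //; apply/eqP.
Qed.

Lemma sat_sector_pairs rv rn i i' h : (forall i, gaps rn i < #|T|) ->
  let P i := in_sector adj (clean_at rv) (corners rv) (gaps rn) i in
  sat rv rn (FAllPairs (sector_formula i 0) (sector_formula i' 1) h) <->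
  forall v v', P i v -> P i' v' -> sat (assign 1 v' (assign 0 v rv)) rn h.
Proof.
move=> kb; apply: sat_all_pairs => v v'.
  exact: (sat_sector (assign 1 v' (assign 0 v rv)) 0 (kb i)).
exact: (sat_sector (assign 1 v' (assign 0 v rv)) 1 (kb i')).
Qed.

Lemma sum_gaps rn : \sum_(k <- iota 3 5) rn k = \sum_(i < 5) gaps rn i.
Proof. by rewrite -(big_mkord xpredT (fun i => rn i.+3)) /index_iota /= !big_cons !big_nil. Qed.

Lemma sat_hole_frame rv rn : (forall i, gaps rn i < #|T|) ->
  sat rv rn hole_frame_formula <-> hole_frame adj (clean_at rv) (corners rv) (gaps rn).
Proof.
move=> kb; rewrite /hole_frame_formula !sat_and; split.
  move=> /and5P[/sat_bigP long /sat_bigP walk /sat_bigP shortest /sat_bigP next].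
  move=> /andP[/sat_bigP skip /eqP]; rewrite sum_gaps => total.
  split=> // [i|i|i|i v v' Pv Pv'|i v v' Pv Pv'].
  - exact/(sat_gt1 rv (kb i))/long.
  - by have := walk i; rewrite sat_clean_walk.
  - exact/(sat_shortest rv (kb i))/shortest.
  - have /(sat_sector_pairs _ _ _ _ kb)/(_ v v' Pv Pv') := next i.
    by rewrite sat_and sat_imp => /andP[ne /implyP near]; split=> // /near/eqP.
  have /(sat_sector_pairs _ _ _ _ kb)/(_ v v' Pv Pv') := skip i.
  by rewrite sat_and => /andP[].
move=> [long walk shortest next skip total].
apply/and5P; split; [apply/sat_bigP => i..|].
- exact/(sat_gt1 rv (kb i))/long.
- by rewrite sat_clean_walk; apply: walk.
- exact/(sat_shortest rv (kb i))/shortest.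
- apply/sat_sector_pairs => // v v' Pv Pv'; have [ne near] := next i v v' Pv Pv'.
  by rewrite sat_and sat_imp; apply/andP; split=> //; apply/implyP => /near E; apply/eqP.
apply/andP; split; last by apply/eqP; rewrite sum_gaps.
apply/sat_bigP => i; apply/sat_sector_pairs => // v v' Pv Pv'; rewrite sat_and; apply/andP.
exact: skip Pv Pv'.
Qed.

Lemma sat_hole rv rn : sat rv rn hole_formula <->
  exists u um up v vm vp x a,
    (forall i, a i < #|T|) /\ hole_frame adj (clean adj u um up v vm vp) x a.
Proof.
rewrite /hole_formula sat_exs; split.
  move=> [rv' _ /sat_exns[rn' [_ bound frame]]].
  have kb i : gaps rn' i < #|T|.
    by apply: bound; rewrite mem_iota /gap_var; have := ltn_ord i; slia.
  by do 8 eexists; split; last exact: (proj1 (sat_hole_frame _ kb) frame).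
move=> [u [um [up [v [vm [vp [x [a [kb frame]]]]]]]]].
pose rv' y := if y < 4 then rv y else if y < 10 then nth (rv y) [:: u; um; up; v; vm; vp] (y - 4)
  else if y < 15 then x (inord (y - 10)) else rv y.
pose rn' y := if 3 <= y < 8 then a (inord (y - 3)) else rn y.
have xE : corners rv' = x.
  apply: functional_extensionality => -[[|[|[|[|[|//]]]]] Hi];
    by rewrite /corners /rv' /=; congr x; apply/val_inj; rewrite /= inordK.
have aE : gaps rn' = a.
  apply: functional_extensionality => -[[|[|[|[|[|//]]]]] Hi];
    by rewrite /gaps /rn' /=; congr a; apply/val_inj; rewrite /= inordK.
exists rv' => [y|]; first by rewrite mem_iota /rv'; do ?[case: ifP => ?] => //; slia.
apply/sat_exns; exists rn'; split=> [y|y|].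
- by rewrite mem_iota => yl; rewrite /rn' ifF //; slia.
- by rewrite mem_iota => yl; rewrite /rn' ifT //; slia.
by apply/sat_hole_frame; rewrite ?xE aE.
Qed.

End HoleFormula.

Variable side : T -> bool.
Hypothesis adjC : symmetric adj.
Hypothesis bip : forall x y, adj x y -> side x != side y.

Lemma sat_hexagon rv rn : sat rv rn hexagon_formula <-> exists c, hole adj c 6.
Proof.
rewrite /hexagon_formula sat_exs; split=> [[rv' _]|[c [P Hc]]].
  case/andP=> edges nonedges; apply: (hexagon_hole adjC bip (x1 := rv' 0) (x2 := rv' 1)
    (x3 := rv' 2) (j1 := rv' 3) (j2 := rv' 4) (j3 := rv' 5)); first exact: edges.
  by rewrite !negb_or; exact: nonedges.
exists (fun y => nth (rv y) [:: c 0; c 2; c 4; c 3; c 5; c 1] y) => [y|].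
  by rewrite mem_iota => yl; rewrite nth_default //=; slia.
have cE i j : i < j < i + 6 -> adj (c i) (c j) = (j == i.+1) || (j.+1 == i + 6) by case/Hc.
by rewrite /= (adjC (c 2) (c 1)) (adjC (c 4) (c 3)) (adjC (c 4) (c 1)) !cE.
Qed.

Lemma no_unbalanced_hole :
  (forall c n, ~ smallest_unbalanced adj c n) -> ~ has_unbalanced_hole adj.
Proof.
move=> none [n [c [n5 n4 Hc]]].
have [N] := ubnP n; elim: N n c n5 n4 Hc => // N IH n c n5 n4 Hc nN.
by apply: (none c n); split=> // m c' m5 m4 mn Hc'; apply: (IH m c') => //; slia.
Qed.

Lemma sat_unbalanced rv rn : sat rv rn unbalanced_formula <-> has_unbalanced_hole adj.
Proof.
rewrite /unbalanced_formula !sat_or; split.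
  case/or4P.
  - by move/sat_hexagon => [c Hc]; exists 6, c.
  - move/sat_theta => [r [s [m [k [_ /(theta_frame_sound adjC bip)[a [b [X [Y [Z]]]]]]]]]].
    exact: (theta_unbalanced_hole adjC bip).
  - move/sat_tent => [p1 [p2 [c1 [c2 [a1 [b1 [r1 [a2 [b2 [r2]]]]]]]]]].
    exact: (tent_frame_sound adjC bip).
  - move/sat_hole => [u [um [up [v [vm [vp [x [a [_]]]]]]]]].
    exact: (hole_frame_sound adjC).
move=> U; apply/negPn/negP; rewrite !negb_or => /and4P[no_hexagon no_theta no_tent no_hole].
apply: no_unbalanced_hole U => c n Cm.
have TF : theta_free adj side.
  apply: (theta_free_of_frame_free adjC bip) => r s m k kb frame.
  by case/negP: no_theta; apply/sat_theta; exists r, s, m, k.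
have TNF : tent_free adj.
  move=> p1 p2 c1 c2 a1 b1 r1 a2 b2 r2; apply/negP => frame.
  by case/negP: no_tent; apply/sat_tent; exists p1, p2, c1, c2, a1, b1, r1, a2, b2, r2.
have [n5 n4 Hc _] := Cm; have [n6|n6] := eqVneq n 6.
  by case/negP: no_hexagon; apply/sat_hexagon; exists c; rewrite -n6.
by case/negP: no_hole; apply/sat_hole; apply: (hole_frame_complete adjC bip Cm) => //; slia.
Qed.

End Meaning.

(** * The recognition algorithm *)

Definition closed_adj_formula x z : formula := FOr (FEq x z) (FAdj x z).

Definition common_nbh_formula x y z : formula :=
  closed_adj_formula x z &&& closed_adj_formula y z.

Definition clique_pair_formula x y : formula :=
  FAdj x y &&&
  FAllPairs (common_nbh_formula x y 0) (common_nbh_formula x y 1) (FOr (FEq 0 1) (FAdj 0 1)).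

Definition extended_triangle_formula : formula := FExs (iota 0 6)
  ((FAdj 0 1 &&& FAdj 1 2 &&& FAdj 0 2) &&&
   (closed_adj_formula 0 3 &&& closed_adj_formula 1 3 &&& FNot (closed_adj_formula 2 3)) &&&
   (closed_adj_formula 1 4 &&& closed_adj_formula 2 4 &&& FNot (closed_adj_formula 0 4)) &&&
   (closed_adj_formula 0 5 &&& closed_adj_formula 2 5 &&& FNot (closed_adj_formula 1 5))).

(* In the next three formulas the variables 2, 3 and 4, 5 hold pairs of vertices. *)
Definition pair_adj_formula : formula :=
  FOr (FEq 2 3 &&& clique_pair_formula 4 5 &&& common_nbh_formula 4 5 2)
      (FEq 4 5 &&& clique_pair_formula 2 3 &&& common_nbh_formula 2 3 4).

Definition same_nbh_formula : formula :=
  FAll 0 (FImp (common_nbh_formula 2 3 0) (common_nbh_formula 4 5 0) &&&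
          FImp (common_nbh_formula 4 5 0) (common_nbh_formula 2 3 0)).

Definition central_formula : formula :=
  FAll 2 (FAll 3 (FImp (clique_pair_formula 2 3) (common_nbh_formula 2 3 4))).

Section Formulas.
Variables (T : finType) (e : rel T).
Notation sat := (sat e).

Lemma sat_closed_adj rv rn x z :
  sat rv rn (closed_adj_formula x z) = closed_adj e (rv x) (rv z).
Proof. by rewrite sat_or. Qed.

Lemma sat_common_nbh rv rn x y z :
  sat rv rn (common_nbh_formula x y z) = (rv z \in common_nbh e (rv x) (rv y)).
Proof. by rewrite sat_and !sat_closed_adj inE. Qed.

Lemma sat_clique_pair rv rn x y :
  sat rv rn (clique_pair_formula x.+2 y.+2) = clique_pair e (rv x.+2, rv y.+2).
Proof.
rewrite sat_and /clique_pair; congr (_ && _).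
pose nbr v := v \in common_nbh e (rv x.+2) (rv y.+2).
have pairsP : sat rv rn (FAllPairs (common_nbh_formula x.+2 y.+2 0)
    (common_nbh_formula x.+2 y.+2 1) (FOr (FEq 0 1) (FAdj 0 1))) <->
    forall a b, nbr a -> nbr b ->
      sat (assign 1 b (assign 0 a rv)) rn (FOr (FEq 0 1) (FAdj 0 1)).
  by apply: sat_all_pairs => a b; rewrite sat_common_nbh.
apply/idP/cliqueP => [/pairsP pairs a b aK bK ab|K_clique].
  by have := pairs a b aK bK; rewrite sat_or /= /assign /= (negbTE ab).
by apply/pairsP => a b aK bK; rewrite sat_or /= /assign /=; case: eqVneq => //= ab; apply: K_clique.
Qed.

Lemma sat_extended_triangle rv rn :
  sat rv rn extended_triangle_formula <-> extended_triangle e.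
Proof.
have not_closed rv' x z :
    sat rv' rn (FNot (closed_adj_formula x z)) = ~~ closed_adj e (rv' x) (rv' z).
  by rewrite sat_not sat_closed_adj.
rewrite /extended_triangle_formula sat_exs; split.
  move=> [rv' _]; rewrite !sat_and !not_closed !sat_closed_adj => /and4P[xyz a b c].
  by exists (rv' 0), (rv' 1), (rv' 2), (rv' 3), (rv' 4), (rv' 5).
move=> [x [y [z [a [b [c [xyz xya yzb xzc]]]]]]].
exists (fun k => nth (rv k) [:: x; y; z; a; b; c] k) => [k|].
  by rewrite mem_iota => kl; rewrite nth_default //=; slia.
by rewrite !sat_and !not_closed !sat_closed_adj; apply/and4P.
Qed.

Lemma sat_pair_adj rv rn :
  sat rv rn pair_adj_formula = pair_adj e (rv 2, rv 3) (rv 4, rv 5).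
Proof.
by rewrite sat_or; congr (_ || _); rewrite 2!sat_and sat_clique_pair sat_common_nbh.
Qed.

Lemma sat_same_nbh rv rn : sat rv rn same_nbh_formula =
  (common_nbh e (rv 2) (rv 3) == common_nbh e (rv 4) (rv 5)).
Proof.
rewrite sat_all; apply/forallP/eqP => [same|same z]; last first.
  by rewrite sat_and !sat_imp !sat_common_nbh /assign /= same implybb.
apply/setP => z; have := same z; rewrite sat_and !sat_imp !sat_common_nbh /assign /=.
by case: (z \in _); case: (z \in _).
Qed.

Lemma sat_central rv rn : sat rv rn central_formula = central e (rv 4).
Proof.
rewrite sat_all; apply/forallP/forallP => [all_nbh [x y]|all_nbh x].
  have := all_nbh x; rewrite sat_all => /forallP/(_ y).
  by rewrite sat_imp sat_clique_pair sat_common_nbh.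
rewrite sat_all; apply/forallP => y; have := all_nbh (x, y).
by rewrite sat_imp sat_clique_pair sat_common_nbh.
Qed.

End Formulas.

(* The vertex [i] of the input graph is represented by any tree [t] with [tree_nat t = i]. *)
Definition vertex_adj (t t' inp : tree) : bool :=
  is_node (hd_tree (tree_drop t' (hd_tree (tree_drop t inp)))).

Definition vertex_eq (t t' inp : tree) : bool := tree_nat t == tree_nat t'.

Definition vertices (inp : tree) : tree := nat_trees (tree_nat inp).

Lemma ptimeb_vertex_adj :
  ptimeb (fun d => vertex_adj (hd_tree d) (hd_tree (tl_tree d)) (tl_tree (tl_tree d))).
Proof.
apply: ptimeb_is_node; apply: ptime_hd; apply: ptime_drop; first by ptime_tac.
by apply: ptime_hd; apply: ptime_drop; ptime_tac.
Qed.

Lemma ptimeb_vertex_eq :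
  ptimeb (fun d => vertex_eq (hd_tree d) (hd_tree (tl_tree d)) (tl_tree (tl_tree d))).
Proof. by apply: ptimeb_eq; ptime_tac. Qed.

Lemma ptime_vertices : ptime vertices.
Proof. exact: ptime_nat_trees ptime_id. Qed.

Notation eval_vertices := (eval_formula vertex_adj vertex_eq vertices).

Definition env_of_pairs (t t' : tree) : tree :=
  enc_seq [:: Leaf; Leaf; hd_tree t; tl_tree t; hd_tree t'; tl_tree t'].

Definition vpair_adj (t t' inp : tree) : bool :=
  eval_vertices inp (env_of_pairs t t') Leaf pair_adj_formula.

Definition vpair_eq (t t' inp : tree) : bool :=
  (tree_nat (hd_tree t) == tree_nat (hd_tree t')) &&
  (tree_nat (tl_tree t) == tree_nat (tl_tree t')).

Definition vpairs (inp : tree) : tree := tree_prod (vertices inp) (vertices inp).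

Definition clique_pair_tree (t inp : tree) : bool :=
  eval_vertices inp (env_of_pairs t t) Leaf (clique_pair_formula 2 3).

Definition same_nbh_tree (t t' inp : tree) : bool :=
  eval_vertices inp (env_of_pairs t t') Leaf same_nbh_formula.

Definition central_tree (t inp : tree) : bool :=
  eval_vertices inp (env_of_pairs Leaf (Node t t)) Leaf central_formula.

Lemma ptimeb_eval_vertices f a b inp : ptime a -> ptime b -> ptime inp ->
  ptimeb (fun d => eval_vertices (inp d) (env_of_pairs (a d) (b d)) Leaf f).
Proof.
move=> Ha Hb Hinp; apply: (ptimeb_comp3 (P := fun venv nenv inp => eval_vertices inp venv nenv f)).
- exact: ptimeb_eval_formula ptimeb_vertex_adj ptimeb_vertex_eq ptime_vertices f.
- by rewrite /env_of_pairs /=; ptime_tac.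
- exact: ptime_leaf.
- by [].
Qed.

Lemma ptimeb_vpair_adj :
  ptimeb (fun d => vpair_adj (hd_tree d) (hd_tree (tl_tree d)) (tl_tree (tl_tree d))).
Proof. by apply: ptimeb_eval_vertices; ptime_tac. Qed.

Lemma ptimeb_vpair_eq :
  ptimeb (fun d => vpair_eq (hd_tree d) (hd_tree (tl_tree d)) (tl_tree (tl_tree d))).
Proof. by apply: ptimeb_and; apply: ptimeb_eq; ptime_tac. Qed.

Lemma ptime_vpairs : ptime vpairs.
Proof. exact: ptime_prod ptime_vertices ptime_vertices. Qed.

Notation eval_pairs := (eval_formula vpair_adj vpair_eq vpairs).

Definition add_clique_pair (acc t inp : tree) : tree :=
  if clique_pair_tree t inp && ~~ has (fun t' => same_nbh_tree t t' inp) (dec_seq acc)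
  then Node t acc else acc.

Definition clique_list (inp : tree) : tree :=
  foldl (fun acc t => add_clique_pair acc t inp) Leaf (dec_seq (vpairs inp)).

Lemma ptime_clique_list : ptime clique_list.
Proof.
have [q Hq vpairs_size] := ptime_size ptime_vpairs.
apply: (@ptime_foldl add_clique_pair (fun=> Leaf) vpairs (fun n => 1 + q n * (1 + q n))).
- apply: ptime_if; try by ptime_tac.
  apply: ptimeb_and; first by apply: ptimeb_eval_vertices; ptime_tac.
  apply: ptimeb_not; apply: (@ptimeb_has (fun t' e =>
    same_nbh_tree (hd_tree (tl_tree e)) t' (tl_tree (tl_tree e))) hd_tree); last by ptime_tac.
  by apply: ptimeb_eval_vertices; ptime_tac.
- exact: ptime_leaf.
- exact: ptime_vpairs.
- by nat_poly_tac.
move=> d k; apply: leq_trans (tree_size_foldl (c := 1 + tree_size (vpairs d)) _ _ _) _.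
  by move=> acc x Hx; rewrite /add_clique_pair; case: ifP => _ /=; slia.
by rewrite leq_add2l leq_mul // leq_add2l.
Qed.

(* An input that is not a node is the graph without vertices, which is its own root. *)
Definition decide_osf_root (inp : tree) : bool :=
  ~~ is_node inp ||
  [&& ~~ eval_vertices inp Leaf Leaf extended_triangle_formula,
      ~~ eval_pairs inp Leaf Leaf unbalanced_formula
    & tree_nat (clique_list inp) <=
      tree_nat (tree_filter (fun t => central_tree t inp) (vertices inp))].

Lemma ptimeb_decide_osf_root : ptimeb decide_osf_root.
Proof.
have closed adjt eqt univ f :
    ptimeb (fun e => adjt (hd_tree e) (hd_tree (tl_tree e)) (tl_tree (tl_tree e))) ->
    ptimeb (fun e => eqt (hd_tree e) (hd_tree (tl_tree e)) (tl_tree (tl_tree e))) ->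
    ptime univ -> ptimeb (fun inp => eval_formula adjt eqt univ inp Leaf Leaf f).
  move=> Hadj Heq Huniv.
  apply: (ptimeb_comp3 (P := fun ev en inp => eval_formula adjt eqt univ inp ev en f));
    by [apply: ptimeb_eval_formula | ptime_tac].
apply: ptimeb_or; first by apply: ptimeb_not; apply: ptimeb_is_node; ptime_tac.
apply: ptimeb_and; [|apply: ptimeb_and].
- exact: ptimeb_not (closed _ _ _ _ ptimeb_vertex_adj ptimeb_vertex_eq ptime_vertices).
- exact: ptimeb_not (closed _ _ _ _ ptimeb_vpair_adj ptimeb_vpair_eq ptime_vpairs).
apply: ptimeb_leq; first exact: ptime_clique_list.
apply: ptime_filter; last exact: ptime_vertices.
by apply: ptimeb_eval_vertices; ptime_tac.
Qed.

Lemma hd_tree_drop t u : hd_tree (tree_drop t u) = nth Leaf (dec_seq u) (tree_nat t).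
Proof.
have -> v : hd_tree v = nth Leaf (dec_seq v) 0 by case: v.
by rewrite dec_seq_drop nth_drop addn0.
Qed.

Lemma env_get_leaf x : env_get x Leaf = Leaf.
Proof. by rewrite /env_get; have -> : iter x tl_tree Leaf = Leaf by elim: x => //= x ->. Qed.

Lemma dec_seq_nat_trees k : dec_seq (nat_trees k) = map nat_tree (rev (iota 0 k)).
Proof. by elim: k => // k IH; rewrite -addn1 iotaD rev_cat /= addn1 /= IH. Qed.

Definition add_class (A : Type) (B : eqType) (p : pred A) (f : A -> B) acc x : seq A :=
  if p x && ~~ has (fun y => f x == f y) acc then x :: acc else acc.

Lemma foldl_add_class (A : Type) (B : eqType) (p : pred A) (f : A -> B) s :
  let l := foldl (add_class p f) [::] s in uniq (map f l) /\ map f l =i map f (filter p s).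
Proof.
elim/last_ind: s => [|s x [l_uniq lE]] //=; rewrite foldl_rcons filter_rcons {1 3}/add_class.
set l := foldl _ _ _ in l_uniq lE *.
have -> : has (fun y => f x == f y) l = (f x \in map f l).
  by rewrite -has_pred1 has_map; apply: eq_has => y /=; rewrite eq_sym.
have [px|Npx] /= := boolP (p x); last by [].
have [xl|xl] /= := boolP (f x \in map f l).
  by split=> // b; rewrite map_rcons mem_rcons inE lE; case: eqVneq => // ->; rewrite -lE xl.
by rewrite xl; split=> // b; rewrite map_rcons mem_rcons !inE lE.
Qed.

Section Correctness.
Variables (n : nat) (e : rel 'I_n.+1).
Hypothesis eS : simple_graph e.

Let V := 'I_n.+1.
Let inp := enc_graph e.

Let repr_vertex (t : tree) (x : V) : Prop := tree_nat t = x.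
Let repr_pair (t : tree) (p : V * V) : Prop :=
  repr_vertex (hd_tree t) p.1 /\ repr_vertex (tl_tree t) p.2.

Let enc_vertex (x : V) : tree := nat_tree x.
Let enc_pair (p : V * V) : tree := Node (enc_vertex p.1) (enc_vertex p.2).

Let vertex_seq : seq V := rev (enum V).
Let pair_seq : seq (V * V) := rev [seq (x, y) | x <- vertex_seq, y <- vertex_seq].

Let size_inp : tree_nat inp = n.+1.
Proof. by rewrite tree_nat_enc_seq size_map size_enum_ord. Qed.

Let vertex_adjE t t' u v :
  repr_vertex t u -> repr_vertex t' v -> vertex_adj t t' inp = e u v.
Proof.
move=> tu tv; rewrite /vertex_adj !hd_tree_drop tu tv /inp /enc_graph dec_seqK.
rewrite (nth_map u) ?size_enum_ord // nth_ord_enum dec_seqK.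
by rewrite (nth_map v) ?size_enum_ord // nth_ord_enum; case: (e u v).
Qed.

Let vertex_eqE t t' u v :
  repr_vertex t u -> repr_vertex t' v -> vertex_eq t t' inp = (u == v).
Proof. by move=> tu tv; rewrite /vertex_eq tu tv val_eqE. Qed.

Let verticesE : dec_seq (vertices inp) = map enc_vertex vertex_seq.
Proof.
by rewrite /vertices size_inp dec_seq_nat_trees -val_enum_ord -map_rev -map_comp.
Qed.

Let enc_vertexK x : repr_vertex (enc_vertex x) x. Proof. exact: tree_nat_treeK. Qed.
Let mem_vertex_seq x : x \in vertex_seq. Proof. by rewrite mem_rev mem_enum. Qed.
Let size_vertex_seq : size vertex_seq = #|V|. Proof. by rewrite size_rev -cardE. Qed.

Let eval_verticesE f venv nenv rv rn :
  (forall x, repr_vertex (env_get x venv) (rv x)) ->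
  (forall i, tree_nat (env_get i nenv) = rn i) ->
  eval_vertices inp venv nenv f = sat e rv rn f.
Proof.
exact: (eval_formulaE vertex_adjE vertex_eqE verticesE enc_vertexK mem_vertex_seq
  size_vertex_seq).
Qed.

Let pairs_assignment (p q : V * V) k := nth ord0 [:: ord0; ord0; p.1; p.2; q.1; q.2] k.

Let eval_env_of_pairs f t t' p q : repr_pair t p -> repr_pair t' q ->
  eval_vertices inp (env_of_pairs t t') Leaf f = sat e (pairs_assignment p q) (fun=> 0) f.
Proof.
move=> [p1 p2] [q1 q2]; apply: eval_verticesE => [x|i]; last by rewrite env_get_leaf.
do 6 (case: x => [//|x]).
have -> : env_get x.+4.+2 (env_of_pairs t t') = env_get x Leaf by rewrite /env_get !iterSr.
by rewrite env_get_leaf /pairs_assignment /= nth_nil.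
Qed.

Let vpair_adjE t t' p q : repr_pair t p -> repr_pair t' q -> vpair_adj t t' inp = pair_adj e p q.
Proof.
move=> tp tq; rewrite /vpair_adj (eval_env_of_pairs _ tp tq) sat_pair_adj.
by case: p q {tp tq} => [? ?] [? ?].
Qed.

Let vpair_eqE t t' p q : repr_pair t p -> repr_pair t' q -> vpair_eq t t' inp = (p == q).
Proof. by move=> [t1 t2] [t1' t2']; rewrite /vpair_eq t1 t2 t1' t2' !val_eqE -pair_eqE. Qed.

Let vpairsE : dec_seq (vpairs inp) = map enc_pair pair_seq.
Proof.
rewrite /vpairs dec_seq_prod verticesE /pair_seq [RHS]map_rev; congr rev.
by rewrite map_allpairs allpairs_mapl; congr flatten; apply: eq_map => x; rewrite -map_comp.
Qed.

Let enc_pairK p : repr_pair (enc_pair p) p. Proof. by split; apply: enc_vertexK. Qed.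

Let mem_pair_seq p : p \in pair_seq.
Proof. by rewrite mem_rev; case: p => x y; apply/allpairsP; exists (x, y). Qed.

Let size_pair_seq : size pair_seq = #|{: V * V}|.
Proof. by rewrite size_rev size_allpairs size_vertex_seq card_prod. Qed.

Let nbh (p : V * V) := common_nbh e p.1 p.2.

Let clique_pair_treeE p : clique_pair_tree (enc_pair p) inp = clique_pair e p.
Proof.
rewrite /clique_pair_tree (eval_env_of_pairs _ (enc_pairK p) (enc_pairK p)) sat_clique_pair.
by case: p.
Qed.

Let same_nbh_treeE p q : same_nbh_tree (enc_pair p) (enc_pair q) inp = (nbh p == nbh q).
Proof.
by rewrite /same_nbh_tree (eval_env_of_pairs _ (enc_pairK p) (enc_pairK q)) sat_same_nbh.
Qed.

Let central_treeE x : central_tree (enc_vertex x) inp = central e x.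
Proof.
have leaf_repr : repr_pair Leaf (ord0, ord0) by [].
by rewrite /central_tree (eval_env_of_pairs _ leaf_repr (enc_pairK (x, x))) sat_central.
Qed.

Lemma clique_listE : dec_seq (clique_list inp) =
  map enc_pair (foldl (add_class (clique_pair e) nbh) [::] pair_seq).
Proof.
rewrite /clique_list vpairsE; elim/last_ind: pair_seq => //= s p IH.
rewrite map_rcons !foldl_rcons {1}/add_clique_pair {1}/add_class IH has_map clique_pair_treeE.
rewrite (eq_has (a2 := fun q => nbh p == nbh q)) => [|q]; last exact: same_nbh_treeE.
by case: ifP => //= _; rewrite IH.
Qed.

Lemma tree_nat_clique_list : tree_nat (clique_list inp) = #|pair_cliques e|.
Proof.
have [l_uniq lE] := foldl_add_class (clique_pair e) nbh pair_seq.
rewrite /tree_nat clique_listE size_map -(size_map nbh) -(card_uniqP l_uniq).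
apply: eq_card => K; rewrite lE; apply/mapP/imsetP => [[p]|[p]].
  by rewrite mem_filter => /andP[pK _] ->; exists p; rewrite ?inE.
by rewrite inE => pK ->; exists p => //; rewrite mem_filter pK mem_pair_seq.
Qed.

Lemma tree_nat_central :
  tree_nat (tree_filter (fun t => central_tree t inp) (vertices inp)) = #|[set v | central e v]|.
Proof.
rewrite /tree_nat size_tree_filter verticesE count_map (eq_count (a2 := central e)) => [|x].
  rewrite count_rev -sum1_count big_enum_cond -sum1_card.
  by apply: eq_bigl => x; rewrite !inE.
exact: central_treeE.
Qed.

Lemma decide_osf_rootE : decide_osf_root inp <-> has_osf_split_root e.
Proof.
rewrite osf_root_pairs // /decide_osf_root is_nodeE size_inp (_ : ~~ (0 < n.+1) = false) // orFb.
rewrite tree_nat_clique_list tree_nat_central.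
have -> : eval_vertices inp Leaf Leaf extended_triangle_formula =
    sat e (fun=> ord0) (fun=> 0) extended_triangle_formula.
  by apply: eval_verticesE => x; rewrite env_get_leaf.
have -> : eval_pairs inp Leaf Leaf unbalanced_formula =
    sat (pair_adj e) (fun=> (ord0, ord0)) (fun=> 0) unbalanced_formula.
  by apply: (eval_formulaE vpair_adjE vpair_eqE vpairsE enc_pairK mem_pair_seq size_pair_seq) => x;
    rewrite env_get_leaf.
have triangleP := sat_extended_triangle e (fun=> ord0) (fun=> 0).
have holeP := sat_unbalanced (@pair_adjC _ e) (pair_bip eS) (fun=> (ord0, ord0)) (fun=> 0).
split=> [/and3P[no_triangle no_hole count]|[no_triangle no_hole count]].
  by split=> // [/triangleP|/holeP]; exact/negP.
by apply/and3P; split=> //; [apply/negP => /triangleP | apply/negP => /holeP].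
Qed.

End Correctness.

Lemma osf_root_ord0 (e : rel 'I_0) : simple_graph e -> has_osf_split_root e.
Proof. by move=> eS; apply: edgeless_osf_root => // -[]. Qed.

Lemma tree_size_enc_seq c s :
  all (fun t => tree_size t <= c) s -> tree_size (enc_seq s) <= 1 + size s * (1 + c).
Proof. by elim: s => //= t s IH /andP[tc /IH]; slia. Qed.

Lemma tree_size_enc_graph n (e : rel 'I_n) : tree_size (enc_graph e) <= 1 + n * (2 + n * 4).
Proof.
apply: leq_trans (tree_size_enc_seq (c := 1 + n * 4) _) _; last first.
  by rewrite size_map size_enum_ord; slia.
rewrite all_map; apply/allP => i _ /=.
apply: leq_trans (tree_size_enc_seq (c := 3) _) _; last first.
  by rewrite size_map size_enum_ord.
by rewrite all_map; apply/allP => j _ /=; case: (e i j).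
Qed.

Lemma osf_root_recognizable :
  poly_time_recognizable (fun n (e : rel 'I_n) => has_osf_split_root e).
Proof.
have [c [m [p [_ Hp Hc]]]] := ptimeb_decide_osf_root.
have Hq : nat_poly (fun n => p (1 + n * (2 + n * 4))) by apply: (nat_poly_comp Hp); nat_poly_tac.
have [a [k bound]] := nat_poly_bound Hq; exists c, a, k => n e eS.
have [_ [s [[t run t_le] answer _]]] := Hc (init_store (enc_graph e)).
exists t, s; split=> //.
  apply: leq_trans t_le _; apply: leq_trans (bound n).
  exact: nat_poly_mono Hp (tree_size_enc_graph e).
have -> : s 0 <> Leaf <-> decide_osf_root (enc_graph e).
  by rewrite answer -[init_store _ 0]/(enc_graph e); case: (decide_osf_root _).
case: n e eS {run answer t_le} => [|n] e eS; last exact: decide_osf_rootE.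
have -> : decide_osf_root (enc_graph e) by rewrite /enc_graph (size0nil (size_enum_ord 0)).
by split=> // _; apply: osf_root_ord0.
Qed.

Theorem theorem11 :
  (forall (T : finType) (e : rel T), simple_graph e ->
     (has_connected_osf_split_root e <->
      balanced_graph e /\
      #|max_cliques e| <= #|\bigcap_(K in max_cliques e) K|)) /\
  poly_time_recognizable (fun n (e : rel 'I_n) => has_osf_split_root e).
Proof.
split; first exact: connected_osf_root_iff.
exact: osf_root_recognizable.
Qed.
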